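(* Let $\Gamma$ be a disconnected graph. Then $\Gamma$ is the Gruenberg-Kegel graph of a finite solvable group that is character-quadratic or semi-rational if and only if $\Gamma$ is one of the following seven graphs (each given by its vertex set $V$ and edge set $E$): - $V=\{2,3\}$, $E=\emptyset$; - $V=\{2,5\}$, $E=\emptyset$; - $V=\{3,7\}$, $E=\emptyset$; - $V=\{2,3,5\}$, $E=\{2-5\}$; - $V=\{2,3,5\}$, $E=\{2-3\}$; - $V=\{2,3,7\}$, $E=\{2-3\}$; - $V=\{2,3,13\}$, $E=\{2-3\}$.
   Context: All groups are finite. The Gruenberg-Kegel graph of a group $G$ is the simple undirected graph whose vertices are the prime divisors of $|G|$, two distinct vertices $p,q$ being adjacent if and only if $G$ contains an element of order $pq$; $p-q$ denotes the edge joining $p$ and $q$. Graphs are labelled by primes and compared as labelled graphs. For $\chi\in\mathrm{Irr}(G)$ (the set of complex irreducible characters of $G$), $\mathbb{Q}(\chi)=\mathbb{Q}(\chi(g)\mid g\in G)$; for $x\in G$, $\mathbb{Q}(x)=\mathbb{Q}(\psi(x)\mid \psi\in\mathrm{Irr}(G))$. $G$ is semi-rational if $[\mathbb{Q}(x):\mathbb{Q}]\le 2$ for every $x\in G$ (equivalently, for every $x\in G$ the generators of $\langle x\rangle$ lie in at most two conjugacy classes of $G$). $G$ is character-quadratic if $[\mathbb{Q}(\chi):\mathbb{Q}]\le 2$ for every $\chi\in\mathrm{Irr}(G)$. *)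

(* Defs.v *)
From HB Require Import structures.
From mathcomp Require Import all_boot all_order all_fingroup all_algebra.
From mathcomp Require Import all_solvable all_field all_character.
From mathcomp Require Import finmap.

Set Implicit Arguments.
Unset Strict Implicit.
Unset Printing Implicit Defensive.

Import GroupScope.

(* Finite simple graphs labelled by primes. An edge is the two-element set of
   its endpoints, so equality of labelled graphs is Leibniz equality. *)
Definition prime_graph_axiom (VE : {fset nat} * {fset {fset nat}}) : bool :=
  all prime VE.1 &&
  all (fun e : {fset nat} => (e `<=` VE.1)%fset && (#|` e|%fset == 2)) VE.2.

Record prime_graph : Type := PrimeGraph {
  graph_data : {fset nat} * {fset {fset nat}};
  graph_dataP : prime_graph_axiom graph_data
}.

Definition vertices (Gamma : prime_graph) : {fset nat} := (graph_data Gamma).1.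
Definition edges (Gamma : prime_graph) : {fset {fset nat}} :=
  (graph_data Gamma).2.

Definition adjacent (Gamma : prime_graph) : rel nat :=
  fun u v => [fset u; v]%fset \in edges Gamma.

Definition disconnected (Gamma : prime_graph) : Prop :=
  exists u v : nat,
    [/\ u \in vertices Gamma, v \in vertices Gamma &
        ~ exists s : seq nat, path (adjacent Gamma) u s /\ last u s = v].

Section GruenbergKegel.
Variables (gT : finGroupType) (G : {group gT}).

Definition GK_vertices : {fset nat} := [fset p in primes #|G|]%fset.

Definition GK_adj (p q : nat) : bool :=
  (p != q) && [exists x in G, #[x] == (p * q)%N].

Definition GK_edges : {fset {fset nat}} :=
  [fset [fset pq.1; pq.2]%fset
     | pq in [seq (p, q) | p <- primes #|G|, q <- primes #|G|]
     & GK_adj pq.1 pq.2]%fset.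

Lemma GK_graph_subproof : prime_graph_axiom (GK_vertices, GK_edges).
Proof.
apply/andP; split; apply/allP => /=.
  by move=> p; rewrite inE /= mem_primes => /andP[].
move=> e /imfsetP[[p q]] /=; rewrite inE /= => /andP[].
move=> /allpairsP[[p' q'] /= [p'G q'G [-> ->]]] /andP[npq _] ->.
rewrite cardfs2 npq eqxx andbT.
by apply/fsubsetP => r; rewrite !inE => /orP[]/eqP->.
Qed.

Definition GK_graph : prime_graph := PrimeGraph GK_graph_subproof.

End GruenbergKegel.

(* [num_field_exists s] provides a finite extension of rat, with an embedding
   in algC, whose image is the field generated by the entries of s. *)
Definition num_field (s : seq algC) : fieldExtType rat :=
  projT1 (num_field_exists s).

Definition degree_over_Q (s : seq algC) : nat := \dim {: num_field s}%VS.

Definition semi_rational (gT : finGroupType) (G : {group gT}) : Prop :=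
  forall x : gT, x \in G ->
    degree_over_Q [seq ('chi[G]_i)%R x | i : Iirr G] <= 2.

Definition character_quadratic (gT : finGroupType) (G : {group gT}) : Prop :=
  forall i : Iirr G,
    degree_over_Q [seq ('chi[G]_i)%R x | x in G] <= 2.

(* Main.v *)
Require Import Defs.
From mathcomp Require Import all_boot all_order all_fingroup all_algebra.
From mathcomp Require Import all_solvable all_field all_character.
From mathcomp Require Import finmap ring zify.

Set Implicit Arguments.
Unset Strict Implicit.
Unset Printing Implicit Defensive.

Import GroupScope GRing.Theory FiniteModule.

(** Let G be solvable with disconnected Gruenberg-Kegel graph, and character-quadratic
    or semi-rational. Both conditions say that two automorphisms of the algebraic
    numbers induce at most one nontrivial map on a set of character values; reading
    automorphisms as power maps x |-> x ^+ k gives one consequence common to the two: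
    x ^+ (k ^ 2) is conjugate to x for k prime to the order of x
    ([square_power_class]). On an element b of
    prime order q that commutes with an a of order prime to q, this is realized inside
    'C_G[a] ([square_power_cent], [prime_order_fusion]), so some g centralizing a acts
    on b with order (q - 1) / 2.

    Let pi be a connected component that contains a prime divisor of the order of the
    Fitting subgroup, and K = O_pi(G), which is nontrivial. No element of G has order
    divisible both by a prime in pi and by a prime outside pi. For each prime q dividing
    the order of K, an element of order q of K survives in some q-chief factor V below
    K, and K centralizes V ([chief_factor_exists]): Sylow subgroups of K for the other
    primes, taken invariant under a group of prime order outside pi, form Frobenius
    groups with it, and averaging forces them to centralize V ([Frobenius_kernel_cent]).
    Hence elements of order prime to pi act on V without nontrivial fixed points.

    If G / K has order prime to pi, it acts as a Frobenius complement H on V. Then the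
    Sylow subgroups of H are cyclic or quaternion, squares of power maps bound their
    orders and leave only the primes 2, 3 and 5, and no 15 divides the order. As H
    induces all v |-> v ^+ (k ^ 2) on each vector, V is covered by eigenspaces of the
    elements of a small set S. An eigenspace of h meets that of a distinct conjugate
    trivially, so its square is at most the order of V, and S cannot be too small
    ([cover_card_bound]). This leaves the table of [fixed_point_free_orders]. A prime
    q >= 5 of pi is then alone in pi: the element g above, centralizing a neighbour,
    would lie in K, which acts trivially on V.

    Otherwise the Fitting subgroup of G / K has prime order r outside pi, with cyclic
    quotient of order d, a pi-number, where (r, d) is one of six pairs
    ([upper_Frobenius_orders]), and the same count of eigenspaces shows that q >= 5 only
    for (r, q) = (3, 5) ([non_Frobenius_orders]). Both cases give graphs in the list.

    Conversely, the seven graphs belong to the groups of affine maps x |-> h x + v of a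
    finite field, with h in a group H acting without nonzero fixed points: H is cyclic
    of order 2, 3 or 6 over the fields of 3, 5, 7, 13 or 25 elements, and dicyclic of
    order 20 over the field of 81 elements. An affine map is a translation or is
    conjugate to an element of H, and in both cases the generators of the cyclic
    subgroup that it generates lie in at most two classes. *)

(** * The Galois action on character values *)

(** The Galois-theoretic form of degree at most two: all automorphisms that are
    nontrivial on s agree on s. *)
Definition quadratic_values (s : seq algC) : Prop :=
  forall u v : {rmorphism algC -> algC},
    [\/ {in s, u =1 id}, {in s, v =1 id} | {in s, u =1 v}].

Lemma quadratic_values_degree (s : seq algC) :
  degree_over_Q s <= 2 -> quadratic_values s.
Proof.
rewrite /degree_over_Q /num_field.
case: (num_field_exists s) => /= Qs [QsC [s1 <- gens1]] dimQ u v.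
have ratE (w : {rmorphism algC -> algC}) (a : rat) : w (QsC (a *: 1))%R = QsC (a *: 1)%R.
  by rewrite rmorphZ_num rmorph1 mulr1 fmorph_rat.
have [/allP rat1 | /allPn[z s1z nz]] := boolP (all (mem 1%VS) s1).
  apply: Or31 => _ /mapP[y /rat1 /vlineP[a ->] ->].
  exact: ratE.
have free1z: free [:: 1%R; z].
  rewrite free_cons span_seq1 seq1_free.
  apply/andP; split; last by apply: contraNneq nz => ->; apply: mem0v.
  apply: contraNN nz => /vlineP[a a1]; apply/vlineP; exists a^-1%R.
  have nza: a != 0%R.
    by apply/eqP => a0; have /eqP := oner_neq0 Qs; rewrite a1 a0 scale0r.
  by rewrite a1 scalerA mulVf ?scale1r.
have spanQ y : exists a b : rat, y = (a *: 1 + b *: z)%R.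
  have: y \in <<[:: 1%R; z]>>%VS.
    have /eqP ->: <<[:: 1%R; z]>>%VS == fullv :> {vspace Qs}.
      by rewrite eqEdim subvf (eqnP free1z).
    exact: memvf.
  rewrite span_cons span_seq1 => /memv_addP[_ /vlineP[a ->] [_ /vlineP[b ->] ->]].
  by exists a, b.
have fixall (w w' : {rmorphism algC -> algC}) : w (QsC z) = w' (QsC z) ->
    {in map QsC s1, w =1 w'}.
  move=> wz _ /mapP[y _ ->]; have [a [b ->]] := spanQ y.
  rewrite !rmorphD /= !ratE -[z]mul1r scalerAl !(rmorphM QsC) !rmorphM /= !ratE.
  by rewrite wz.
have [a [b zz]] := spanQ (z * z)%R.
have conj (w : {rmorphism algC -> algC}) :
    w (QsC z) = QsC z \/ w (QsC z) = (ratr b - QsC z)%R.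
  have eqz : (QsC z * QsC z = ratr a + ratr b * QsC z)%R.
    rewrite -rmorphM zz rmorphD /= rmorphZ_num rmorph1 mulr1.
    by rewrite -[z in LHS]mul1r scalerAl rmorphM rmorphZ_num rmorph1 mulr1.
  have eqw : (w (QsC z) * w (QsC z) = ratr a + ratr b * w (QsC z))%R.
    by rewrite -rmorphM eqz rmorphD [w (ratr b * _)%R]rmorphM [w (ratr a)]fmorph_rat [w (ratr b)]fmorph_rat.
  have: ((w (QsC z) - QsC z) * (w (QsC z) + QsC z - ratr b) == 0)%R.
    apply/eqP; set y := w _ in eqw *; set x := QsC z in eqz *.
    have -> : ((y - x) * (y + x - ratr b) = (y * y - ratr b * y) - (x * x - ratr b * x))%R by ring.
    by rewrite eqw eqz !addrK subrr.
  rewrite mulf_eq0 !subr_eq0 => /orP[] /eqP; first by left.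
  by move=> <-; right; rewrite addrK.
have [uz|uz] := conj u; first by apply: Or31; apply: (fixall u idfun).
have [vz|vz] := conj v; first by apply: Or32; apply: (fixall v idfun).
by apply: Or33; apply: fixall; rewrite uz vz.
Qed.

(** An automorphism that raises the roots of unity of order dividing #[x] to
    the power k sends chi x to chi (x ^+ k): restrict chi to the cyclic group
    generated by x and split it into linear characters. *)
Lemma char_power_aut (gT : finGroupType) (G : {group gT}) (chi : 'CF(G)) x k
    (u : {rmorphism algC -> algC}) :
  chi \is a character -> x \in G -> (forall z, z ^+ #[x] = 1 -> u z = z ^+ k)%R ->
  u (chi x) = chi (x ^+ k).
Proof.
move=> Nchi Gx uE; have sXG: <[x]> \subset G by rewrite cycle_subG.
have Xx: x \in <[x]> by apply: cycle_id.
have /char_sum_irrP[n Dchi]: ('Res[<[x]>] chi)%R \is a character by apply: cfRes_char.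
rewrite -(cfResE chi sXG Xx) -(cfResE chi sXG (mem_cycle x k)) Dchi !sum_cfunE rmorph_sum /=.
apply: eq_bigr => i _; rewrite !cfunE rmorphM /= rmorph_nat; congr (_ * _)%R.
have lin_i: ('chi_i)%R \is a linear_char by apply/irr_cyclic_lin/cycle_cyclic.
rewrite uE ?lin_charX //.
by rewrite -lin_charX // expg_order lin_char1.
Qed.

Definition quadratic_characters (gT : finGroupType) (G : {group gT}) : Prop :=
  (forall i : Iirr G, quadratic_values [seq ('chi[G]_i)%R x | x in G]) \/
  (forall x : gT, x \in G -> quadratic_values [seq ('chi[G]_i)%R x | i : Iirr G]).

Lemma quadratic_charactersP (gT : finGroupType) (G : {group gT}) :
  character_quadratic G \/ semi_rational G -> quadratic_characters G.
Proof.
by case=> H; [left=> i | right=> x Gx]; apply: quadratic_values_degree;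
  [apply: H | apply: H].
Qed.

Lemma quadratic_values_sub (s t : seq algC) :
  {subset s <= t} -> quadratic_values t -> quadratic_values s.
Proof.
by move=> sst qt u v; case: (qt u v) => E; [apply: Or31 | apply: Or32 | apply: Or33];
  apply: sub_in1 E.
Qed.

Lemma quadratic_characters_morphim (aT rT : finGroupType) (G D : {group aT})
    (f : {morphism D >-> rT}) :
  G \subset D -> quadratic_characters G -> quadratic_characters (f @* G).
Proof.
move=> sGD; have chiE i x (Gx : x \in G) :
  ('chi[f @* G]_i (f x) = 'chi[G]_(morph_Iirr i) x)%R.
- by rewrite morph_IirrE // cfMorphE.
case=> [qG | qG]; [left=> i | right=> y /morphimP[x Dx Gx ->{y}]].
  apply: quadratic_values_sub (qG (morph_Iirr i)) => _ /imageP[y fGy ->].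
  have [x Dx Gx ->] := morphimP fGy; rewrite chiE //.
  by apply/imageP; exists x.
apply: quadratic_values_sub (qG x Gx) => _ /imageP[i _ ->].
by rewrite chiE //; apply/imageP; exists (morph_Iirr i).
Qed.

Lemma quadratic_characters_quotient (gT : finGroupType) (G N : {group gT}) :
  N <| G -> quadratic_characters G -> quadratic_characters (G / N).
Proof. by move=> /normal_norm nNG; apply: quadratic_characters_morphim. Qed.

Lemma quadratic_characters_isog (aT rT : finGroupType) (G : {group aT}) (H : {group rT}) :
  G \isog H -> quadratic_characters G -> quadratic_characters H.
Proof.
case/isogP=> f _ fG; have <-: (f @* G)%G = H by apply: val_inj.
exact: quadratic_characters_morphim.
Qed.

(** The square of an automorphism u fixes every quadratic value, and if u raises
    roots of unity to the power k, its square takes chi x to chi (x ^+ (k ^ 2)). *)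
Lemma square_power_class (gT : finGroupType) (G : {group gT}) x k :
  quadratic_characters G -> x \in G -> coprime k #[x] -> x ^+ (k ^ 2) \in x ^: G.
Proof.
move=> qG Gx /Qn_aut_exists[u uE].
have uuE i : (u (u ('chi[G]_i x)) = 'chi_i (x ^+ (k ^ 2))%g)%R.
  rewrite (char_power_aut (irr_char i) Gx uE).
  rewrite (char_power_aut (k := k) (irr_char i) (groupX k Gx)) -?expgM ?mulnn //.
  move=> z z1; apply: uE.
  have /dvdnP[m ->]: #[x ^+ k] %| #[x] by rewrite orderXdvd.
  by rewrite mulnC exprM z1 expr1n.
suffices fixuu i : (u (u ('chi[G]_i x)) = 'chi_i x)%R.
  by rewrite class_sym; apply/eq_irr_mem_classP; rewrite ?groupX // => i; rewrite -uuE fixuu.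
pose uu : {rmorphism algC -> algC} := u \o u.
have qs : exists2 s, quadratic_values s & ('chi_i x)%R \in s.
  case: qG => qG; [exists [seq 'chi[G]_i y | y in G]%R | exists [seq 'chi[G]_i x | i : Iirr G]%R] => //;
    try exact: qG.
    by apply/imageP; exists x.
  by apply/imageP; exists i.
have [s qs_s s_x] := qs.
case: (qs_s u uu) => /(_ _ s_x) E; first by rewrite !E.
  exact: E.
by have Ec := fmorph_inj u E; rewrite -!Ec.
Qed.

Lemma cyclic_faithful_lin (gT : finGroupType) (x : gT) :
  exists2 i : Iirr <[x]>, ('chi_i \is a linear_char)%R & (cfaithful 'chi_i)%R.
Proof.
have n_gt0 := order_gt0 x.
have [w prim_w] := C_prim_root_exists n_gt0.
pose lg y : nat := odflt ord0 [pick m : 'I_#[x].+1 | y == x ^+ m].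
have lgP y : y \in <[x]> -> y = x ^+ lg y.
  move=> Xy; rewrite /lg; case: pickP => [m /eqP // | nolg].
  have [m ltm Dy] := cyclePmin Xy; have := nolg (Ordinal (ltnW ltm : m < #[x].+1)).
  by rewrite /= -Dy eqxx.
pose r y : 'M[algC]_1 := ((w ^+ lg y)%:M)%R.
have wE (m k : nat) : x ^+ m = x ^+ k -> (w ^+ m = w ^+ k)%R.
  by move/eqP; rewrite eq_expg_mod_order => /eqP E; rewrite -(prim_expr_mod prim_w m) E prim_expr_mod.
have r_repr : mx_repr <[x]> r.
  split=> [|y z Xy Xz]; first by rewrite /r (wE _ 0) -?lgP ?group1.
  rewrite /r -scalar_mxM -exprD; congr (_%:M)%R; apply: wE.
  by rewrite -lgP ?groupM // expgD -!lgP.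
pose rG := MxRepresentation r_repr.
have chir := cfRepr_char rG.
have lin_r: cfRepr rG \is a linear_char by rewrite qualifE /= chir cfRepr1 eqxx.
have /irrP[i Di] := lin_char_irr lin_r.
exists i; rewrite -Di //.
apply/subsetP=> y; rewrite cfker_repr => /rkerP[Xy].
rewrite /= /r => /matrixP/(_ 0 0)%R; rewrite !mxE eqxx !mulr1n => E.
rewrite inE (lgP y Xy) -(expg0 x) eq_expg_mod_order.
by rewrite -(eq_prim_root_expr prim_w) E expr0.
Qed.

(** For values at x the three cases are those of the definition, applied to the
    automorphisms of exponents k1 and k2. For character fields, look at an irreducible character over a faithful linear
    character lambda of <[x]>; by Clifford its restriction is a multiple of the
    sum of the conjugates of lambda. *)
Lemma normal_cyclic_powers (gT : finGroupType) (G : {group gT}) x k1 k2 :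
    quadratic_characters G -> <[x]> <| G -> coprime k1 #[x] -> coprime k2 #[x] ->
  [\/ x ^+ k1 \in x ^: G, x ^+ k2 \in x ^: G | x ^+ k1 \in (x ^+ k2) ^: G].
Proof.
move=> qG nXG /Qn_aut_exists[u uE] /Qn_aut_exists[v vE].
have Gx: x \in G by rewrite -cycle_subG normal_sub.
case: qG => [qG | /(_ x Gx) qG]; last first.
  have mem i : ('chi[G]_i x \in [seq 'chi[G]_i x | i : Iirr G])%R by apply/imageP; exists i.
  case: (qG u v) => E; [apply: Or31 | apply: Or32 | apply: Or33].
  - rewrite class_sym; apply/eq_irr_mem_classP; rewrite ?groupX // => i.
    by rewrite -(char_power_aut (irr_char i) Gx uE) E.
  - rewrite class_sym; apply/eq_irr_mem_classP; rewrite ?groupX // => i.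
    by rewrite -(char_power_aut (irr_char i) Gx vE) E.
  - apply/eq_irr_mem_classP; rewrite ?groupX // => i.
    by rewrite -(char_power_aut (irr_char i) Gx uE) -(char_power_aut (irr_char i) Gx vE) E.
have [j lin_j ker_j] := cyclic_faithful_lin x.
have [i] := constt_cfInd_irr j (normal_sub nXG); rewrite constt_Ind_Res => jRi.
have inj_j := fful_lin_char_inj lin_j ker_j.
have Xx: x \in <[x]> by apply: cycle_id.
have nXx y : y \in G -> x ^ y \in <[x]>.
  by move=> Gy; rewrite memJ_norm // (subsetP (normal_norm nXG)).
have key (w w' : {rmorphism algC -> algC}) k k' :
    (forall z, z ^+ #[x] = 1 -> w z = z ^+ k)%R ->
    (forall z, z ^+ #[x] = 1 -> w' z = z ^+ k')%R ->
    {in [seq 'chi[G]_i y | y in G]%R, w =1 w'} ->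
  x ^+ k \in (x ^+ k') ^: G.
- move=> wE w'E ww'; set chi := ('chi_i)%R in jRi ww'.
  have Ew: (cfAut w ('Res[<[x]>] chi) = cfAut w' ('Res[<[x]>] chi))%R.
    apply/cfunP=> y; rewrite !cfunE.
    have [Xy | nXy] := boolP (y \in <[x]>); last by rewrite cfun0 // !rmorph0.
    rewrite cfResE ?normal_sub //; apply: ww'; apply/imageP; exists y => //.
    by rewrite (subsetP (normal_sub nXG)).
  have: aut_Iirr w j \in irr_constt (cfAut w' ('Res[<[x]>] chi)%R).
    by rewrite -Ew irr_consttE aut_IirrE cfdot_aut_irr fmorph_eq0 -irr_consttE.
  have [m Dm] : exists m, aut_Iirr w' m = aut_Iirr w j.
    by exists (invF (@aut_Iirr_inj _ _ w') (aut_Iirr w j)); rewrite f_invF.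
  rewrite -Dm irr_consttE aut_IirrE cfdot_aut_irr fmorph_eq0.
  rewrite (Clifford_Res_sum_cfclass nXG jRi) cfdotZl mulf_eq0 negb_or cfdot_suml.
  case/andP=> _ nz_sum.
  have [g Gg Dmj]: exists2 g, g \in G & ('chi_m = ('chi_j ^ g)%CF)%R.
    apply/cfclassP; apply: contraNT nz_sum => notj; apply/eqP/big1_seq => xi /andP[_ jxi].
    have [g Gg Dxi] := cfclassP _ _ _ jxi; rewrite Dxi -conjg_IirrE cfdot_irr.
    case: eqP => // Em; case/negP: notj.
    by rewrite -Em conjg_IirrE -Dxi.
  have Eval : ('chi_j x ^+ k = 'chi_j (x ^ g^-1)%g ^+ k')%R.
    have := congr1 (fun i : Iirr <[x]> => ('chi_i)%R x) Dm; rewrite !aut_IirrE !cfunE.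
    rewrite Dmj cfConjgE ?(subsetP (normal_norm nXG)) //.
    have root1 y : y \in <[x]> -> ('chi_j y ^+ #[x] = 1)%R.
      case/cycleP=> l ->; rewrite -lin_charX ?mem_cycle //.
      by rewrite -expgM mulnC expgM expg_order expg1n lin_char1.
    by rewrite wE ?w'E ?root1 ?nXx ?groupV.
  apply/imsetP; exists g^-1; rewrite ?groupV // conjXg.
  apply: inj_j; rewrite ?groupX ?nXx ?groupV //.
  by rewrite !lin_charX ?nXx ?groupV.
case: (qG i u v) => E; [apply: Or31 | apply: Or32 | apply: Or33].
- have := key u idfun k1 1%N uE (fun z _ => erefl) E.
  by rewrite expg1.
- have := key v idfun k2 1%N vE (fun z _ => erefl) E.
  by rewrite expg1.
- exact: key u v k1 k2 uE vE E.
Qed.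

(** * Power maps on commuting elements *)

Lemma prime_primitive_root r : prime r ->
  exists2 a, coprime a r & forall m, (a ^ m == 1 %[mod r]) = (r.-1 %| m).
Proof.
move=> pr_r; have r_gt1 := prime_gt1 pr_r.
have F1 (n : nat) : (n%:R == 1 :> 'F_r)%R = (n == 1 %[mod r]).
  by rewrite -val_eqE /= val_Fp_nat // Fp_cast.
pose rs := [seq x <- enum 'F_r | x != 0%R].
have: has (r.-1.-primitive_root%R) rs.
  apply: has_prim_root.
  - by case: r r_gt1 {pr_r F1 rs} => [|[]].
  - apply/allP=> x; rewrite mem_filter => /andP[nz_x _]; apply/unity_rootP.
    have := expf_card x; rewrite card_Fp // -[in X in (_ ^+ X)%R](prednK (prime_gt0 pr_r)) exprS => /eqP.
    by rewrite -[X in _ == X]mulr1 (inj_eq (mulfI nz_x)) => /eqP.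
  - by rewrite filter_uniq ?enum_uniq.
  - rewrite size_filter (@eq_count _ _ (predC (pred1 (0%R : 'F_r)))) //.
    have := count_predC (pred1 (0%R : 'F_r)) (enum 'F_r).
    rewrite -cardE card_Fp // count_uniq_mem ?enum_uniq // mem_enum inE => Er.
    by rewrite -[X in X.-1]Er add1n.
case/hasP=> x _ prim_x; exists (x : nat).
  have ltxr : x < r by rewrite -[X in _ < X](Fp_cast pr_r) ltn_ord.
  rewrite coprime_sym prime_coprime // gtnNdvd //.
  rewrite lt0n; apply/negP=> /eqP x0.
  have := prim_expr_order prim_x; rewrite (_ : x = 0%R); last exact: val_inj.
  rewrite expr0n; case: (r.-1 =P 0)%N => [r0 | _ /eqP]; last by rewrite eq_sym oner_eq0.
  by case: r r_gt1 r0 {pr_r F1 rs x prim_x x0 ltxr} => [|[]].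
move=> m; rewrite -F1 (prim_order_dvd prim_x) natrX.
by rewrite (_ : (x : nat)%:R%R = x) // natr_Zp.
Qed.

(** Apply the conjugacy of powers to a * b, with an exponent congruent to 1 modulo
    the order of a and to k modulo the order of b. *)
Lemma square_power_cent (gT : finGroupType) (G : {group gT}) a b k :
    quadratic_characters G -> a \in G -> b \in G -> commute a b ->
    coprime #[a] #[b] -> coprime k #[b] ->
  exists2 g, g \in 'C_G[a] & b ^ g = b ^+ (k ^ 2).
Proof.
move=> qG Ga Gb cab co_ab co_k.
pose m := chinese #[a] #[b] 1 k; pose u := chinese #[a] #[b] 1 0.
have o_ab := orderM cab co_ab.
have am : a ^+ m = a.
  by apply/eqP; rewrite -[X in _ == X]expg1 eq_expg_mod_order chinese_modl.
have bm : b ^+ m = b ^+ k by apply/eqP; rewrite eq_expg_mod_order chinese_modr.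
have au : a ^+ u = a.
  by apply/eqP; rewrite -[X in _ == X]expg1 eq_expg_mod_order chinese_modl.
have bu : b ^+ u = 1.
  by apply/eqP; rewrite -[X in _ == X](expg0 b) eq_expg_mod_order chinese_modr.
have co_m : coprime m #[a * b].
  rewrite o_ab coprimeMr -coprime_modl chinese_modl // coprime_modl coprime1n /=.
  by rewrite -coprime_modl chinese_modr // coprime_modl.
have /imsetP[g Gg] := square_power_class qG (groupM Ga Gb) co_m.
have am2 : a ^+ (m ^ 2) = a by rewrite -mulnn expgM !am.
have bm2 : b ^+ (m ^ 2) = b ^+ (k ^ 2).
  by rewrite -mulnn expgM bm -expgM mulnC expgM bm -expgM mulnn.
rewrite expgMn // am2 bm2 conjMg => Eg.
have ag : a ^ g = a.
  have := congr1 (fun x => x ^+ u) Eg; rewrite -conjMg -conjXg.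
  rewrite !expgMn ?au ?bu ?mulg1 //; last by apply: commuteX.
  by rewrite -expgM mulnC expgM bu expg1n mulg1.
have cag : commute a g by apply/commgP/conjg_fixP.
exists g; first by rewrite inE Gg; apply/cent1P; apply: commute_sym.
by move: Eg; rewrite ag => /mulgI.
Qed.

(** Take k to be a primitive root modulo r, so that c = k ^ 2 has order (r - 1) / 2. *)
Lemma prime_order_fusion (gT : finGroupType) (G : {group gT}) a b r :
    quadratic_characters G -> a \in G -> b \in G -> commute a b ->
    coprime #[a] r -> prime r -> odd r -> #[b] = r ->
  exists c, exists2 g, g \in 'C_G[a] &
    (forall m, b ^ (g ^+ m) = b ^+ (c ^ m)) /\
    (forall m, (b ^+ (c ^ m) == b) = ((r.-1)./2 %| m)).
Proof.
move=> qG Ga Gb cab co_ar pr_r odd_r ob.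
have [k co_kr kP] := prime_primitive_root pr_r.
have [||g Cg bg] := square_power_cent qG Ga Gb cab (k := k); rewrite ?ob //.
exists (k ^ 2)%N; exists g => //; split=> m.
  elim: m => [|m IHm]; first by rewrite conjg1.
  by rewrite expgSr conjgM IHm conjXg bg -expgM -expnS.
rewrite -[X in _ == X]expg1 eq_expg_mod_order ob -expnM kP.
have -> : (r.-1 = 2 * (r.-1)./2)%N.
  by rewrite mul2n -[LHS]odd_double_half -subn1 oddB ?prime_gt0 // odd_r.
by rewrite mul2n doubleK -mul2n dvdn_pmul2l.
Qed.

(** * Frobenius groups acting on abelian groups *)

(** Averaging over a Frobenius group: a vector fixed by R, or by a conjugate of
    R, is zero, so in the sum of the translates of v over U * R, cut along the
    Frobenius partition, everything cancels but the sum over U and #|U| copies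
    of v; hence #|U| v is fixed by U. *)
Lemma Frobenius_kernel_cent (gT : finGroupType) (V U R : {group gT}) :
    abelian V -> coprime #|V| #|U| -> U \subset 'N(V) -> R \subset 'N(V) ->
    R \subset 'N(U) -> prime #|R| -> 'C_U(R) = 1 -> 'C_V(R) = 1 ->
  U \subset 'C(V).
Proof.
move=> abV co_VU nVU nVR nUR pr_R cUR cVR.
have [-> | ntU] := eqVneq (U : {set gT}) 1; first exact: sub1G.
pose L := U <*> R; have nVL : L \subset 'N(V) by rewrite join_subG nVU.
have frobL : [Frobenius L = U ><| R].
  apply/prime_FrobeniusP => //; split=> //; apply: sdprodEY => //.
  rewrite setIC; apply: prime_TIg => //; apply: contraL (prime_gt1 pr_R) => sRU.
  rewrite -leqNgt -trivg_card_le1 -subG1 -cUR subsetI sRU.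
  exact: cyclic_abelian (prime_cyclic pr_R).
have /and3P[/eqP covP trivP _] := Frobenius_partition frobL.
have fix0 (w : fmod_of abV) (S : {group gT}) : S \subset 'N(V) -> 'C_V(S) = 1 ->
    {in S, forall x, (w ^@ x = w)%R} -> (w = 0)%R.
  move=> nVS cVS fixw; apply: fmod_inj; apply/set1P; rewrite -[[set _]]cVS.
  rewrite inE fmodP; apply/centP=> x Sx; apply/commgP/conjg_fixP.
  by have := fmvalJ w (subsetP nVS x Sx); rewrite fixw // => <-.
have sum_fix (w : fmod_of abV) (S : {group gT}) : S \subset 'N(V) ->
    {in S, forall x, ((\sum_(y in S) w ^@ y) ^@ x = \sum_(y in S) w ^@ y)%R}.
  move=> nVS x Sx; rewrite actr_sum /= [RHS](reindex_inj (mulIg x)) /=.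
  rewrite [RHS](eq_bigl (mem S)) => [|y]; last by rewrite /= groupMr.
  by apply: eq_bigr => y Sy; rewrite actrM // (subsetP nVS).
have sum0 (w : fmod_of abV) (S : {group gT}) : S \subset 'N(V) -> 'C_V(S) = 1 ->
    (\sum_(y in S) w ^@ y = 0)%R.
  by move=> nVS cVS; apply: fix0 cVS _ => //; apply: sum_fix.
have key (w : fmod_of abV) : (\sum_(y in U) w ^@ y = w *+ #|R^# :^: U|)%R.
  have cVL : 'C_V(L) = 1.
    by apply/trivgP; rewrite -cVR setIS ?centS ?joing_subr.
  have := sum0 w [group of L] nVL cVL; rewrite (eq_bigl (fun y => y \in cover (gval U |: R^# :^: U))) => [|y]; last by rewrite covP.
  rewrite big_trivIset //=.
  have notU : gval U \notin R^# :^: U.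
    apply/imsetP=> [[u Uu EU]]; have := group1 U; rewrite EU.
    by rewrite conjD1g !inE eqxx.
  rewrite big_setU1 //= => /eqP; rewrite addr_eq0 => /eqP ->.
  rewrite -sumrN -sumr_const; apply: eq_bigr => _ /imsetP[u Uu ->].
  have nVRu : R :^ u \subset 'N(V) by rewrite -(normP (subsetP nVU u Uu)) normJ conjSg.
  have cVRu : 'C_V(R :^ u) = 1.
    by rewrite -(normP (subsetP nVU u Uu)) centJ -conjIg cVR conjs1g.
  have := sum0 w (R :^ u)%G nVRu cVRu.
  rewrite (bigD1 1) ?group1 //= actr1 => /eqP; rewrite addrC addr_eq0 => /eqP Ew.
  rewrite conjD1g -[RHS]opprK -Ew; congr (- _)%R; apply: eq_bigl => y.
  by rewrite !inE andbC.
have cardRU : #|R^# :^: U| = #|U|.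
  have := card_partition (Frobenius_partition frobL).
  have notU : gval U \notin R^# :^: U.
    apply/imsetP=> [[u Uu EU]]; have := group1 U; rewrite EU.
    by rewrite conjD1g !inE eqxx.
  rewrite big_setU1 //= (eq_bigr (fun _ => #|R|.-1)) => [|_ /imsetP[u Uu ->]]; last first.
    by rewrite cardJg [#|R|](cardsD1 1) group1.
  rewrite sum_nat_const; have [/eqP/sdprod_card <- _] := andP frobL.
  have R_gt0 := cardG_gt0 R; have R_gt1 := prime_gt1 pr_R.
  rewrite -[in X in X -> _](prednK R_gt0) mulnS => /addnI/eqP.
  by rewrite eqn_pmul2r ?ltn_predRL // => /eqP.
apply/centsP=> u Uu v Vv; apply/esym/commgP/conjg_fixP.
have nVu := subsetP nVU u Uu.
pose w := fmod abV v.
have := sum_fix w U nVU u Uu; rewrite key cardRU actZr => E.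
have {E} : (v ^ u) ^+ #|U| = v ^+ #|U|.
  by have := congr1 val E; rewrite /= !fmvalZ fmvalJ // fmodK.
move/(congr1 (fun z => z ^+ (expg_invn V #|U|))); rewrite !expgK // memJ_norm //.
Qed.

(** A minimal E-invariant subgroup of V is a faithful irreducible module, and an
    abelian group with such a module is cyclic. *)
Lemma semiregular_abelian_cyclic (gT : finGroupType) (V E : {group gT}) q :
    q.-abelem V -> V :!=: 1 -> E \subset 'N(V) -> semiregular V E -> abelian E ->
  cyclic E.
Proof.
move=> abV ntV nVE regE abE.
have [M minM sMV] := minnormal_exists ntV nVE.
have [/andP[ntM nME] _] := mingroupP minM.
have abM := abelemS sMV abV.
have ffM : mx_faithful (abelem_repr abM ntM nME).
  apply: abelem_mx_faithful; apply/trivgP/subsetP=> x /setIP[Ex cMx].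
  apply: contraNT ntM; rewrite inE -subG1 => nt_x; rewrite -(regE x) ?inE ?nt_x //.
  by rewrite subsetI sMV sub_cent1.
by apply: mx_faithful_irr_abelian_cyclic ffM _ abE; apply/abelem_mx_irrP.
Qed.

(** Count V^# along the cover: if e is the largest order of an E i, then e ^ 2
    is at most #|V| and #|V| - 1 at most #|S| * (e - 1). *)
Lemma cover_card_bound (gT : finGroupType) (I : finType) (S : {set I}) (V : {group gT})
    (E : I -> {group gT}) :
    V :!=: 1 -> (forall i, i \in S -> E i \subset V /\ (#|E i| ^ 2 <= #|V|)%N) ->
    (forall v, v \in V^# -> exists2 i, i \in S & v \in E i) ->
  exists e, [/\ 1 < e, e %| #|V|, e ^ 2 <= #|V| & #|V| <= 1 + #|S| * e.-1]%N.
Proof.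
move=> ntV EV cov.
have [v Vv] : exists v, v \in V^#.
  by apply/set0Pn; rewrite -subset0 subDset setU0 subG1.
have [i0 Si0 Ei0v] := cov v Vv.
pose i1 := [arg max_(i > i0 in S) #|E i|].
have [Si1 max1] : i1 \in S /\ forall i, i \in S -> #|E i| <= #|E i1|.
  by rewrite /i1; case: arg_maxnP.
exists #|E i1|; have [sE1 lE1] := EV i1 Si1; split=> //.
- rewrite (leq_trans _ (max1 i0 Si0)) // cardG_gt1; apply: contraTneq Ei0v => ->.
  by case/setD1P: Vv => ntv _; rewrite inE.
- exact: cardSg.
rewrite (cardsD1 1) group1 leq_add2l.
have /subset_leq_card : V^# \subset \bigcup_(i in S) (E i)^#.
  apply/subsetP=> x Vx; have [i Si Eix] := cov x Vx; apply/bigcupP; exists i => //.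
  by rewrite inE Eix andbT; case/setD1P: Vx; rewrite inE.
move/leq_trans; apply; apply: leq_trans (_ : \sum_(i in S) #|(E i)^#| <= _).
  elim/big_rec2: _ => [|i n A _ leAn]; first by rewrite cards0.
  by rewrite (leq_trans (leq_card_setU _ _).1) // leq_add2l.
rewrite -sum_nat_const; apply: leq_sum => i Si.
by have := max1 i Si; rewrite (cardsD1 1 (E i)) group1; case: #|E i1|.
Qed.

(** * Cyclic quotients and fixed-point-free groups *)

(** Test k = 2 for odd n, and k = n / 2 + 1 or n / 2 + 2 for even n. *)
Lemma units_pm1 n : 0 < n ->
    (forall k, coprime k n -> (n %| k - 1) || (n %| k + 1)) ->
  n \in [:: 1%N; 2; 3; 4; 6].
Proof.
move=> n_gt0 units.
have bound m k : 0 < m - 1 -> coprime m n -> n = k -> (k <= m - 1) || (k <= m + 1).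
  move=> m_gt1 co_m <-; case/orP: (units m co_m) => /dvdn_leq -> //; rewrite ?orbT //.
  by rewrite addn1.
have [odd_n | even_n] := boolP (odd n).
  have := bound 2 n isT; rewrite coprime2n odd_n => /(_ isT erefl) le_n3.
  case: n n_gt0 odd_n le_n3 {units bound} => [|[|[|[|n]]]] //=; lia.
have [m Dn] : exists m, n = m.*2 by exists n./2; rewrite even_halfK.
have [odd_m | even_m] := boolP (odd m).
  have co_n : coprime (m + 2) n.
    rewrite Dn -mul2n coprimeMr coprimen2 oddD odd_m /=.
    by rewrite /coprime gcdnC gcdnDl -/(coprime m 2) coprimen2 odd_m.
  have := bound (m + 2)%N _ _ co_n Dn.
  case: m odd_m Dn {co_n} => [|[|[|[|[|m]]]]] //= _ -> //; rewrite /= -addnn; lia.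
have co_n : coprime (m + 1) n.
  rewrite Dn -mul2n coprimeMr coprimen2 oddD addbT even_m /=.
  by rewrite /coprime gcdnC gcdnDl gcdn1.
have := bound (m + 1)%N _ _ co_n Dn.
case: m even_m Dn {co_n} => [|[|[|m]]] //= even_m Dn; rewrite /= ?Dn // -addnn; last by lia.
by rewrite Dn in n_gt0.
Qed.

(** Conjugacy is equality in the cyclic group generated by x, so comparing the
    exponents k and -1 leaves only k = 1 and k = -1. *)
Lemma cyclic_quotient_order (gT : finGroupType) (G N : {group gT}) :
    quadratic_characters G -> N <| G -> cyclic (G / N) ->
  #|G / N| \in [:: 1%N; 2; 3; 4; 6].
Proof.
move=> qG nNG /cyclicP[x defL]; have qL := quadratic_characters_quotient nNG qG.
have Ex : (G / N)%G = <[x]>%G by apply: val_inj.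
have {}qL : quadratic_characters <[x]> by rewrite -Ex.
rewrite defL -orderE; have abX : abelian <[x]> := cycle_abelian x.
have classX y z : z \in <[x]> -> (y \in z ^: <[x]>) = (y == z).
  by move=> Xz; rewrite (elimT (abelian_classP _) abX z Xz) inE.
apply: units_pm1 => // k co_k.
have co_N : coprime (#[x].-1) #[x] by rewrite coprime_sym coprimenP.
have := normal_cyclic_powers qL (normal_refl _) co_k co_N.
have dvdE m l : l <= m -> x ^+ m = x ^+ l -> #[x] %| m - l.
  by move=> le_lm /eqP; rewrite eq_expg_mod_order eqn_mod_dvd.
have [k0 | k_gt0] := posnP k.
  by move: co_k; rewrite k0 /coprime gcd0n => /eqP ->; rewrite dvd1n.
case; rewrite classX ?cycle_id ?mem_cycle // => /eqP E.
- by rewrite dvdE ?expg1.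
- have E1: x ^+ 2 = x ^+ 0.
    by rewrite expgS expg1 -[X in _ * X]E -expgS prednK // expg_order.
  have := dvdE 2 0 isT E1; rewrite subn0 => /(@dvdn_leq _ 2 isT); have := order_gt0 x.
  case o2: #[x] => [|[|[|n]]] // _ _; first by rewrite dvd1n.
  by rewrite o2 coprimen2 in co_k; rewrite [in X in _ || X]dvdn2 addn1 /= co_k orbT.
- have /eqP := congr1 (mulg^~ x) E; rewrite /= -!expgSr prednK // expg_order.
  by rewrite -order_dvdn addn1 => ->; rewrite orbT.
Qed.

Section FixedPointFree.

Variables (gT : finGroupType) (q : nat) (V H : {group gT}).
Hypotheses (abV : q.-abelem V) (ntV : V :!=: 1) (nVH : H \subset 'N(V)).
Hypothesis regH : semiregular V H.

Let fixV x v : x \in H -> v \in V -> v ^ x = v -> v != 1 -> x = 1.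
Proof.
move=> Hx Vv vx ntv; apply: contraNeq ntv => ntx.
have cvx : commute v x by apply/commgP/conjg_fixP.
have : v \in 'C_V[x] by rewrite inE Vv; apply/cent1P.
by rewrite regH ?inE ?ntx.
Qed.

Let Vbasis : exists2 v, v \in V & v != 1.
Proof. by apply/trivgPn. Qed.

Lemma regular_coprime : coprime #|V| #|H|.
Proof. exact: regular_norm_coprime. Qed.

(** v * v ^ t is fixed by t. *)
Lemma involution_inverts t v : t \in H -> #[t] = 2 -> v \in V -> v ^ t = v^-1.
Proof.
move=> Ht ot Vv; have nVt := subsetP nVH t Ht.
have Vvt : v ^ t \in V by rewrite memJ_norm.
have cVV := centsP (abelem_abelian abV).
have fixvt : (v * v ^ t) ^ t = v * v ^ t.
  rewrite conjMg -conjgM -[t * t]/(t ^+ 2) -ot expg_order conjg1.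
  exact: cVV.
have [vv1 | nt] := eqVneq (v * v ^ t) 1; first by rewrite -[LHS](mulKg v) vv1 mulg1.
by move: (fixV Ht (groupM Vv Vvt) fixvt nt) ot => ->; rewrite order1.
Qed.

Lemma involution_unique t u : t \in H -> u \in H -> #[t] = 2 -> #[u] = 2 -> t = u.
Proof.
move=> Ht Hu ot ou; have [v Vv ntv] := Vbasis.
apply/eqP; rewrite eq_mulgV1; apply/eqP; apply: fixV ntv => //; first by rewrite groupM ?groupV.
rewrite conjgM (involution_inverts Ht) // conjVg.
by rewrite (involution_inverts (groupVr Hu)) ?orderV ?invgK.
Qed.

Lemma involution_central t x : t \in H -> #[t] = 2 -> x \in H -> commute t x.
Proof.
move=> Ht ot Hx; apply/commgP/conjg_fixP.
by apply: involution_unique; rewrite ?groupJ ?orderJ.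
Qed.

(** Otherwise x and y generate a Frobenius group whose complement <[y]> has no fixed
    points on V, and <[x]> would centralize V. *)
Lemma prime_orders_commute x y : x \in H -> y \in H -> prime #[x] -> prime #[y] ->
  y \in 'N(<[x]>) -> commute x y.
Proof.
move=> Hx Hy pr_x pr_y nXy; apply/commgP/eqP; apply: contraNeq ntV => nc_xy.
have sXH : <[x]> \subset H by rewrite cycle_subG.
have sYH : <[y]> \subset H by rewrite cycle_subG.
have ntx : x != 1 by rewrite -order_gt1 prime_gt1.
have nty : y != 1 by rewrite -order_gt1 prime_gt1.
have cXY : 'C_<[x]>(<[y]>) = 1.
  apply: prime_TIg => //; rewrite cycle_subG; apply: contra nc_xy.
  by rewrite /= cent_cycle => /cent1P cyx; apply/commgP.
have cVY : 'C_V(<[y]>) = 1 by rewrite cent_cycle regH // !inE nty.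
have : <[x]> \subset 'C(V).
  apply: (@Frobenius_kernel_cent _ V <[x]> <[y]>) => //.
  - exact: abelem_abelian abV.
  - exact: coprimegS sXH regular_coprime.
  - exact: subset_trans sXH nVH.
  - exact: subset_trans sYH nVH.
  - by rewrite cycle_subG.
rewrite cycle_subG => cVx; rewrite -subG1 -(regH (x := x)) ?inE ?ntx // subsetI subxx.
by rewrite sub_cent1.
Qed.

Lemma odd_pgroup_cyclic (r : nat) (R : {group gT}) :
  R \subset H -> r.-group R -> odd #|R| -> cyclic R.
Proof.
move=> sRH rR oddR; rewrite (odd_pgroup_rank1_cyclic rR oddR).
have [E /pnElemP[sER abE <-]] := p_rank_witness r R.
have sEH := subset_trans sER sRH.
have cycE : cyclic E.
  apply: semiregular_abelian_cyclic abV ntV (subset_trans sEH nVH) _ (abelem_abelian abE).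
  exact: semiregularS regH.
by rewrite (abelem_cyclic abE) in cycE.
Qed.

(** A 2-group with a unique involution is cyclic or quaternion. *)
Lemma pgroup2_cyclic_or_quaternion (P : {group gT}) :
  P \subset H -> 2.-group P -> cyclic P || (extremal_class P == Quaternion).
Proof.
move=> sPH P2; have [-> | ntP] := eqVneq (P : {set gT}) 1; first by rewrite cyclic1.
apply/(prime_Ohm1P P2 ntP).
have [_ div2 _] := pgroup_pdiv P2 ntP.
have [t Pt ot] := Cauchy (isT : prime 2) div2; have Ht := subsetP sPH t Pt.
suffices -> : 'Ohm_1(P) = <[t]> by rewrite -orderE.
rewrite (OhmE 1 P2); apply/eqP; rewrite eqEsubset gen_subG cycle_subG mem_gen ?andbT; last first.
  by rewrite !inE Pt -order_dvdn ot.
apply/subsetP=> u; rewrite !inE => /andP[Pu /eqP u2].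
have [-> | ntu] := eqVneq u 1; first exact: group1.
rewrite (involution_unique (subsetP sPH u Pu) Ht _ ot) ?cycle_id //.
exact: nt_prime_order.
Qed.

End FixedPointFree.

Lemma quaternion_facts (gT : finGroupType) (P : {group gT}) :
    extremal_class P == Quaternion ->
  exists n x,
    [/\ n > 2, #|P| = (2 ^ n)%N, x \in P & #[x] = (2 ^ n.-1)%N] /\
    [/\ P^`(1) = <[x ^+ 2]>, #|P^`(1)| = (2 ^ n.-2)%N, {in P, forall t, t ^+ 2 \in P^`(1)},
        {in P :\: <[x]>, forall t, #[t] = 4}
      & {in <[x]> & P :\: <[x]>, forall z t, z ^ t = z^-1}].
Proof.
move/eqP/quaternion_classP=> [n n_gt2 isoP].
have [[x y] genP _] := generators_quaternion n_gt2 isoP.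
have [[_ X4 Xinv] [derP PhiP cardP _] _ _ _] := quaternion_structure n_gt2 genP isoP.
have [oP Px ox _] := genP; exists n, x; split=> //; split=> // t Pt.
have P2 : 2.-group P by rewrite /pgroup oP pnatX.
rewrite -PhiP (Phi_joing P2) mem_gen // inE; apply/orP; right.
by rewrite -[in t ^+ 2](expn1 2) Mho_p_elt // (mem_p_elt P2).
Qed.

(** A suitable power of an element u that acts on <[x]> as a transvection of
    prime order s is an s-element that still acts nontrivially. *)
Lemma p_elt_normalizer (gT : finGroupType) (s : nat) (x u y : gT) :
    prime s -> s.-elt x -> y \in <[x]> -> #[y] = s -> x ^ u = x * y -> y ^ u = y ->
  exists2 w, w \in <[u]> &
    [/\ s.-group (<[x]> <*> <[w]>), ~ commute x w & exists i, x ^ w = x * y ^+ i].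
Proof.
move=> pr_s s_x Xy oy xu yu; pose b := (#[u]`_s^')%N.
have xui i : x ^ (u ^+ i) = x * y ^+ i.
  elim: i => [|i IHi]; first by rewrite conjg1 mulg1.
  rewrite expgSr conjgM IHi conjMg xu conjXg yu -mulgA.
  by rewrite expgS.
have ub : #[u ^+ b] = (#[u]`_s)%N.
  by rewrite orderXdiv ?dvdn_part // -[X in X %/ _](partnC s (order_gt0 u)) mulnK ?part_gt0.
have s_w : s.-elt (u ^+ b) by rewrite /p_elt ub part_pnat.
exists (u ^+ b); first exact: mem_cycle.
split; last by exists b; rewrite xui.
  have nXw : <[u ^+ b]> \subset 'N(<[x]>) by rewrite norms_cycle xui groupM ?cycle_id ?groupX.
  by rewrite norm_joinEr // pgroupM; apply/andP; split.
move/commgP/conjg_fixP; rewrite xui => /eqP; rewrite -[X in _ == X]mulg1 (inj_eq (mulgI x)).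
rewrite -order_dvdn oy; apply/negP; rewrite -p'natE //; exact: part_pnat.
Qed.

Section QuadraticFixedPointFree.

Variables (gT : finGroupType) (q : nat) (V H : {group gT}).
Hypotheses (abV : q.-abelem V) (ntV : V :!=: 1) (nVH : H \subset 'N(V)).
Hypotheses (regH : semiregular V H) (qH : quadratic_characters H).

Let twist_group (s : nat) (x u y : gT) :
    prime s -> s.-elt x -> x \in H -> u \in H -> y \in <[x]> -> #[y] = s ->
    x ^ u = x * y -> y ^ u = y ->
  exists w, [/\ w \in H, s.-group (<[x]> <*> <[w]>), <[x]> <*> <[w]> \subset H,
    ~ commute x w & exists i, x ^ w = x * y ^+ i].
Proof.
move=> pr_s s_x Hx Hu Xy oy xu yu.
have [w uw [sA nc xw]] := p_elt_normalizer pr_s s_x Xy oy xu yu; exists w.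
have Hw : w \in H by apply: subsetP uw; rewrite cycle_subG.
by split=> //; rewrite join_subG !cycle_subG Hx.
Qed.

(** The squares modulo s ^ 2 contain 1 + 2 s, an element of order s, whereas the
    Sylow s-subgroups are abelian. *)
Lemma no_odd_square_order (s : nat) x :
  prime s -> odd s -> x \in H -> #[x] <> (s ^ 2)%N.
Proof.
move=> pr_s odd_s Hx ox; have s_gt0 := prime_gt0 pr_s.
have co_k : coprime (1 + s) #[x].
  by rewrite ox coprimeXr // coprime_sym /coprime gcdnDr gcdn1.
have /imsetP[u Hu xu] := square_power_class qH Hx co_k.
pose y := x ^+ (2 * s).
have xy : x ^ u = x * y.
  rewrite -xu /y -expgS; apply/eqP; rewrite eq_expg_mod_order ox.
  have -> : ((1 + s) ^ 2 = (2 * s).+1 + s ^ 2)%N by rewrite sqrnD; lia.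
  by rewrite modnDr.
have xs2 : x ^+ (s ^ 2) = 1 by rewrite -ox expg_order.
have yu : y ^ u = y.
  rewrite /y conjXg xy expgMn; last by apply: commuteX.
  rewrite /y -expgM (_ : (2 * s * (2 * s) = s ^ 2 * 4)%N); last by lia.
  by rewrite [x ^+ (s ^ 2 * 4)]expgM xs2 expg1n mulg1.
have oy : #[y] = s.
  rewrite /y mulnC expgM orderXgcd orderXdiv ox -?mulnn ?dvdn_mulr // mulnK //.
  by rewrite (eqP (_ : coprime s 2)) ?divn1 // coprimen2.
have s_x : s.-elt x by rewrite /p_elt ox pnatX pnat_id.
have [w [Hw sA sAH nc _]] := twist_group pr_s s_x Hx Hu (mem_cycle _ _) oy xy yu.
apply: nc.
have oddA : odd #|<[x]> <*> <[w]>| by have [k ->] := p_natP sA; rewrite oddX odd_s orbT.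
have := odd_pgroup_cyclic abV ntV nVH regH sAH sA oddA => /cyclic_abelian /centsP cA.
by apply: cA; rewrite mem_gen // inE cycle_id ?orbT.
Qed.

(** The same argument with 3 ^ 2 = 1 + 8: in a quaternion group the two
    possible actions on an element of order 16 are +-1. *)
Lemma no_order_16 x : x \in H -> #[x] <> 16.
Proof.
move=> Hx ox.
have co_k : coprime 3 #[x] by rewrite ox.
have /imsetP[u Hu xu] := square_power_class qH Hx co_k.
have xy : x ^ u = x * x ^+ 8 by rewrite -xu -expgS.
have x16 : x ^+ 16 = 1 by rewrite -ox expg_order.
have yu : (x ^+ 8) ^ u = x ^+ 8.
  rewrite conjXg xy -expgS -expgM; apply/eqP.
  by rewrite eq_expg_mod_order ox.
have oy : #[x ^+ 8] = 2 by rewrite orderXdiv ox.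
have s_x : 2.-elt x by rewrite /p_elt ox (@pnatX 2 2 4).
have [w [Hw sA sAH nc [i xw]]] := twist_group (isT : prime 2) s_x Hx Hu (mem_cycle _ _) oy xy yu.
set A := <[x]> <*> <[w]> in sA sAH.
have Ax : x \in A by rewrite mem_gen // inE cycle_id.
have Aw : w \in A by rewrite mem_gen // inE cycle_id orbT.
have := pgroup2_cyclic_or_quaternion abV ntV nVH regH sAH sA.
case/orP=> [/cyclic_abelian/centsP cA | /quaternion_facts[n [g [_ [_ _ _ X4 Xinv]]]]].
  by apply: nc; apply: cA.
have gx : x \in <[g]>.
  by apply: contraT => gx; have := X4 x; rewrite !inE gx Ax ox => /(_ isT).
have gw : w \in A :\: <[g]>.
  rewrite inE Aw andbT; apply/negP=> gw; apply: nc.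
  by apply: (centsP (cycle_abelian g)).
have := Xinv x w gx gw; rewrite xw => /(congr1 (mulg x)); rewrite mulgV mulgA => /eqP.
rewrite -expgM -[x * x]/(x ^+ 2) -expgD -order_dvdn ox.
by case/dvdnP=> m; clear; lia.
Qed.

Lemma prime_order_not_2 x t : x \in H -> t \in H -> prime #[x] -> t \in 'N(<[x]>) ->
  (t ^+ 2 = 1) -> commute x t.
Proof.
move=> Hx Ht pr_x nXt t2; have [-> | ntt] := eqVneq t 1; first exact: commute1.
apply: (prime_orders_commute abV ntV nVH regH) => //.
by rewrite (nt_prime_order _ t2).
Qed.

(** Let c be the square of a primitive root modulo r and x ^ g = x ^+ c. An odd
    prime s dividing (r - 1) / 2 gives a nonabelian group of order r s, so
    (r - 1) / 2 = 2 ^ m; its 2-part then has order at least 2 ^ m.+1, because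
    involutions are central, and there are no elements of order 16. *)
Lemma prime_divisor_le5 r : prime r -> r %| #|H| -> r \in [:: 2; 3; 5].
Proof.
move=> pr_r rH; have [x Hx ox] := Cauchy pr_r rH.
have [-> // | odd_r] := even_prime pr_r.
have cx1 : commute 1 x by apply: commute_sym; apply: commute1.
have co_1r : coprime #[1 : gT] r by rewrite order1 coprime1n.
have [c [g /setIP[Hg _] [gP cP]]] :=
  prime_order_fusion qH (group1 H) Hx cx1 co_1r pr_r odd_r ox.
have gfix m : (x ^ (g ^+ m) == x) = ((r.-1)./2 %| m) by rewrite gP cP.
have nXg m : g ^+ m \in 'N(<[x]>) by rewrite -cycle_subG norms_cycle gP mem_cycle.
have pr_x : prime #[x] by rewrite ox.
have Dr : (r = ((r.-1)./2).*2.+1)%N.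
  by rewrite -[LHS](odd_double_half r) odd_r add1n /= -[in RHS](odd_double_half r) odd_r /= doubleK.
pose b s := (#[g]`_s^')%N.
have b_s (s : nat) : prime s -> ~~ (s %| b s).
  by move=> pr_s; rewrite -p'natE // part_pnat.
have ogb (s : nat) : #[g ^+ b s] = (#[g]`_s)%N.
  by rewrite orderXdiv ?dvdn_part // -[X in X %/ _](partnC s (order_gt0 g)) mulnK ?part_gt0.
have no_odd s : prime s -> odd s -> ~~ (s %| (r.-1)./2).
  move=> pr_s odd_s; apply/negP=> s_r.
  have nfix : x ^ (g ^+ b s) != x.
    by rewrite gfix; apply: contra (b_s s pr_s); apply: dvdn_trans.
  have ntw : g ^+ b s != 1 by apply: contraNneq nfix => ->; rewrite conjg1.
  suffices ow : #[g ^+ b s] = s.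
    case/negP: nfix; apply/eqP/conjg_fixP/commgP.
    by apply: (prime_orders_commute abV ntV nVH regH) => //; rewrite ?groupX ?ow.
  have Dlog : #[g ^+ b s] = (s ^ logn s #[g])%N by rewrite ogb p_part.
  case Dl : (logn s #[g]) Dlog => [|[|l]] Dlog; last 1 first.
  - have dvd_l : (s ^ l %| s ^ l.+2)%N by rewrite dvdn_exp2l // -addn2 leq_addr.
    have := @no_odd_square_order s ((g ^+ b s) ^+ (s ^ l)) pr_s odd_s.
    rewrite !groupX // orderXdiv Dlog // -expnB ?prime_gt0 //; last by rewrite -addn2 leq_addr.
    by rewrite -addn2 addKn => /(_ isT).
  - by move: ntw; rewrite -order_eq1 Dlog eqxx.
  - by rewrite Dlog expn1.
have Dm : exists m, ((r.-1)./2 = 2 ^ m)%N.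
  exists (logn 2 (r.-1)./2); apply/esym; rewrite -p_part; apply: part_pnat_id.
  have r_gt2 : 0 < (r.-1)./2 by move: (prime_gt1 pr_r); rewrite Dr; case: (r.-1)./2.
  apply/pnatP=> // p pr_p p_r; case: (even_prime pr_p) => [-> // | odd_p].
  by case/negP: (no_odd p pr_p odd_p).
have [m {}Dm] := Dm; rewrite Dm in Dr gfix.
have [m3 | m3] := ltnP m 3.
  case: m m3 Dr {Dm gfix} => [|[|[|]]] // _ Dr; rewrite Dr // in pr_r *.
pose w := g ^+ b 2.
have wfix l : (x ^ (w ^+ l) == x) = (2 ^ m %| l).
  rewrite -expgM gfix Gauss_dvdr // coprimeXl // prime_coprime //.
  exact: b_s.
have ow : #[w] = (2 ^ logn 2 #[g])%N by rewrite ogb p_part.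
have [le4 | lt4] := leqP 4 (logn 2 #[g]).
  have := @no_order_16 (w ^+ (2 ^ (logn 2 #[g] - 4))).
  rewrite !groupX // orderXdiv ow ?dvdn_exp2l ?leq_subr //.
  by rewrite -expnB ?leq_subr // subKn // => /(_ isT).
have nfix : x ^ (w ^+ (2 ^ 2)) != x by rewrite wfix dvdn_Pexp2l // -ltnNge.
pose t := w ^+ (2 ^ 2).
have t2 : t ^+ 2 = 1.
  apply/eqP; rewrite -expgM -order_dvdn ow (_ : (2 ^ 2 * 2 = 2 ^ 3)%N) // dvdn_exp2l //.
case/negP: nfix; apply/eqP/conjg_fixP/commgP; apply: prime_order_not_2 => //.
  by rewrite !groupX.
by rewrite -/t /t -!expgM.
Qed.

(** The inversion of z is its square-power map for k = 2. Its 2-part w still inverts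
    z, and w cannot have order 2 because involutions are central. *)
Lemma order5_inverted a z : a \in H -> z \in H -> commute a z -> coprime #[a] 5 -> #[z] = 5 ->
  exists w, [/\ w \in 'C_H[a], 2.-elt w, 4 <= #[w] & z ^ w = z^-1].
Proof.
move=> Ha Hz caz co_a5 oz.
have [|| g /setIP[Hg cag] zg] := square_power_cent qH Ha Hz caz (k := 2); rewrite ?oz //.
have {}zg : z ^ g = z^-1.
  rewrite zg; apply/eqP; rewrite eq_sym eq_invg_mul -expgS.
  by rewrite -oz expg_order.
have zgi i : z ^ (g ^+ i) = if odd i then z^-1 else z.
  elim: i => [|i IHi]; first by rewrite conjg1.
  by rewrite expgSr conjgM IHi /=; case: (odd i); rewrite ?conjVg zg ?invgK.
pose w := g ^+ (#[g]`_2^')%N.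
have odd_b : odd (#[g]`_2^')%N.
  have := part_pnat 2^' #[g]; rewrite p'natE //.
  by rewrite dvdn2 negbK.
have zw : z ^ w = z^-1 by rewrite zgi odd_b.
have Hw : w \in H by apply: groupX.
have ow : #[w] = (2 ^ logn 2 #[g])%N.
  rewrite orderXdiv ?dvdn_part // -[X in X %/ _](partnC 2 (order_gt0 g)) mulnK ?part_gt0 //.
  by rewrite p_part.
exists w; split; rewrite /p_elt ?ow ?pnatX //.
  by rewrite inE Hw groupX.
rewrite (@leq_exp2l 2 2) // leqNgt ltnS; apply/negP=> small.
have w2 : w ^+ 2 = 1 by apply/eqP; rewrite -order_dvdn ow (@dvdn_exp2l 2 _ 1).
have nzw : w \in 'N(<[z]>) by rewrite -cycle_subG norms_cycle zw groupV cycle_id.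
have pr_z : prime #[z] by rewrite oz.
have /commgP/conjg_fixP := prime_order_not_2 Hz Hw pr_z nzw w2.
rewrite zw => /eqP; rewrite eq_invg_mul -[z * z]/(z ^+ 2) -order_dvdn oz //.
Qed.

Lemma odd_sylow_order s : prime s -> odd s -> logn s #|H| <= 1.
Proof.
move=> pr_s odd_s; have [S sylS] := Sylow_exists s H.
have [sSH sS _] := and3P sylS.
have oS := card_Hall sylS; rewrite p_part in oS.
have oddS : odd #|S| by rewrite oS oddX odd_s orbT.
have /cyclicP[x defS] := odd_pgroup_cyclic abV ntV nVH regH sSH sS oddS.
have ox : #[x] = (s ^ logn s #|H|)%N by rewrite -oS defS.
rewrite leqNgt; apply/negP=> gt1.
have Hx : x \in H by rewrite -cycle_subG -defS.
have := @no_odd_square_order s (x ^+ (s ^ (logn s #|H| - 2))) pr_s odd_s.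
rewrite groupX // orderXdiv ox ?dvdn_exp2l ?leq_subr //.
by rewrite -expnB ?leq_subr ?prime_gt0 // subKn // => /(_ isT).
Qed.

Lemma quaternion_order_le16 (P : {group gT}) :
  P \subset H -> extremal_class P == Quaternion -> #|P| \in [:: 8; 16].
Proof.
move=> sPH /quaternion_facts[n [x [[n_gt2 -> Px ox] _]]].
have [n_ge5 | ] := leqP 5 n; last by case: n n_gt2 {ox} => [|[|[|[|[|]]]]].
have n4 : 4 <= n.-1 by case: n n_ge5 {n_gt2 ox}.
have := @no_order_16 (x ^+ (2 ^ (n.-1 - 4))).
rewrite groupX ?(subsetP sPH) // orderXdiv ox ?dvdn_exp2l ?leq_subr //.
by rewrite -expnB ?leq_subr // subKn // => /(_ isT).
Qed.

End QuadraticFixedPointFree.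

(** * Fitting subgroups and cyclic Sylow 2-subgroups *)

Lemma index_cent_cyclic (gT : finGroupType) (A L : {group gT}) :
  cyclic A -> L \subset 'N(A) -> #|L : 'C_L(A)| %| totient #|A|.
Proof.
move=> cycA nAL; rewrite -card_Aut_cyclic //.
rewrite indexgI; have := card_morphim (conj_aut A) L.
rewrite ker_conj_aut (setIidPr nAL) /= => <-.
by apply: cardSg; apply: Aut_conj_aut.
Qed.

(** Otherwise a minimal normal subgroup M / Z of G / Z below C / Z, with
    C = C_G(F(G)) and Z = F(G) n C, would give a normal subgroup M of class two
    outside F(G). *)
Lemma solvable_cent_Fitting (gT : finGroupType) (G : {group gT}) :
  solvable G -> 'C_G('F(G)) \subset 'F(G).
Proof.
move=> solG; set F := 'F(G)%G; pose C := 'C_G(F)%G; pose Z := (C :&: F)%G.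
have nFG : F <| G := Fitting_normal G.
have nCG : C <| G.
  rewrite /normal subsetIl /=; apply: normsI; first exact: normG.
  exact: norms_cent (normal_norm nFG).
have nZG : Z <| G by apply: normalI.
have sZC : Z \subset C by apply: subsetIl.
have nZC : C \subset 'N(Z) := subset_trans (normal_sub nCG) (normal_norm nZG).
apply: contraT => nsCF.
have ntCb : (C / Z)%g != 1.
  by rewrite -subG1 quotient_sub1 //; apply: contra nsCF => /subset_trans -> //; apply: subsetIr.
have nCb : G / Z \subset 'N(C / Z) by rewrite quotient_norms ?normal_norm.
have [Mb minMb sMCb] := minnormal_exists ntCb nCb.
have solCb : solvable (C / Z) := quotient_sol _ (solvableS (normal_sub nCG) solG).
have [nMb ntMb /is_abelemP[p _ /abelem_abelian abMb]] := minnormal_solvable minMb sMCb solCb.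
have nMbL : Mb <| G / Z.
  by rewrite /normal nMb (subset_trans sMCb) ?quotientS ?normal_sub.
have [M EM sZM nMG] := inv_quotientN nZG nMbL.
have sMC : M \subset C.
  by rewrite -(quotientSGK _ sZC) -?EM // (subset_trans (normal_sub nMG)) ?normal_norm.
have sMF : M \subset F.
  apply: (Fitting_max nMG); rewrite -quotient_center_nil; apply: abelian_nil.
  apply: sub_der1_abelian; apply: subset_trans (_ : Z \subset _).
    apply: der1_min; first by rewrite (subset_trans (normal_sub nMG)) ?normal_norm.
    by rewrite -EM.
  rewrite subsetI sZM centsC (subset_trans sMC) //.
  by apply: subset_trans (subsetIr _ _) _; rewrite centS ?subsetIr.
have nZM : M \subset 'N(Z) := subset_trans (normal_sub nMG) (normal_norm nZG).
by case/negP: ntMb; rewrite EM -subG1 quotient_sub1 //= subsetI sMC.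
Qed.

(** Over O_{2'}(G) the Fitting subgroup is a 2-group; it is centralized by the
    abelian Sylow 2-subgroup, hence equal to it, and a cyclic 2-group has no
    automorphism of odd order. *)
Lemma cyclic_sylow2_quotient (gT : finGroupType) (G P : {group gT}) :
    solvable G -> 2.-Sylow(G) P -> cyclic P ->
  cyclic (G / 'O_2^'(G)) /\ #|G / 'O_2^'(G)| = #|P|.
Proof.
move=> solG sylP cycP; set N := 'O_2^'(G); pose L := (G / N)%G.
have nNG : N <| G := pcore_normal _ _.
have solL : solvable L := quotient_sol _ solG.
have [sPG P2 _] := and3P sylP.
have nNP : P \subset 'N(N) := subset_trans sPG (normal_norm nNG).
have sylPb : 2.-Sylow(L) (P / N) := quotient_pHall nNP sylP.
have cycPb : cyclic (P / N) := quotient_cyclic _ cycP.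
have OL1 : 'O_2^'(L) = 1 by apply: trivg_pcore_quotient.
have FL : 'F(L) = 'O_2(L) := Fitting_eq_pcore OL1.
have sOP : 'O_2(L) \subset P / N := pcore_sub_Hall sylPb.
have sPO : P / N \subset 'O_2(L).
  rewrite -FL; apply: subset_trans (solvable_cent_Fitting solL).
  rewrite subsetI quotientS // FL; apply: sub_abelian_cent => //.
  exact: cyclic_abelian.
have EP : P / N = 'O_2(L) by apply/eqP; rewrite eqEsubset sPO.
have oPb : #|P / N| = #|P|.
  apply/esym/card_isog/quotient_isog => //.
  by apply: coprime_TIg; rewrite coprime_sym; apply: pnat_coprime P2 (pcore_pgroup _ _).
suffices EL : L :=: P / N by rewrite -/L -[G / N]/(gval L) EL.
have nPL : P / N <| L by rewrite EP pcore_normal.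
have cPL : 'C_L(P / N) \subset P / N.
  by rewrite EP -{1}FL -FL solvable_cent_Fitting.
apply/eqP; rewrite eq_sym eqEsubset normal_sub //= -indexg_eq1.
have dvd1 : #|L : P / N| %| totient #|P / N|.
  apply: dvdn_trans (index_cent_cyclic cycPb (normal_norm nPL)).
  have EC : 'C_L(P / N) = P / N.
    apply/eqP; rewrite eqEsubset cPL subsetI normal_sub //.
    exact: cyclic_abelian.
  by rewrite EC.
have odd_i : 2^'.-nat #|L : P / N| by case/and3P: sylPb.
have p2 : 2.-nat (totient #|P / N|).
  have /p_natP[k ->] : 2.-group (P / N) := quotient_pgroup _ P2.
  case: k => [|k]; first by rewrite expn0.
  by rewrite totient_pfactor // mul1n pnatX.
by rewrite (pnat_1 (pnat_dvd dvd1 p2) odd_i).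
Qed.

(** The automorphism group of a cyclic group is abelian. *)
Lemma der1_cent_cyclic (gT : finGroupType) (A L : {group gT}) :
  cyclic A -> L \subset 'N(A) -> L^`(1) \subset 'C(A).
Proof.
case/cyclicP=> a ->{A} nAL; rewrite cent_cycle gen_subG.
apply/subsetP=> _ /imset2P[g h Lg Lh ->]; apply/cent1P/esym/commgP/conjg_fixP.
have pow g1 : g1 \in L -> exists i, a ^ g1 = a ^+ i.
  by move=> Lg1; apply/cycleP; rewrite memJ_norm ?cycle_id // (subsetP nAL).
have [i ag] := pow g Lg; have [j ah] := pow h Lh.
have E : a ^ (g * h) = a ^ (h * g).
  by rewrite !conjgM ag ah !conjXg ag ah -!expgM mulnC.
have [n Db] : exists n, a ^ (h * g)^-1 = a ^+ n.
  by apply: pow; rewrite groupV groupM.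
have -> : [~ g, h] = (h * g)^-1 * (g * h) by rewrite invMg commgEl /conjg !mulgA.
by rewrite conjgM Db conjXg E -conjXg -Db conjgKV.
Qed.

(** F(L) has order dividing 15 and contains its centralizer, so L / F(L) embeds in
    its automorphism group; were the order of F(L) a proper divisor of 15, the order
    of L would not be divisible by 15. *)
Lemma Fitting_order_15 (gT : finGroupType) (L : {group gT}) :
    solvable L -> 'O_2(L) = 1 -> 3 %| #|L| -> 5 %| #|L| ->
    logn 3 #|L| <= 1 -> logn 5 #|L| <= 1 ->
    {in \pi(L), forall p, p \in [:: 2; 3; 5]} ->
  [/\ cyclic 'F(L), #|'F(L)| = 15, 'C_L('F(L)) = 'F(L) & #|L : 'F(L)| %| 8].
Proof.
move=> solL OL1 L3 L5 log3 log5 piL; set F := 'F(L)%G.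
have nFL : F <| L := Fitting_normal L.
have F2' : 2^'.-group F.
  have := nilpotent_pcoreC 2 (Fitting_nil L).
  by rewrite p_core_Fitting OL1 dprod1g => <-; apply: pcore_pgroup.
have logF p : prime p -> logn p #|F| <= (p \in [:: 3; 5]).
  move=> pr_p; have le_pL := dvdn_leq_log p (cardG_gt0 L) (cardSg (normal_sub nFL)).
  have [pF | npF] := boolP (p %| #|F|); last by rewrite lognE (negPf npF) !andbF.
  have : p \in \pi(L) by rewrite mem_primes pr_p cardG_gt0 (dvdn_trans pF) ?cardSg ?normal_sub.
  move/piL; rewrite !inE => /or3P[] /eqP Dp; subst p => //.
  - by have := pgroupP F2' 2 isT pF.
  - exact: leq_trans le_pL log3.
  - exact: leq_trans le_pL log5.
have F15 : #|F| %| 15.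
  apply/dvdn_partP => // p; rewrite mem_primes => /and3P[pr_p _ pF].
  have : logn p #|F| <= logn p 15.
    apply: leq_trans (logF p pr_p) _; rewrite !inE; case: (p =P 3) => [-> //|_]; by case: (p =P 5) => [-> //|_].
  rewrite p_part => le_p; apply: dvdn_trans (pfactor_dvdnn p 15).
  exact: dvdn_exp2l.
have cycF : cyclic F.
  apply: nil_Zgroup_cyclic (Fitting_nil L); apply/forall_inP=> S /SylowP[p pr_p sylS].
  have := card_Hall sylS; rewrite p_part; have := logF p pr_p.
  case: (logn p _) => [|[|l]] //; last by case: (p \in _).
    by move=> _ oS; rewrite (card1_trivg oS) cyclic1.
  by move=> _ oS; rewrite prime_cyclic // oS expn1.
have CF : 'C_L(F) = F.
  apply/eqP; rewrite eqEsubset solvable_cent_Fitting //= subsetI normal_sub //.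
  exact: cyclic_abelian.
have iF := index_cent_cyclic cycF (normal_norm nFL); rewrite CF in iF.
have oL : #|L| = (#|F| * #|L : F|)%N by rewrite Lagrange ?normal_sub.
have oF : #|F| = 15.
  have L15 : 15 %| #|F| * totient #|F|.
    apply: (@dvdn_trans #|L|); last by rewrite oL dvdn_pmul2l.
    by rewrite (@Gauss_dvd 3 5) // L3.
  move: F15 L15; rewrite dvdn_divisors // !inE => /or4P[] /eqP -> //.
split=> //; by rewrite oF in iF.
Qed.

Section SylowStructure.

Variables (gT : finGroupType) (q : nat) (V H : {group gT}).
Hypotheses (abV : q.-abelem V) (ntV : V :!=: 1) (nVH : H \subset 'N(V)).
Hypotheses (regH : semiregular V H) (qH : quadratic_characters H) (solH : solvable H).

(** In the cyclic case P is a quotient of H, and cyclic quotients have order at most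
    6; in the quaternion case H has no element of order 16. *)
Lemma sylow2_cases (P : {group gT}) : 2.-Sylow(H) P ->
     cyclic P /\ #|P| \in [:: 1%N; 2; 4]
  \/ extremal_class P == Quaternion /\ #|P| \in [:: 8; 16].
Proof.
move=> sylP; have [sPH P2 _] := and3P sylP.
case/orP: (pgroup2_cyclic_or_quaternion abV ntV nVH regH sPH P2) => [cycP | quaP]; last first.
  by right; rewrite quaP (quaternion_order_le16 abV ntV nVH regH qH).
left; have [cycL oL] := cyclic_sylow2_quotient solH sylP cycP.
split=> //; have := cyclic_quotient_order qH (pcore_normal _ _) cycL.
rewrite oL; have [k ->] := p_natP P2; case: k => [|[|[|k]]] //.
rewrite !inE !expnS; have := expn_gt0 2 k; move: (2 ^ k)%N; clear; lia.
Qed.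

(** Modulo T = O_2(H), the Fitting subgroup is cyclic of order 15, with generator x.
    Conjugation takes x to x ^+ 4 and, by the quadratic condition for the exponents 11
    and 7, also to one of x ^+ 11, x ^+ 7, x ^+ 2. The last two have order 4 as
    automorphisms, whereas P / T has exponent at most 2 for a Sylow 2-subgroup P. So
    some g induces x ^+ 11; then P / T has order at least 4, so P is quaternion and
    T = P^`(1) is cyclic, hence centralized by the elements of odd order, and x lifts
    to an element x0 of order 15. Now g inverts the 3-part of x0
    and centralizes the 5-part, which is inverted by a 2-element m commuting with g;
    but <g, m> is cyclic, so that g is a power of m or conversely, and neither is
    compatible with these actions. *)
Lemma not_15_dvd : 3 %| #|H| -> 5 %| #|H| -> False.
Proof.
move=> H3 H5.
have [z Hz oz] := Cauchy (isT : prime 5) H5.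
have c1z : commute 1 z by apply: commute_sym; apply: commute1.
have co15 : coprime #[1 : gT] 5 by rewrite order1.
have [w [Hw w2 ow zw]] := order5_inverted abV ntV nVH regH qH (group1 H) Hz c1z co15 oz.
have {}Hw : w \in H by case/setIP: Hw.
have [t Ht ot] : exists2 t, t \in H & #[t] = 2.
  have [k Dk] := p_natP w2; exists (w ^+ (2 ^ k.-1)); first exact: groupX.
  case: k Dk => [|k] Dk; first by rewrite Dk in ow.
  by rewrite orderXdiv Dk ?dvdn_exp2l // expnS mulnK ?expn_gt0.
set T := 'O_2(H)%G; pose L := (H / T)%G.
have nTH : T <| H := pcore_normal _ _.
have T2 : 2.-group T := pcore_pgroup _ _.
have T_gt1 : 1 < #|T|.
  apply: leq_trans (_ : #|<[t]>| <= _); first by rewrite -orderE ot.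
  apply: subset_leq_card; apply: pcore_max; first by rewrite /pgroup -orderE ot.
  rewrite /normal cycle_subG Ht; apply/subsetP=> x Hx.
  by rewrite inE -cycleJ (conjg_fixP _) //; apply/commgP; apply: involution_central abV ntV nVH regH _ _ _ _ _.
have qL : quadratic_characters L := quadratic_characters_quotient nTH qH.
have solL : solvable L := quotient_sol _ solH.
have OL1 : 'O_2(L) = 1 by apply: trivg_pcore_quotient.
have oH : #|H| = (#|L| * #|T|)%N.
  by rewrite card_quotient ?normal_norm // mulnC Lagrange ?normal_sub.
have L_dvd : #|L| %| #|H| by rewrite oH dvdn_mulr.
have dvdL p : prime p -> odd p -> p %| #|H| -> p %| #|L|.
  move=> pr_p odd_p; rewrite oH Euclid_dvdM // => /orP[// | pT].
  by have /eqP Dp := pgroupP T2 p pr_p pT; rewrite Dp in odd_p.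
have logL p : prime p -> odd p -> logn p #|L| <= 1.
  move=> pr_p odd_p; apply: leq_trans (odd_sylow_order abV ntV nVH regH qH pr_p odd_p).
  exact: dvdn_leq_log.
have piL : {in \pi(L), forall p, p \in [:: 2; 3; 5]}.
  move=> p; rewrite mem_primes => /and3P[pr_p _ pL].
  exact: (prime_divisor_le5 abV ntV nVH regH qH pr_p (dvdn_trans pL L_dvd)).
set F := 'F(L)%G; have nFL : F <| L := Fitting_normal L.
have [cycF oF CF iF8] : [/\ cyclic F, #|F| = 15, 'C_L(F) = F & #|L : F| %| 8].
  exact: (Fitting_order_15 solL OL1 (dvdL 3 isT isT H3) (dvdL 5 isT isT H5)
    (logL 3 isT isT) (logL 5 isT isT) piL).
have [x defF] := cyclicP cycF.
have ox : #[x] = 15 by rewrite orderE -defF.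
have oL : #|L| = (15 * #|L : F|)%N by rewrite -oF Lagrange ?normal_sub.
have xE i k : (x ^+ i == x ^+ k) = (i == k %[mod 15]) by rewrite eq_expg_mod_order ox.
have fixF g f : f \in F -> x ^ (f * g) = x ^ g.
  rewrite defF => /cycleP[i ->]; rewrite conjgM; congr (_ ^ _).
  by apply/conjg_fixP/commgP/commuteX.
have iF2 : 2.-nat #|L : F| by apply: pnat_dvd iF8 _.
have [P sylP] := Sylow_exists 2 H; have [sPH P2 _] := and3P sylP.
have oP : #|P| = (#|L : F| * #|T|)%N.
  rewrite (card_Hall sylP) oH oL !partnM ?muln_gt0 ?cardG_gt0 ?indexg_gt0 //.
  by rewrite (@part_p'nat 2 15) // !(@part_pnat_id 2) // mul1n.
pose Q := (P / T)%G.
have sTP : T \subset P := pcore_sub_Hall sylP.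
have oQ : #|Q| = #|L : F|.
  rewrite card_quotient ?(subset_trans sPH) ?normal_norm // -divgS // oP mulnK //.
have Q2 : 2.-group Q by apply: quotient_pgroup.
have sQL : Q \subset L by apply: quotientS.
have tiFQ : F :&: Q = 1.
  by apply: coprime_TIg; rewrite coprime_sym; apply: pnat_coprime Q2 _; rewrite oF.
have defL : F * Q = L.
  apply/eqP; rewrite eqEcard mulG_subG normal_sub // sQL /= (TI_cardMg tiFQ).
  by rewrite oQ oF -oL.
have actQ g k : g \in L -> x ^ g = x ^+ k -> exists2 j, j \in P & x ^ (coset T j) = x ^+ k.
  rewrite -{1}defL => /mulsgP[f _ Ff /morphimP[j Nj Pj ->] ->]; rewrite fixF // => xj.
  by exists j.
have cox i : coprime i 15 -> coprime i #[x] by rewrite ox.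
have [h0 Lh0 xh0] : exists2 h, h \in L & x ^ h = x ^+ 4.
  have Lx : x \in L by rewrite -cycle_subG -defF normal_sub.
  have /imsetP[h Lh xh] := square_power_class qL Lx (cox 2 isT).
  by exists h; rewrite // -xh.
have [g0 Lg0 [k k3 xg0]] : exists2 g, g \in L & exists2 k, k \in [:: 11; 7; 2] & x ^ g = x ^+ k.
  have nXL : <[x]> <| L by rewrite -defF.
  have := normal_cyclic_powers qL nXL (cox 11 isT) (cox 7 isT).
  case=> // /imsetP[g Lg xg].
  - by exists g => //; exists 11.
  - by exists g => //; exists 7.
  exists g^-1; rewrite ?groupV //; exists 2 => //.
  have := congr1 (fun y => y ^+ 11) xg; rewrite /= -conjXg -!expgM.
  have /eqP -> : x ^+ (11 * 11) == x by rewrite -[X in _ == X]expg1 xE.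
  by have /eqP -> : x ^+ (7 * 11) == x ^+ 2 by [rewrite xE] => {1}->; rewrite conjgK.
have [h Ph xh] := actQ h0 4 Lh0 xh0; have [g Pg xg] := actQ g0 k Lg0 xg0.
have QP u : u \in P -> coset T u \in Q by apply: mem_quotient.
(* three automorphisms of <[x]> are induced by distinct cosets *)
have iF3 : k = 11 -> 2 < #|L : F|.
  move=> Dk; rewrite -oQ cardE; apply: (@uniq_leq_size _ [:: 1; coset T h; coset T g]).
    rewrite /= !inE !negb_or andbT -andbA; apply/and3P; split; apply: contraTneq isT => E.
    - by have /eqP := xh; rewrite -E conjg1 -[X in X == _]expg1 xE.
    - by have /eqP := xg; rewrite -E conjg1 Dk -[X in X == _]expg1 xE.
    - by have /eqP := xg; rewrite -E xh Dk xE.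
  by move=> u; rewrite !inE mem_enum => /or3P[] /eqP ->; rewrite ?group1 ?QP.
have involution_case : (coset T g) ^+ 2 = 1 -> k = 11.
  move=> g2; have := xg; move/(congr1 (fun y => y ^ coset T g)).
  rewrite -conjgM -[_ * _]/(_ ^+ 2) g2 conjg1 conjXg xg -expgM => /eqP.
  rewrite -[X in X == _]expg1 xE.
  by move: k3; rewrite !inE => /or3P[] /eqP ->.
have T2gt : 2 * 2 < #|P| -> extremal_class P == Quaternion.
  case: (sylow2_cases sylP) => [[_] | [-> //]].
  by rewrite !inE => /or3P[] /eqP ->.
have quaP : extremal_class P == Quaternion.
  case: (sylow2_cases sylP) => [[_ oP4] | [-> //]]; apply: T2gt.
  have le2 : #|L : F| <= 2.
    rewrite leqNgt; apply/negP=> gt2.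
    have := leq_mul gt2 T_gt1; rewrite -oP.
    by move: oP4; rewrite !inE => /or3P[] /eqP ->.
  have g2 : (coset T g) ^+ 2 = 1.
    have := expg_cardG (QP g Pg); rewrite oQ.
    by case: #|L : F| le2 (indexg_gt0 L F) => [|[|[|]]] // _ _ /(congr1 (fun y => y ^+ 2)); rewrite ?expg1n.
  by have := iF3 (involution_case g2); rewrite ltnNge le2.
have [n [a [[n_gt2 oPn Pa oa] [derP oderP sqP _ _]]]] := quaternion_facts quaP.
have sP'T : P^`(1) \subset T.
  rewrite -quotient_sub1; last first.
    by rewrite (subset_trans (der_sub 1 P)) // (subset_trans sPH) ?normal_norm.
  rewrite quotient_der ?(subset_trans sPH) ?normal_norm // -/Q -tiFQ subsetI der_sub andbT.
  apply: subset_trans (_ : L^`(1) \subset _); first exact: dergS.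
  by rewrite -CF subsetI der_sub der1_cent_cyclic // normal_norm.
have sqT u : u \in P -> (coset T u) ^+ 2 = 1.
  move=> Pu; have Nu : u \in 'N(T) by rewrite (subsetP (normal_norm nTH)) // (subsetP sPH).
  by rewrite -morphX //= coset_id // (subsetP sP'T) ?sqP.
have Dk := involution_case (sqT g Pg); rewrite Dk in xg.
have iF4 : 4 <= #|L : F|.
  have := iF3 Dk; have [l ->] := p_natP iF2.
  by case: l => [|[|l]] // _; rewrite (@leq_exp2l 2 2).
have DT : P^`(1) = T.
  apply/eqP; rewrite eqEcard sP'T oderP; have := oP; rewrite oPn.
  have -> : (2 ^ n = 4 * 2 ^ n.-2)%N by rewrite -(@expnD 2 2) -[in LHS](subnK (ltnW n_gt2)) addnC subn2.
  move=> E; rewrite -(leq_pmul2l (isT : 0 < 4)) E.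
  by rewrite leq_mul2r iF4 orbT.
have cycT : cyclic T by rewrite -DT derP cycle_cyclic.
have cTodd u : u \in H -> 2^'.-elt u -> u \in 'C(T).
  move=> Hu u2'; set C := 'C_H(T)%G.
  have nTC : H \subset 'N(C) by rewrite normsI ?normG // norms_cent ?normal_norm.
  have iC2 : 2.-nat #|H : C|.
    apply: pnat_dvd (index_cent_cyclic cycT (normal_norm nTH)) _.
    have [[|l] ->] := p_natP T2; first by rewrite expn0.
    by rewrite totient_pfactor // mul1n pnatX.
  have Nu : u \in 'N(C) by rewrite (subsetP nTC).
  suffices : u \in C by case/setIP.
  apply: coset_idr => //; apply/eqP; rewrite -order_eq1 -dvdn1.
  have o2 : 2.-nat #[coset C u].
    apply: pnat_dvd iC2; rewrite -card_quotient //; apply: order_dvdG.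
    exact: mem_quotient.
  have o2' : 2^'.-nat #[coset C u] by apply: pnat_dvd u2'; apply: morph_order.
  by rewrite (pnat_1 o2 o2').
have nTh u : u \in H -> u \in 'N(T) by apply: (subsetP (normal_norm nTH)).
have pow15_2' u : u ^+ 15 = 1 -> 2^'.-elt u.
  by move=> u15; apply: (pnat_dvd (n := 15)) => //; rewrite order_dvdn u15.
have lift_inj u v : u \in H -> v \in H -> u ^+ 15 = 1 -> v ^+ 15 = 1 ->
    coset T u = coset T v -> u = v.
  move=> Hu Hv u15 v15 /rcoset_kercosetP -/(_ (nTh u Hu) (nTh v Hv)) /rcosetP[e Te Du].
  have cev : commute e v by apply/commute_sym/(centP (cTodd v Hv (pow15_2' _ v v15))).
  suffices e1 : e = 1 by rewrite Du e1 mul1g.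
  have : #[e] %| 15 by rewrite order_dvdn -u15 Du expgMn // v15 mulg1.
  move/pnat_dvd/(_ (isT : 2^'.-nat 15)) => e2'.
  apply/eqP; rewrite -order_eq1; apply/eqP.
  exact: pnat_1 (mem_p_elt T2 Te) e2'.
have [x0 Hx0 [x0_15 Dx]] : exists2 x0, x0 \in H & x0 ^+ 15 = 1 /\ coset T x0 = x.
  have : x \in L by rewrite (subsetP (normal_sub nFL)) // defF cycle_id.
  case/morphimP=> x1 Nx1 Hx1 Dx; exists (x1.`_2^'); first by rewrite groupX.
  have Dx2' : coset T (x1.`_2^') = x.
    by rewrite -[coset T _]/(coset_morphism T _) morph_constt // -/(coset T x1) -Dx constt_p_elt // /p_elt ox.
  split=> //; have : (x1.`_2^') ^+ 15 \in T.
    have N2 : x1.`_2^' \in 'N(T) by rewrite groupX.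
    by apply: coset_idr; rewrite ?groupX // morphX //= Dx2' -ox expg_order.
  move=> Tx; have p2 := mem_p_elt T2 Tx.
  have p2' : 2^'.-elt ((x1.`_2^') ^+ 15) by rewrite p_eltX // p_elt_constt.
  by apply/eqP; rewrite -order_eq1; apply/eqP; apply: pnat_1 p2 p2'.
have Hg : g \in H := subsetP sPH g Pg.
have lift_pow u i : u \in H -> x ^ (coset T u) = x ^+ i -> x0 ^ u = x0 ^+ i.
  move=> Hu xu; apply: lift_inj; rewrite ?groupJ ?groupX //.
  - by rewrite -conjXg x0_15 conj1g.
  - by rewrite -expgM mulnC expgM x0_15 expg1n.
  - by rewrite morphJ ?nTh // morphX ?nTh //= Dx.
have x0E i l : (i == l %[mod 15]) -> x0 ^+ i = x0 ^+ l.
  move=> E; apply/eqP; rewrite eq_expg_mod_order.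
  have d15 : #[x0] %| 15 by rewrite order_dvdn x0_15.
  by rewrite -(modn_dvdm i d15) (eqP E) modn_dvdm.
have x0g := lift_pow g 11 Hg xg.
have ox0 : #[x0] = 15.
  apply/eqP; rewrite eqn_dvd order_dvdn x0_15 eqxx /= -[15%N in X in X %| _]ox -Dx.
  by apply: morph_order; rewrite nTh.
have g2 : 2.-elt g := mem_p_elt P2 Pg.
(* z1 has order 5 and commutes with g; y1 has order 3 and is inverted by g *)
pose z1 := x0 ^+ 6; pose y1 := x0 ^+ 5.
have oz1 : #[z1] = 5 by rewrite orderXgcd ox0.
have oy1 : #[y1] = 3 by rewrite orderXgcd ox0.
have z1g : z1 ^ g = z1 by rewrite conjXg x0g -expgM; apply: x0E.
have cgz : commute g z1 by apply: commute_sym; apply/commgP/conjg_fixP.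
have co_g5 : coprime #[g] 5 by have [l ->] := p_natP g2; rewrite coprimeXl.
have [m [Cm m2 _ z1m]] := order5_inverted abV ntV nVH regH qH Hg (groupX 6 Hx0) cgz co_g5 oz1.
have [Hm cgm] := setIP Cm; have {}cgm : commute g m by apply/commute_sym/cent1P.
have z1N : z1^-1 != z1 by rewrite eq_invg_mul -[_ * _]/(z1 ^+ 2) -order_dvdn oz1.
have y1N : y1^-1 != y1 by rewrite eq_invg_mul -[_ * _]/(y1 ^+ 2) -order_dvdn oy1.
have y1g : y1 ^ g = y1^-1.
  rewrite conjXg x0g -expgM; apply/eqP; rewrite eq_sym eq_invg_mul -expgD -(expg0 x0).
  by apply/eqP/x0E.
have [i x0m] : exists i, x0 ^ m = x0 ^+ i.
  have : x ^ coset T m \in <[x]>.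
    rewrite -defF memJ_norm ?defF ?cycle_id // -defF (subsetP (normal_norm nFL)) //.
    exact: mem_quotient.
  by case/cycleP=> i xm; exists i; apply: lift_pow.
have y1mm : y1 ^ (m ^+ 2) = y1.
  have co_i3 : ~~ (3 %| i).
    apply/negP=> /dvdnP[l Di]; have : #[y1 ^ m] = 3 by rewrite orderJ.
    have -> : y1 ^ m = 1; last by rewrite order1.
    by rewrite conjXg x0m -expgM Di -mulnA -(expg0 x0); apply: x0E; rewrite modnMl.
  have y1m : y1 ^ m = y1 ^+ i by rewrite conjXg x0m -!expgM mulnC.
  rewrite conjgM y1m conjXg y1m -expgM -[RHS]expg1; apply/eqP.
  rewrite eq_expg_mod_order oy1 -modnMm.
  have := ltn_pmod i (isT : 0 < 3); rewrite /dvdn in co_i3.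
  by case: (i %% 3) co_i3 => [|[|[|e]]].
have cycD : cyclic (<[g]> <*> <[m]>).
  have sDH : <[g]> <*> <[m]> \subset H by rewrite join_subG !cycle_subG Hg.
  apply: (semiregular_abelian_cyclic abV ntV (subset_trans sDH nVH)).
    exact: semiregularS regH.
  by rewrite abelianY !cycle_abelian /= cent_cycle cycle_subG; apply/cent1P; apply: commute_sym.
have chain : (<[g]> \subset <[m]>) || (<[m]> \subset <[g]>).
  rewrite -(cardSg_cyclic cycD (joing_subl _ _) (joing_subr _ _)).
  rewrite -(cardSg_cyclic cycD (joing_subr _ _) (joing_subl _ _)) -!orderE.
  have [l1 ->] := p_natP g2; have [l2 ->] := p_natP m2.
  by rewrite !dvdn_Pexp2l // leq_total.
case/orP: chain; rewrite cycle_subG => /cycleP[l Dl]; last first.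
  by move: z1m z1N; rewrite Dl => <-; rewrite (conjg_fixP _) ?eqxx //; apply/commgP/commuteX/commute_sym.
have [odd_l | even_l] := boolP (odd l).
  have zl j : odd j -> z1 ^ (m ^+ j) = z1^-1.
    have z1mm : z1 ^ (m ^+ 2) = z1 by rewrite conjgM z1m conjVg z1m invgK.
    elim/ltn_ind: j => [[|[|j]]] IH //= oj.
    by rewrite -[j.+2]addn2 addnC expgD conjgM z1mm IH // -[odd j]negbK.
  by move: z1N; rewrite -(zl l odd_l) -Dl z1g eqxx.
have yl j : ~~ odd j -> y1 ^ (m ^+ j) = y1.
  elim/ltn_ind: j => [[|[|j]]] IH //= oj; first by rewrite conjg1.
  by rewrite -[j.+2]addn2 addnC expgD conjgM y1mm IH // -[odd j]negbK.
by move: y1N; rewrite -y1g Dl (yl l even_l) eqxx.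
Qed.

End SylowStructure.

(** * Orders of fixed-point-free groups *)

Section Eigenspaces.

Variables (gT : finGroupType) (V : {group gT}) (h : gT) (c : nat).
Hypothesis abV : abelian V.

Definition eigenspace_of := [set v in V | v ^ h == v ^+ c].

Lemma eigenspace_of_group_set : group_set eigenspace_of.
Proof.
apply/group_setP; split=> [|v w]; first by rewrite inE group1 conj1g expg1n eqxx.
rewrite !inE => /andP[Vv /eqP vh] /andP[Vw /eqP wh]; rewrite groupM //= conjMg vh wh.
by rewrite expgMn //; apply: (centsP abV).
Qed.

Definition eigenspace_group := Group eigenspace_of_group_set.

(** The eigenspaces of h and of its conjugate h ^ t for the same eigenvalue have the
    same order and meet in the fixed points of h * (h ^ t)^-1. *)
Lemma eigenspace_card t : t \in 'N(V) -> 'C_V[h * (h ^ t)^-1] = 1 ->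
  eigenspace_group \subset V /\ #|eigenspace_group| ^ 2 <= #|V|.
Proof.
move=> nVt cV1; set E := eigenspace_group.
have sEV : E \subset V by apply/subsetP=> v; rewrite inE => /andP[].
have sEtV : E :^ t \subset V by rewrite -(normP nVt) conjSg.
have tiE : E :&: E :^ t = 1.
  apply/trivgP; rewrite -cV1; apply/subsetP=> v /setIP[].
  rewrite inE => /andP[Vv /eqP vh] /imsetP[w]; rewrite inE => /andP[Vw /eqP wh] Dv.
  rewrite inE Vv; apply/cent1P/commgP/conjg_fixP.
  suffices -> : v ^ (h * (h ^ t)^-1) = (v ^ (h ^ t)) ^ (h ^ t)^-1 by rewrite conjgK.
  rewrite conjgM; congr (_ ^ _); rewrite vh Dv -conjJg wh conjXg //.
split=> //; rewrite -mulnn -{2}(cardJg E t) -(TI_cardMg tiE).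
by apply: subset_leq_card; rewrite mul_subG.
Qed.

End Eigenspaces.

Section FixedPointFreeOrders.

Variables (gT : finGroupType) (q : nat) (V H : {group gT}).
Hypotheses (abV : q.-abelem V) (ntV : V :!=: 1) (nVH : H \subset 'N(V)).
Hypotheses (regH : semiregular V H) (qH : quadratic_characters H) (solH : solvable H).

Lemma odd_part_cases :
  let m := (#|H| `_2^')%N in
  [/\ m \in [:: 1%N; 3; 5], (3 %| #|H|) = (m == 3) & (5 %| #|H|) = (m == 5)].
Proof.
move=> m; have oH : #|H| = (#|H| `_2 * m)%N by rewrite partnC.
have m15 : m %| 15.
  apply/dvdn_partP => [|p]; first exact: part_gt0.
  rewrite mem_primes => /and3P[pr_p _ pm].
  have pH : p %| #|H| by apply: dvdn_trans pm (dvdn_part _ _).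
  have p2' : p != 2 by apply: (pnatPpi (part_pnat 2^' #|H|)); rewrite mem_primes pr_p part_gt0.
  have := prime_divisor_le5 abV ntV nVH regH qH pr_p pH; rewrite !inE (negPf p2') /= => p35.
  have odd_p : odd p by case/orP: p35 => /eqP ->.
  have le1 := odd_sylow_order abV ntV nVH regH qH pr_p odd_p.
  rewrite p_part; apply: (@dvdn_trans (p ^ 1)); last by case/orP: p35 => /eqP ->.
  by apply: dvdn_exp2l; apply: leq_trans (dvdn_leq_log _ _ (dvdn_part _ _)) le1.
have dvdE p : prime p -> odd p -> (p %| #|H|) = (p %| m).
  move=> pr_p odd_p; rewrite oH Gauss_dvdr // prime_coprime // -p'natE //.
  apply: sub_in_pnat (part_pnat 2 _) => r _ /eqP -> /=.
  by rewrite inE /= -[p]/(id p) inE; apply: contraTneq odd_p => <-.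
rewrite !dvdE //; have := @not_15_dvd _ _ _ _ abV ntV nVH regH qH solH; rewrite !dvdE //.
move: m15; rewrite dvdn_divisors // !inE => /or4P[] /eqP -> // no15.
by case: no15.
Qed.

Lemma sylow2_card_dvd16 (P : {group gT}) : 2.-Sylow(H) P -> #|P| %| 16.
Proof.
move=> sylP; case: (sylow2_cases abV ntV nVH regH qH solH sylP) => -[_].
  by rewrite !inE => /or3P[] /eqP ->.
by rewrite !inE => /orP[] /eqP ->.
Qed.

(** <[z]> has at most four conjugates, since its normalizer contains a 2-element
    of order at least four; by Sylow's theorem it has just one. *)
Lemma sylow5_normal z : z \in H -> #[z] = 5 -> <[z]> <| H.
Proof.
move=> Hz oz; have sZH : <[z]> \subset H by rewrite cycle_subG.
have H5 : 5 %| #|H| by rewrite -oz order_dvdG.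
have [m_cases _ m5] := odd_part_cases; rewrite H5 in m5.
have {m_cases}oH : #|H| = (#|H| `_2 * 5)%N by rewrite -(eqP (esym m5)) partnC.
have [P sylP] := Sylow_exists 2 H; have P16 := sylow2_card_dvd16 sylP.
rewrite (card_Hall sylP) in P16.
have c1z : commute 1 z by apply: commute_sym; apply: commute1.
have co15 : coprime #[1 : gT] 5 by rewrite order1.
have [w [/setIP[Hw _] w2 ow zw]] := order5_inverted abV ntV nVH regH qH (group1 H) Hz c1z co15 oz.
set N := 'N_H(<[z]>)%G.
have sylZ : 5.-Sylow(H) <[z]>.
  apply/and3P; split=> //; first by rewrite /pgroup -orderE oz.
  rewrite -divgS // -orderE oz oH mulnK // p'natE //.
  by apply/negP=> /dvdn_trans/(_ P16).
have N4 : 4 %| #|N|.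
  apply: dvdn_trans (order_dvdG (_ : w \in N)).
    have [l Dl] := p_natP w2; rewrite Dl in ow *.
    by case: l ow {Dl} => [|[|l]] // _; rewrite (@dvdn_exp2l 2 2).
  by rewrite inE Hw -cycle_subG norms_cycle zw groupV cycle_id.
have N5 : 5 %| #|N|.
  by rewrite -oz order_dvdG // inE Hz (subsetP (normG _)) ?cycle_id.
have N20 : 4 * 5 %| #|N| by rewrite Gauss_dvd // N4.
have sNH : N \subset H by apply: subsetIl.
have := card_Syl_mod H (isT : prime 5); rewrite (card_Syl sylZ) -/N.
have : #|H : N| %| 4.
  rewrite -(@dvdn_pmul2r (4 * 5)) //; apply: (@dvdn_trans (16 * 5)) => //.
  apply: (@dvdn_trans #|H|); last by rewrite oH dvdn_pmul2r.
  by rewrite -(Lagrange sNH) mulnC dvdn_pmul2r.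
rewrite dvdn_divisors // !inE => /or3P[] /eqP i1; rewrite i1 // => _.
have /eqP EN : N :==: H by rewrite eqEsubset sNH -indexg_eq1 i1.
by rewrite /normal sZH -EN subsetIr.
Qed.

Lemma card_order8_quaternion (P : {group gT}) :
  extremal_class P == Quaternion -> #|P| = 16 -> #|[set x in P | #[x] == 8]| <= 4.
Proof.
move=> quaP oP; have [n [a [[n_gt2 oPn Pa oa] [_ _ _ X4 _]]]] := quaternion_facts quaP.
have n4 : n = 4 by apply/eqP; rewrite -(eqn_exp2l _ _ (isT : 1 < 2)) -oPn oP.
rewrite n4 /= in oa; apply: (@leq_trans (totient #[a])); last by rewrite oa.
rewrite totient_gen; apply: subset_leq_card; apply/subsetP=> x.
rewrite !inE => /andP[Px /eqP ox].
have ax : x \in <[a]>.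
  by apply: contraT => nax; have := X4 x; rewrite !inE nax Px ox => /(_ isT).
by rewrite /generator eq_sym eqEcard cycle_subG ax -!orderE oa ox.
Qed.

(** Each element of order 8 lies in one of the at most #|H : P| Sylow 2-subgroups,
    each of which has at most 4 such elements. *)
Lemma card_order8 : #|[set x in H | #[x] == 8]| <= 4 * (#|H| `_2^')%N.
Proof.
have [P sylP] := Sylow_exists 2 H; have [sPH P2 _] := and3P sylP.
apply: (@leq_trans (4 * #|'Syl_2(H)|)); last first.
  rewrite leq_mul2l /= (card_Syl sylP); apply: dvdn_leq; first exact: part_gt0.
  have <- : #|H : P| = (#|H| `_2^')%N.
    apply/eqP; rewrite -(eqn_pmul2l (cardG_gt0 P)) Lagrange // (card_Hall sylP).
    by rewrite partnC.
  by apply: indexgS; rewrite subsetI sPH normG.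
apply: (@leq_trans #|\bigcup_(Q in 'Syl_2(H)) [set x in (Q : {group gT}) | #[x] == 8]|).
  apply: subset_leq_card; apply/subsetP=> x; rewrite inE => /andP[Hx /eqP ox].
  have x2 : 2.-group <[x]> by rewrite /pgroup -orderE ox.
  have sXH : <[x]> \subset H by rewrite cycle_subG.
  have [Q sylQ sXQ] := Sylow_superset sXH x2.
  apply/bigcupP; exists Q; first by rewrite inE.
  by rewrite inE -cycle_subG sXQ ox.
rewrite mulnC -sum_nat_const.
apply: (@leq_trans (\sum_(Q in 'Syl_2(H)) #|[set x in (Q : {group gT}) | #[x] == 8]|)).
  elim/big_rec2: _ => [|Q n A _ leAn]; first by rewrite cards0.
  by rewrite (leq_trans (leq_card_setU _ _).1) // leq_add2l.
apply: leq_sum => Q; rewrite inE => sylQ.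
have [[_ oQ] | [quaQ]] := sylow2_cases abV ntV nVH regH qH solH sylQ.
  rewrite leqNgt; apply/negP=> /(leq_ltn_trans (leq0n _))/card_gt0P[x].
  rewrite inE => /andP[/order_dvdG/dvdn_leq le8 /eqP ox].
  by move: (le8 (cardG_gt0 Q)) oQ; rewrite ox !inE => le /or3P[] /eqP Eo; rewrite Eo in le.
rewrite !inE => /orP[] /eqP oQ; last exact: card_order8_quaternion.
rewrite leqNgt; apply/negP=> /(leq_ltn_trans (leq0n _))/card_gt0P[x].
rewrite inE => /andP[Qx /eqP ox].
have EQ : <[x]> = Q by apply/eqP; rewrite eqEcard cycle_subG Qx -orderE ox oQ.
have [n [a [[n_gt2 oPn Pa oa] [_ oder _ _ _]]]] := quaternion_facts quaQ.
have n3 : n = 3 by apply/eqP; rewrite -(eqn_exp2l _ _ (isT : 1 < 2)) -oPn oQ.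
have := derG1P (cycle_abelian x); rewrite /= EQ => der1.
by move: oder; rewrite der1 cards1 n3.
Qed.

Lemma order8_noncentral x : x \in H -> #[x] = 8 -> exists2 t, t \in H & x ^ t != x.
Proof.
move=> Hx ox; have x2 : 2.-group <[x]> by rewrite /pgroup -orderE ox.
have sXH : <[x]> \subset H by rewrite cycle_subG.
have [P sylP sXP] := Sylow_superset sXH x2.
have [sPH P2 _] := and3P sylP; have Px : x \in P by rewrite -cycle_subG.
have [[_ oP] | [quaP _]] := sylow2_cases abV ntV nVH regH qH solH sylP.
  have := dvdn_leq (cardG_gt0 P) (order_dvdG Px); rewrite ox.
  by move: oP; rewrite !inE => /or3P[] /eqP ->.
have [n [a [[n_gt2 oPn Pa oa] [_ _ _ X4 Xinv]]]] := quaternion_facts quaP.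
have ax : x \in <[a]>.
  by apply: contraT => nax; have := X4 x; rewrite !inE nax Px ox => /(_ isT).
have : ~~ (P \subset <[a]>).
  apply/negP=> /subset_leq_card; rewrite -orderE oa oPn leq_exp2l //.
  by case: n n_gt2 {oPn oa} => // n _; rewrite ltnn.
case/subsetPn=> t Pt nat; exists t; first exact: (subsetP sPH).
rewrite (Xinv x t ax) ?inE ?nat //.
by rewrite eq_invg_mul -[_ * _]/(x ^+ 2) -order_dvdn ox.
Qed.

(** For odd q an element of H has order (q - 1) / 2, a divisor of 16 m that is not
    divisible by 16, where m, the odd part of the order of H, is 1, 3 or 5. The primes
    q left by this arithmetic, apart from those of the table, are 17, 11 and 41; in
    these cases the eigenvectors would come from too few elements of H. *)
Theorem fixed_point_free_orders :
    prime q -> H :!=: 1 ->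
    (forall k, coprime k q -> forall v, v \in V -> exists2 h, h \in H & v ^ h = v ^+ (k ^ 2)) ->
  (2 %| #|H|, 3 %| #|H|, 5 %| #|H|, q) \in
    [:: (true, false, false, 3); (true, false, false, 5); (false, true, false, 2);
        (false, true, false, 7); (true, true, false, 5); (true, true, false, 7);
        (true, true, false, 13); (true, false, true, 3)].
Proof.
move=> pr_q ntH powH.
have [m_cases -> ->] := odd_part_cases; set m := (#|H| `_2^')%N in m_cases *.
have oH : #|H| = (#|H| `_2 * m)%N by rewrite partnC.
have co_qH : ~~ (q %| #|H|).
  have := regular_coprime nVH regH.
  have [_ qV _] := pgroup_pdiv (abelem_pgroup abV) ntV.
  by rewrite -prime_coprime // => /(coprime_dvdl qV).
have expV v : v \in V^# -> #[v] = q.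
  by case/setD1P=> ntv Vv; have [_ _ eV] := and3P abV; apply: abelem_order_p abV Vv ntv.
have odd_q_facts : q != 2 -> exists2 c, coprime c q &
    forall v, v \in V^# -> exists h,
      [/\ h \in H, #[h] = (q.-1)./2 & forall j, v ^ (h ^+ j) = v ^+ (c ^ j)].
  move=> q2; have odd_q : odd q by case: (even_prime pr_q) q2 => // ->.
  have [k co_k kP] := prime_primitive_root pr_q.
  exists (k ^ 2)%N; first by rewrite coprimeXl.
  move=> v V1v; have [ntv Vv] := setD1P V1v; have [h Hh vh] := powH k co_k v Vv.
  have vhj j : v ^ (h ^+ j) = v ^+ ((k ^ 2) ^ j).
    elim: j => [|j IHj]; first by rewrite conjg1.
    by rewrite expgSr conjgM IHj conjXg vh -expgM -expnS.
  exists h; split=> //; apply/eqP.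
  have Dq : q.-1 = (2 * (q.-1)./2)%N.
    by rewrite mul2n -[LHS]odd_double_half -subn1 oddB ?prime_gt0 // odd_q.
  have ordE j : (h ^+ j == 1) = ((q.-1)./2 %| j).
    have -> : (h ^+ j == 1) = (v ^ (h ^+ j) == v).
      apply/eqP/eqP=> [-> | fixv]; first by rewrite conjg1.
      apply: contraNeq ntv => nth; have cvh : commute v (h ^+ j) by apply/commgP/conjg_fixP.
      have : v \in 'C_V[h ^+ j] by rewrite inE Vv; apply/cent1P.
      by rewrite regH ?inE ?nth ?groupX.
    rewrite vhj -[X in _ == X]expg1 eq_expg_mod_order expV // -expnM kP.
    by rewrite {1}Dq dvdn_pmul2l.
  by rewrite eqn_dvd order_dvdn ordE dvdnn -ordE expg_order eqxx.
have count (c : nat) (S : {set gT}) : (forall s, s \in S -> s \in H) ->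
    (forall s, s \in S -> exists2 t, t \in H & s ^ t != s) ->
    (forall v, v \in V^# -> exists2 s, s \in S & v ^ s = v ^+ c) ->
  exists e, [/\ 1 < e, e %| #|V|, e ^ 2 <= #|V| & #|V| <= 1 + #|S| * e.-1]%N.
- move=> sSH ncS cov; have cVV := abelem_abelian abV.
  apply: (cover_card_bound (E := fun s => eigenspace_group s c cVV) ntV) => [s Ss | v V1v].
    have [t Ht st] := ncS s Ss; have Hs := sSH s Ss; apply: (@eigenspace_card _ _ _ _ _ t).
      exact: (subsetP nVH).
    apply: regH; rewrite !inE groupM ?groupV ?groupJ // ?andbT.
    by rewrite -eq_mulgV1 eq_sym.
  have [s Ss vs] := cov v V1v; exists s => //; rewrite inE vs eqxx andbT.
  by case/setD1P: V1v.
have qV : q.-group V := abelem_pgroup abV.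
have pow_e e : 1 < e -> e %| #|V| -> q %| e.
  move=> e_gt1 eV; have [l De] := p_natP (pnat_dvd eV qV).
  by move: e_gt1; rewrite De; case: l {De} => // l _; rewrite expnS dvdn_mulr.
have [v0 V1v0] : exists v, v \in V^#.
  by apply/set0Pn; rewrite -subset0 subDset setU0 subG1.
have dvdHV : #|H| %| #|V|.-1 := regular_norm_dvd_pred nVH regH.
have V_gt1 : 1 < #|V| by rewrite cardG_gt1.
(* S consists of the elements of order 8, of which there are at most 4 m *)
have q17 : q != 17.
  apply/eqP=> q17; have q2 : q != 2 by rewrite q17.
  have [c _ fus] := odd_q_facts q2; rewrite q17 in fus.
  have [|||e [e1 eV e2 Ve]] := count c [set x in H | #[x] == 8].
  - by move=> s; rewrite inE => /andP[].
  - by move=> s; rewrite inE => /andP[Hs /eqP]; apply: order8_noncentral.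
  - move=> v V1v; have [h [Hh oh vh]] := fus v V1v; exists h; first by rewrite inE Hh oh.
    by have := vh 1%N; rewrite !expg1 expn1.
  have q_e : 17 %| e by rewrite -q17 pow_e.
  have Se : #|V| <= 1 + (4 * m) * e.-1.
    by apply: leq_trans Ve _; rewrite leq_add2l leq_mul2r card_order8 orbT.
  have le1 : e * e <= 1 + (4 * m) * e.-1 by rewrite mulnn; apply: leq_trans e2 _.
  have e_gt0 : 0 < e by apply: ltnW.
  have le17 := dvdn_leq e_gt0 q_e.
  have m5 : m = 5.
    move: m_cases le1 le17; rewrite !inE; clear; case/or3P=> /eqP -> //; nia.
  have e17 : e = 17.
    case/dvdnP: q_e le1 le17 => d ->; rewrite m5; clear; case: d => [|[|d]] //; nia.
  have [l Vl] := p_natP qV; rewrite m5 e17 q17 in Vl Se.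
  rewrite e17 in e2; rewrite Vl in e2 Se dvdHV.
  have l2 : l = 2.
    apply/eqP; rewrite eqn_leq; apply/andP; split.
      by rewrite -ltnS -(ltn_exp2l _ _ (isT : 1 < 17)); apply: leq_ltn_trans Se _.
    by rewrite -(leq_exp2l _ _ (isT : 1 < 17)).
  have H5 : 5 %| #|H| by rewrite oH m5 dvdn_mull.
  by have := dvdn_trans H5 dvdHV; rewrite l2.
(* S consists of the 4 elements of order 5, which w inverts *)
have q11_41 : m = 5 -> (q != 11) && (q != 41).
  move=> m5; have H5 : 5 %| #|H| by rewrite oH m5 dvdn_mull.
  have [z Hz oz] := Cauchy (isT : prime 5) H5.
  have nZH := sylow5_normal Hz oz.
  have c1z : commute 1 z by apply: commute_sym; apply: commute1.
  have co15 : coprime #[1 : gT] 5 by rewrite order1.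
  have [w [/setIP[Hw _] _ _ zw]] := order5_inverted abV ntV nVH regH qH (group1 H) Hz c1z co15 oz.
  have sylZ : 5.-Sylow(H) <[z]>.
    apply/and3P; split; rewrite ?normal_sub // /pgroup -?orderE ?oz //.
    rewrite -divgS ?normal_sub // -orderE oz oH m5 mulnK // p'natE //.
    by apply/negP; have /p_natP[l ->] := part_pnat 2 #|H|; rewrite Euclid_dvdX.
  have Zz x : x \in H -> #[x] = 5 -> x \in <[z]>.
    move=> Hx ox; rewrite (mem_normal_Hall sylZ nZH) //.
    by rewrite /p_elt ox.
  have excl i : 0 < i -> (5 * i = (q.-1)./2)%N -> False.
    move=> i_gt0 oi; have q_ge : 10 < q.
      have : 5 * 1 <= (q.-1)./2 by rewrite -oi leq_mul2l.
      by move: (q) => r; clear; lia.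
    have q2 : q != 2 by apply: contraTneq q_ge => ->.
    have [c _ fus] := odd_q_facts q2.
    have [|||e [e1 eV e2 Ve]] := count (c ^ i)%N <[z]>^#.
    - by move=> s /setD1P[_ Zs]; rewrite (subsetP (normal_sub nZH)).
    - move=> s /setD1P[nts /cycleP[j Ds]]; exists w => //.
      rewrite Ds conjXg zw expgVn eq_invg_mul -Ds -[_ * _]/(s ^+ 2) -order_dvdn.
      have /prime_nt_dvdP -> // : #[s] %| 5 by rewrite Ds -oz orderXdvd.
      by rewrite order_eq1.
    - move=> v V1v; have [h [Hh oh vh]] := fus v V1v; exists (h ^+ i); rewrite ?vh //.
      have ohi : #[h ^+ i] = 5 by rewrite orderXdiv oh -oi ?dvdn_mull // mulnK.
      by rewrite !inE -order_eq1 ohi Zz ?groupX.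
    have e_q : q <= e by apply: dvdn_leq (pow_e e e1 eV); apply: ltnW.
    have Z1 : #|<[z]>^#| = 4 by have := cardsD1 1 <[z]>; rewrite group1 -orderE oz => -[].
    have le1 := leq_trans e2 Ve; rewrite Z1 in le1.
    by have := leq_trans q_ge e_q; move: le1; rewrite -mulnn; clear; nia.
  by apply/andP; split; apply/eqP=> Dq; [apply: (excl 1%N) | apply: (excl 4)]; rewrite ?Dq.
have q_order : q != 2 -> exists2 h, h \in H & #[h] = (q.-1)./2.
  by move=> q2; have [c _ fus] := odd_q_facts q2; have [h [Hh oh _]] := fus v0 V1v0; exists h.
have Dq : q != 2 -> q = ((q.-1)./2).*2.+1.
  move=> q2; have odd_q : odd q by case: (even_prime pr_q) q2 => // ->.
  by rewrite -[LHS](odd_double_half q) odd_q add1n /= -[in RHS](odd_double_half q) odd_q /= doubleK.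
have [even_H | odd_H] := boolP (2 %| #|H|); last first.
  have H2 : (#|H| `_2 = 1)%N by apply: part_p'nat; rewrite p'natE.
  rewrite H2 mul1n in oH.
  have m3 : m = 3.
    move: m_cases; rewrite !inE => /or3P[] /eqP Dm //.
      by move: ntH; rewrite -cardG_gt1 oH Dm.
    have H5 : 5 %| #|H| by rewrite oH Dm.
    have [z Hz oz] := Cauchy (isT : prime 5) H5.
    have c1z : commute 1 z by apply: commute_sym; apply: commute1.
    have co15 : coprime #[1 : gT] 5 by rewrite order1.
    have [w [/setIP[Hw _] w2 ow zw]] := order5_inverted abV ntV nVH regH qH (group1 H) Hz c1z co15 oz.
    have [l Dl] := p_natP w2; case/negP: odd_H; apply: dvdn_trans (order_dvdG Hw).
    by rewrite Dl in ow *; case: l ow {Dl} => // l _; rewrite expnS dvdn_mulr.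
  have [-> | q2] := eqVneq q 2; first by rewrite m3.
  have [h Hh oh] := q_order q2.
  have := order_dvdG Hh; rewrite oh oH m3 dvdn_divisors // !inE.
  have := Dq q2 => /[swap] /orP[] /eqP -> Eq; last by rewrite Eq.
  by move: co_qH; rewrite Eq oH m3.
have q2 : q != 2 by apply: contraNneq co_qH => ->.
have [h Hh oh] := q_order q2.
have [P sylP] := Sylow_exists 2 H; have P16 := sylow2_card_dvd16 sylP.
have dvd16 : (q.-1)./2 %| 16 * m.
  rewrite -oh; apply: dvdn_trans (order_dvdG Hh) _.
  by rewrite oH -(card_Hall sylP) dvdn_mul.
have n16 : ~~ (16 %| (q.-1)./2).
  apply/negP=> /dvdnP[d Do]; apply: (no_order_16 abV ntV nVH regH qH (groupX d Hh)).
  have d_gt0 : 0 < d by case: d Do => // o0; have := order_gt0 h; rewrite oh o0.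
  by rewrite orderXdiv oh Do ?dvdn_mulr // mulKn.
have qm : q != m by apply: contraNneq co_qH => ->; rewrite oH dvdn_mull.
have := Dq q2; move: n16 dvd16 qm pr_q q17 q11_41; move: ((q.-1)./2) => o n16.
rewrite dvdn_divisors; last by move: m_cases; rewrite !inE => /or3P[] /eqP ->.
have d16 : divisors (16 * 1) = [:: 1%N; 2; 4; 8; 16] by [].
have d48 : divisors (16 * 3) = [:: 1%N; 2; 3; 4; 6; 8; 12; 16; 24; 48] by [].
have d80 : divisors (16 * 5) = [:: 1%N; 2; 4; 5; 8; 10; 16; 20; 40; 80] by [].
move=> dvd16 qm pr_q q17 q11_41 Eq; move: m_cases; rewrite !inE => /or3P[] /eqP Em;
  move: q11_41 dvd16 qm; rewrite Em ?d16 ?d48 ?d80 Eq => q11_41 dvd16 qm;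
  rewrite Eq in pr_q q17; move: dvd16 n16 pr_q q17 q11_41 qm; clear; rewrite !inE.
- by do ?[case/orP]; move=> /eqP ->.
- by do ?[case/orP]; move=> /eqP ->.
- by do ?[case/orP]; move=> /eqP -> // _ _ _ /(_ erefl).
Qed.

End FixedPointFreeOrders.

(** * Groups without elements of mixed order *)

Definition unmixed (pi : nat_pred) (gT : finGroupType) (G : {group gT}) : Prop :=
  forall x, x \in G -> pi.-elt x || pi^'.-elt x.

Section Unmixed.

Variables (gT : finGroupType) (pi : nat_pred).
Implicit Types G N H : {group gT}.

Lemma unmixed_quotient G N : unmixed pi G -> unmixed pi (G / N).
Proof.
move=> uG _ /morphimP[x Nx Gx ->].
by case/orP: (uG x Gx) => px; apply/orP; [left | right]; apply: (pnat_dvd (morph_order _ Nx)).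
Qed.

Lemma unmixed_commute G x y : unmixed pi G -> x \in G -> y \in G -> commute x y ->
  pi.-elt x -> pi^'.-elt y -> x = 1 \/ y = 1.
Proof.
move=> uG Gx Gy cxy px py; have co_xy : coprime #[x] #[y] := pnat_coprime px py.
have oxy := orderM cxy co_xy.
case/orP: (uG _ (groupM Gx Gy)); rewrite /p_elt oxy pnatM => /andP[px' py'].
  by right; apply/eqP; rewrite -order_eq1 (pnat_1 py' py).
by left; apply/eqP; rewrite -order_eq1 (pnat_1 px px').
Qed.

Lemma unmixed_cent G x y : unmixed pi G -> x \in G -> y \in G -> commute x y ->
  pi^'.-elt y -> y != 1 -> pi^'.-elt x.
Proof.
move=> uG Gx Gy cxy py nty; case/orP: (uG x Gx) => // px.
have [-> | y1] := unmixed_commute uG Gx Gy cxy px py; first by rewrite p_elt1.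
by rewrite y1 eqxx in nty.
Qed.

End Unmixed.

Section UpperFrobenius.

Variables (gT : finGroupType) (pi : nat_pred) (L : {group gT}).
Hypotheses (solL : solvable L) (qL : quadratic_characters L) (uL : unmixed pi L).
Hypotheses (OL1 : 'O_pi(L) = 1) (npi'L : ~~ pi^'.-group L).
Hypotheses (cycF : cyclic 'F(L)) (oddF : odd #|'F(L)|).

Let F := 'F(L)%G.
Let nFL : F <| L. Proof. exact: Fitting_normal. Qed.

Lemma Fitting_pi' : pi^'.-group 'F(L).
Proof.
have hallF := nilpotent_pcore_Hall pi (Fitting_nil L).
have O1 : 'O_pi('F(L)) = 1 by apply/trivgP; rewrite -OL1 pcore_Fitting.
by have := pHall_pgroup hallF; case/and3P: hallF => _ _; rewrite O1 indexg1.
Qed.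

Let cFF : abelian F. Proof. exact: cyclic_abelian. Qed.

Lemma cent_Fitting_eq : 'C_L('F(L)) = 'F(L).
Proof.
by apply/eqP; rewrite eqEsubset solvable_cent_Fitting //= subsetI normal_sub.
Qed.

(** L / F is abelian, because F contains its centralizer and L / 'C_L(F) is abelian; an
    unmixed abelian group is a pi-group or a pi'-group, and L is not a pi'-group. *)
Lemma quotient_Fitting_pi : pi.-group (L / F).
Proof.
have abA : abelian (L / F).
  apply: sub_der1_abelian; apply: (@subset_trans _ _ 'C_L('F(L))).
    by rewrite subsetI der_sub; apply: der1_cent_cyclic (normal_norm nFL).
  by rewrite cent_Fitting_eq.
have uA : unmixed pi (L / F) := unmixed_quotient uL.
have [s [pr_s pi_s s_A]] : exists s, [/\ prime s, s \in pi & s %| #|L / F|].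
  have oL : #|L| = (#|F| * #|L / F|)%N by rewrite card_quotient ?normal_norm // Lagrange ?normal_sub.
  have : ~~ pi^'.-nat #|L / F|.
    by apply: contra npi'L => piA; rewrite /pgroup oL pnatM piA andbT; apply: Fitting_pi'.
  rewrite /pnat cardG_gt0 /= => /allPn[s]; rewrite mem_primes => /and3P[pr_s _ s_A].
  by rewrite inE /= negbK => pi_s; exists s.
have [a Aa oa] := Cauchy pr_s s_A.
apply/pgroupP=> t pr_t t_A; apply: contraT => pi't.
have [b Ab ob] := Cauchy pr_t t_A.
have pi_a : pi.-elt a by rewrite /p_elt oa pnatE.
have pi'b : pi^'.-elt b by rewrite /p_elt ob pnatE.
have [a1|b1] := unmixed_commute uA Aa Ab (centsP abA a Aa b Ab) pi_a pi'b.
- by move: pr_s; rewrite -oa a1 order1.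
- by move: pr_t; rewrite -ob b1 order1.
Qed.

Lemma mem_Fitting x : x \in L -> pi^'.-elt x -> x \in 'F(L).
Proof.
move=> Lx px; have hallF : pi^'.-Hall(L) F.
  apply/and3P; split; rewrite ?normal_sub ?Fitting_pi' //.
  rewrite -card_quotient ?normal_norm //; apply: sub_in_pnat quotient_Fitting_pi.
  by move=> p _ /= pi_p; rewrite inE /= inE /= pi_p.
by rewrite (mem_normal_Hall hallF nFL).
Qed.

Lemma Fitting_commute g y : g \in L -> y \in 'F(L) -> y != 1 -> commute g y -> g \in 'F(L).
Proof.
move=> Lg Fy nty cgy; apply: mem_Fitting => //.
apply: (unmixed_cent uL Lg _ cgy (mem_p_elt Fitting_pi' Fy) nty).
exact: (subsetP (normal_sub nFL)).
Qed.

Let sFL : {subset 'F(L) <= L}. Proof. exact/subsetP/normal_sub. Qed.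

Let FF : {in 'F(L) &, forall x y, commute x y}. Proof. by move=> x y Fx Fy; apply: (centsP cFF). Qed.

(** An element of L commuting with a nontrivial element of F lies in F, hence commutes
    with all of F. If the order of F had a square factor p ^ 2, or a prime factor p >= 5
    besides another one, the power maps of exponents (1 + p) ^ 2, or 4 on the p-part
    alone, would be induced by such elements. *)
Lemma Fitting_prime_order : prime #|'F(L)|.
Proof.
have ntF : 'F(L) != 1.
  by rewrite trivg_Fitting //; apply: contraNneq npi'L => ->; apply: pgroup1.
have F_gt1 : 1 < #|F| by rewrite cardG_gt1.
have no_sq p : prime p -> ~~ (p ^ 2 %| #|F|).
  move=> pr_p; apply/negP=> p2F; have /cyclicP[x defF] := cycF.
  have odd_p : odd p.
    have pF : p %| #|F| by apply: dvdn_trans p2F; rewrite -mulnn dvdn_mulr.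
    by apply: dvdn_odd pF _.
  have ox : #[x] = #|F| by rewrite orderE -defF.
  have p_gt0 := prime_gt0 pr_p.
  pose y := x ^+ (#[x] %/ p ^ 2).
  have Fy : y \in F by rewrite /= defF mem_cycle.
  have oy : #[y] = (p ^ 2)%N.
    rewrite orderXdiv ?dvdn_div ?ox // divnA // mulKn //.
  have co_k : coprime (1 + p) #[y].
    by rewrite oy coprimeXr // coprime_sym /coprime gcdnDr gcdn1.
  have /imsetP[g Lg yg] := square_power_class qL (sFL Fy) co_k.
  have Dk : ((1 + p) ^ 2 = (2 * p).+1 + p ^ 2)%N by rewrite sqrnD; clear; lia.
  have yp2 : y ^+ (p ^ 2) = 1 by rewrite -oy expg_order.
  have ypg : (y ^+ p) ^ g = y ^+ p.
    have Dkp : ((1 + p) ^ 2 * p = p + (p + 2) * p ^ 2)%N by ring.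
    rewrite conjXg -yg -expgM Dkp; apply/eqP; rewrite eq_expg_mod_order oy.
    by rewrite addnC modnMDl.
  have Fg : g \in F.
    apply: (@Fitting_commute g (y ^+ p)) => //; first exact: groupX.
      rewrite -order_dvdn oy; apply/negP=> /(dvdn_leq p_gt0).
      by rewrite -mulnn leqNgt -{1}[p]muln1 ltn_pmul2l ?prime_gt1.
    by apply: commute_sym; apply/commgP/conjg_fixP.
  have /commgP/conjg_fixP : commute y g by apply: FF.
  rewrite -yg Dk => /eqP; rewrite -[X in _ == X]expg1 eq_expg_mod_order oy modnDr.
  rewrite eqn_mod_dvd // subn1 /= -mulnn => /dvdn_leq; rewrite muln_gt0 p_gt0 => /(_ isT).
  by rewrite leq_pmul2r // => p_le2; move: (prime_gt1 pr_p) odd_p p_le2; clear; lia.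
have no_two p s : prime p -> prime s -> 5 <= p -> p != s -> p %| #|F| -> s %| #|F| -> False.
  move=> pr_p pr_s p_ge5 neq_ps pF sF.
  have [b Fb ob] := Cauchy pr_p pF; have [a Fa oa] := Cauchy pr_s sF.
  have co_ab : coprime #[a] #[b] by rewrite oa ob prime_coprime // dvdn_prime2 // eq_sym.
  have co_2b : coprime 2 #[b] by rewrite ob coprime2n (dvdn_odd pF).
  have [g /setIP[Lg cag] bg] := square_power_cent qL (sFL Fa) (sFL Fb) (FF Fa Fb) co_ab co_2b.
  have Fg : g \in F.
    apply: (@Fitting_commute g a) => //; first by rewrite -order_gt1 oa prime_gt1.
    by apply/cent1P.
  have /commgP/conjg_fixP : commute b g by apply: FF.
  rewrite bg => /eqP; rewrite -[X in _ == X]expg1 eq_expg_mod_order ob eqn_mod_dvd //.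
  by move/dvdn_leq => /(_ isT); rewrite leqNgt (leq_trans _ p_ge5).
pose r := pdiv #|F|; have pr_r : prime r := pdiv_prime F_gt1.
have rF : r %| #|F| := pdiv_dvd _.
have odd_pF p : p %| #|F| -> odd p by move/dvdn_odd; apply.
have ge5 p s : prime p -> prime s -> p != s -> odd p -> odd s -> (5 <= p) || (5 <= s).
  by case: p => [|[|[|[|[|p]]]]] //; case: s => [|[|[|[|[|s]]]]].
case/dvdnP: (rF) => m Dm.
have [m_le1 | m_gt1] := leqP m 1.
  suffices m1 : m = 1%N by rewrite -/F Dm m1 mul1n.
  by case: m Dm m_le1 => [|[|m]] // F0; move: F_gt1; rewrite F0.
pose s := pdiv m; have pr_s : prime s := pdiv_prime m_gt1.
have sm : s %| m := pdiv_dvd _.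
have sF : s %| #|F| by rewrite Dm dvdn_mulr.
have [Drs | neq_rs] := eqVneq r s.
  by case/negP: (no_sq r pr_r); rewrite Dm -mulnn dvdn_pmul2r ?prime_gt0 // Drs.
case/orP: (ge5 r s pr_r pr_s neq_rs (odd_pF r rF) (odd_pF s sF)) => [r5 | s5].
  by case: (no_two r s).
by case: (no_two s r) => //; rewrite eq_sym.
Qed.

(** With r the order of F, the order d of L / F divides r - 1 and is a multiple of
    (r - 1) / 2, and d, the order of a cyclic quotient, is 2, 3, 4 or 6. *)
Theorem upper_Frobenius_orders :
  [/\ cyclic (L / 'F(L)), prime #|'F(L)| &
      (#|'F(L)|, #|L / 'F(L)|) \in
        [:: (3, 2); (5, 2); (5, 4); (7, 3); (7, 6); (13, 6)]].
Proof.
have pr_r := Fitting_prime_order; set r := #|'F(L)| in pr_r *.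
have odd_r : odd r by [].
have cycA : cyclic (L / F).
  have /isog_cyclic <- : (conj_aut F @* L) \isog (L / F).
    have := first_isog_loc (conj_aut F) (normal_norm nFL).
    rewrite ker_conj_aut.
    have -> : 'C_L(F) = F by apply: cent_Fitting_eq.
    by rewrite isog_sym.
  by apply: cyclicS (Aut_conj_aut _ _) _; apply: Aut_prime_cyclic.
have oA : #|L / F| = #|L : F| by rewrite card_quotient ?normal_norm.
have dvd_d : #|L / F| %| r.-1.
  have := index_cent_cyclic cycF (normal_norm nFL).
  by rewrite (cent_Fitting_eq) totient_prime // oA.
have [x Fx ox] := Cauchy pr_r (dvdnn r).
have c1x : commute 1 x by apply: commute_sym; apply: commute1.
have co1 : coprime #[1 : gT] r by rewrite order1 coprime1n.
have [c [g /setIP[Lg _] [xg xc]]] :=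
  prime_order_fusion qL (group1 L) (sFL Fx) c1x co1 pr_r odd_r ox.
have dvd_r : (r.-1)./2 %| #|L / F|.
  rewrite -xc -xg; apply/eqP/conjg_fixP/commgP; apply: FF => //.
  apply: coset_idr; first by rewrite groupX // (subsetP (normal_norm nFL)).
  rewrite morphX ?(subsetP (normal_norm nFL)) //; apply/eqP; rewrite -order_dvdn.
  by apply: order_dvdG; apply: mem_quotient.
have d_le : #|L / F| \in [:: 1%N; 2; 3; 4; 6] := cyclic_quotient_order qL nFL cycA.
have d1 : #|L / F| != 1%N.
  rewrite oA indexg_eq1; apply: contra npi'L => sLF.
  exact: pgroupS sLF Fitting_pi'.
split=> //; have r_gt1 := prime_gt1 pr_r.
have Dr : (r = ((r.-1)./2).*2.+1)%N.
  by rewrite -[LHS](odd_double_half r) odd_r add1n /= -[in RHS](odd_double_half r) odd_r /= doubleK.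
move: d_le d1 dvd_d dvd_r pr_r; rewrite -/F Dr /= doubleK.
move: ((r.-1)./2) (#|L / F|) => h d; clear; rewrite !inE.
case/or4P=> [/eqP-> //|/eqP->|/eqP->|/orP[]/eqP->] _.
all: move=> dv; rewrite dvdn_divisors // => hd; move: hd dv; rewrite !inE.
all: by do ?[case/orP]; move=> /eqP ->.
Qed.

End UpperFrobenius.

Section CentralizedChiefFactor.

Variables (gT : finGroupType) (pi : nat_pred) (q : nat) (G V : {group gT}).
Let K := 'O_pi(G)%G.
Hypotheses (solG : solvable G) (qG : quadratic_characters G) (uG : unmixed pi G).
Hypotheses (pr_q : prime q) (abV : q.-abelem V) (ntV : V :!=: 1) (nVG : V <| G).
Hypotheses (sVK : V \subset K) (cVK : K \subset 'C(V)).

Let nKG : K <| G. Proof. exact: pcore_normal. Qed.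
Let piK : pi.-group K. Proof. exact: pcore_pgroup. Qed.
Let piV : pi.-group V. Proof. exact: pgroupS sVK piK. Qed.
Let sVG : V \subset G. Proof. exact: normal_sub. Qed.
Let sKG : K \subset G. Proof. exact: normal_sub. Qed.
Let nKx x : x \in G -> x \in 'N(K). Proof. exact/subsetP/normal_norm. Qed.

Lemma chief_factor_prime_pi : q \in pi.
Proof.
have [_ qV _] := pgroup_pdiv (abelem_pgroup abV) ntV.
by have := pgroupP piV q pr_q qV.
Qed.

Lemma pi'_elt_regular x : x \in G -> pi^'.-elt x -> x != 1 -> 'C_V[x] = 1.
Proof.
move=> Gx p'x ntx; apply/trivgP/subsetP=> v /setIP[Vv /cent1P cxv].
have Gv := subsetP sVG v Vv.
have [-> | x1] := unmixed_commute uG Gv Gx cxv (mem_p_elt piV Vv) p'x.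
  by rewrite inE.
by rewrite x1 eqxx in ntx.
Qed.

Lemma pi'_group_semiregular (Q : {group gT}) : Q \subset G -> pi^'.-group Q -> semiregular V Q.
Proof.
move=> sQG p'Q x /setD1P[ntx Qx]; apply: pi'_elt_regular => //; first exact: (subsetP sQG).
exact: mem_p_elt p'Q Qx.
Qed.

Section NonFrobenius.

Let L := (G / K)%G.
Hypothesis npi'L : ~~ pi^'.-group L.

Let solL : solvable L. Proof. exact: quotient_sol. Qed.
Let qL : quadratic_characters L. Proof. exact: quadratic_characters_quotient. Qed.
Let uL : unmixed pi L. Proof. exact: unmixed_quotient. Qed.
Let OL1 : 'O_pi(L) = 1. Proof. exact: trivg_pcore_quotient. Qed.
Let F := 'F(L)%G.
Let nFL : F <| L. Proof. exact: Fitting_normal. Qed.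
Let p'F : pi^'.-group F. Proof. exact: Fitting_pi'. Qed.

(** Take a Hall pi'-subgroup of the preimage of F in G. *)
Lemma Fitting_lift : exists Q : {group gT},
  [/\ Q \subset G, pi^'.-group Q, Q :&: K = 1 & Q / K = F].
Proof.
have [M DM sKM nMG] := inv_quotientN nKG nFL.
have sMG := normal_sub nMG.
have [Q hallQ] := Hall_exists pi^' (solvableS sMG solG).
have sQM := pHall_sub hallQ; have p'Q := pHall_pgroup hallQ.
exists Q; split=> //; first exact: subset_trans sQM sMG.
  by apply: coprime_TIg; rewrite coprime_sym (pnat_coprime piK p'Q).
rewrite DM; apply: pHall_id.
  apply: quotient_pHall hallQ; apply: subset_trans sQM _.
  exact: subset_trans sMG (normal_norm nKG).
by rewrite /= -DM.
Qed.

Lemma pi_elt_exists : exists a, [/\ a \in L, pi.-elt a & a != 1].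
Proof.
have : ~~ pi^'.-nat #|L| by [].
rewrite /pnat cardG_gt0 /= => /allPn[s]; rewrite mem_primes => /and3P[pr_s _ s_L].
rewrite inE /= negbK => pi_s; have [a La oa] := Cauchy pr_s s_L.
exists a; split=> //; [by rewrite /p_elt oa pnatE | by rewrite -order_gt1 oa prime_gt1].
Qed.

(** The lift Q of F acts on V without fixed points, so its Sylow subgroups of odd order
    are cyclic. If Q had even order, its unique involution would be centralized,
    modulo K, by a nontrivial pi-element of L. *)
Lemma Fitting_quotient_odd_cyclic : cyclic 'F(L) /\ odd #|'F(L)|.
Proof.
have [Q [sQG p'Q tiQK DQ]] := Fitting_lift.
have nVQ : Q \subset 'N(V) := subset_trans sQG (normal_norm nVG).
have regQ := pi'_group_semiregular sQG p'Q.
have nKQ : Q \subset 'N(K) := subset_trans sQG (normal_norm nKG).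
have isoQ : Q \isog F by rewrite -DQ; apply: quotient_isog; rewrite // setIC.
have injQ : {in Q &, injective (coset K)}.
  move=> x y Qx Qy /= Exy; apply/eqP; rewrite eq_mulgV1 -in_set1 -[[set 1]]/(1 : {set gT}) -tiQK.
  rewrite inE groupM ?groupV //=; apply: coset_idr; first by rewrite groupM ?groupV ?(subsetP nKQ).
  by rewrite morphM ?groupV ?(subsetP nKQ) // morphV ?(subsetP nKQ) //= Exy mulgV.
have oQF : #|Q| = #|F| := card_isog isoQ.
have oddQ : odd #|Q|.
  apply: contraT; rewrite -dvdn2 => evenQ; have [t Qt ot] := Cauchy (isT : prime 2) evenQ.
  have Ft : coset K t \in F by rewrite -DQ mem_quotient.
  have [a [La pi_a nta]] := pi_elt_exists.
  have ntt : coset K t != 1.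
    apply/eqP=> Kt1; have t1 : t = 1 by apply: injQ; rewrite ?group1 // Kt1 morph1.
    by rewrite t1 order1 in ot.
  have cat : commute a (coset K t).
    apply: commute_sym; apply/commgP/conjg_fixP.
    have : coset K t ^ a \in F by rewrite memJ_norm // (subsetP (normal_norm nFL)).
    rewrite -DQ => /morphimP[s Ns Qs Ds]; rewrite Ds; congr (coset K _).
    apply: (involution_unique abV ntV nVQ regQ) => //.
    apply: nt_prime_order => //.
      apply: injQ; rewrite ?groupX ?group1 // morphX //= -[coset K s]Ds -conjXg.
      by rewrite -morphX ?(subsetP nKQ) //= -ot expg_order !morph1 conj1g.
    by apply: contraNneq ntt => s1; rewrite -(conjg_eq1 _ a) Ds s1 morph1.
  have Lt : coset K t \in L by apply: (subsetP (normal_sub nFL)).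
  have [a1|t1] := unmixed_commute uL La Lt cat pi_a (mem_p_elt p'F Ft).
    by rewrite a1 eqxx in nta.
  by rewrite t1 eqxx in ntt.
split; last by rewrite -oQF.
rewrite -(isog_cyclic isoQ); apply: nil_Zgroup_cyclic; last by rewrite (isog_nil isoQ) Fitting_nil.
apply/forall_inP=> S /SylowP[p pr_p sylS]; have [sSQ pS _] := and3P sylS.
apply: (odd_pgroup_cyclic abV ntV nVQ regQ sSQ pS).
by apply: dvdn_odd (cardSg sSQ) oddQ.
Qed.

(** Such a g is not a pi-element, hence is a pi'-element. *)
Lemma Fitting_elt_regular g : g \in G -> coset K g \in 'F(L) -> coset K g != 1 -> 'C_V[g] = 1.
Proof.
move=> Gg Fg nt_g; apply: pi'_elt_regular => //; last first.
  by apply: contraNneq nt_g => ->; rewrite morph1.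
case/orP: (uG Gg) => // pi_g; case/negP: nt_g.
have pi_Kg : pi.-elt (coset K g) by apply: (pnat_dvd _ pi_g); apply: morph_order; apply: nKx.
by rewrite -order_eq1; apply/eqP; apply: (pnat_1 pi_Kg (mem_p_elt p'F Fg)).
Qed.

Lemma act_coset g h v : g \in G -> h \in G -> v \in V -> coset K g = coset K h -> v ^ g = v ^ h.
Proof.
move=> Gg Gh Vv /rcoset_kercosetP -/(_ (nKx Gg) (nKx Gh)) /rcosetP[k Kk ->].
have cvk : commute v k by apply: commute_sym; apply: (centP (subsetP cVK k Kk)).
by have /commgP/conjg_fixP vk := cvk; rewrite conjgM vk.
Qed.

Let repL u : u \in L -> exists2 g, g \in G & coset K g = u.
Proof. by case/morphimP=> g _ Gg ->; exists g. Qed.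

Let lift (u : coset_of K) : gT := odflt 1 [pick g in G | coset K g == u].

Let liftP u : u \in L -> lift u \in G /\ coset K (lift u) = u.
Proof.
move=> /repL[g Gg Dg]; rewrite /lift; case: pickP => [h /andP[Gh /eqP Dh] | /(_ g)] //.
by rewrite Gg Dg eqxx.
Qed.

(** Cover V^# by eigenspaces of lifts of the elements u of S. As u and u ^ w differ by
    a nontrivial element of F, which has no fixed points on V, the eigenspaces of u and
    of u ^ w meet trivially. *)
Lemma eigenvalue_count (S : {set coset_of K}) (c : nat) :
    (forall u, u \in S -> u \in L) ->
    (forall u, u \in S -> exists2 w, w \in L & (u * (u ^ w)^-1 \in 'F(L)) /\ (u ^ w != u)) ->
    (forall v, v \in V^# -> exists2 g, coset K g \in S & g \in G /\ v ^ g = v ^+ c) ->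
  exists e, [/\ 1 < e, q %| e, e ^ 2 <= #|V| & #|V| <= 1 + #|S| * e.-1]%N.
Proof.
move=> sSL ncS cov; have cVV := abelem_abelian abV.
have [u Su | v V1v | e [e1 eV e2 Ve]] :=
    cover_card_bound (S := S) (E := fun u => eigenspace_group (lift u) c cVV) ntV.
- have [w Lw [Fu nu]] := ncS u Su.
  have [Gu Du] := liftP (sSL u Su); have [Gw Dw] := liftP Lw.
  apply: (@eigenspace_card _ _ _ _ _ (lift w)).
    exact: (subsetP (normal_norm nVG)).
  have Dc : coset K (lift u * (lift u ^ lift w)^-1) = u * (u ^ w)^-1.
    by rewrite morphM ?nKx ?groupV ?groupJ // morphV ?nKx ?groupJ //= morphJ ?nKx //= Du Dw.
  apply: Fitting_elt_regular; rewrite ?groupM ?groupV ?groupJ ?Dc //.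
  by rewrite -eq_mulgV1 eq_sym.
- have [g Sg [Gg vg]] := cov v V1v; exists (coset K g) => //.
  have [Gu Du] := liftP (sSL _ Sg); have [_ Vv] := setD1P V1v.
  by rewrite inE Vv (act_coset Gu Gg Vv Du) vg eqxx.
exists e; split=> //; have [l De] := p_natP (pnat_dvd eV (abelem_pgroup abV)).
by move: e1; rewrite De; case: l {De} => // l _; rewrite expnS dvdn_mulr.
Qed.

Let cycF : cyclic 'F(L). Proof. by case: Fitting_quotient_odd_cyclic. Qed.
Let oddF : odd #|'F(L)|. Proof. by case: Fitting_quotient_odd_cyclic. Qed.

Lemma card_V_mod : #|V| = 1 %[mod #|'F(L)|].
Proof.
have [Q [sQG p'Q tiQK DQ]] := Fitting_lift.
have nVQ : Q \subset 'N(V) := subset_trans sQG (normal_norm nVG).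
have nKQ : Q \subset 'N(K) := subset_trans sQG (normal_norm nKG).
have isoQ : Q \isog F by rewrite -DQ; apply: quotient_isog; rewrite // setIC.
have := regular_norm_dvd_pred nVQ (pi'_group_semiregular sQG p'Q).
rewrite (card_isog isoQ) -subn1 => dv; apply/eqP.
by rewrite eqn_mod_dvd // cardG_gt0.
Qed.

(** For q >= 5 some element of L acts on a given vector with order (q - 1) / 2, so that
    (q - 1) / 2 divides r or d. The first case is excluded with S = F^#; in the second
    there remain, besides (r, q) = (3, 5), four cases with d = 6, excluded with the
    elements whose image in L / F has a prime order s, except when the order of V is
    small, and then that order is not 1 modulo r. *)
Theorem non_Frobenius_orders : exists r d,
  [/\ r \in pi^', pi.-nat d, #|L| = (r * d)%N,
      (r, d) \in [:: (3, 2); (5, 2); (5, 4); (7, 3); (7, 6); (13, 6)]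
    & (5 <= q -> (r, q) = (3, 5))].
Proof.
have [cycA pr_r rd] := upper_Frobenius_orders solL qL uL OL1 npi'L cycF oddF.
exists #|'F(L)|, #|L / 'F(L)|; set r := #|'F(L)| in pr_r rd *.
have pi'r : r \in pi^' by have := p'F; rewrite /pgroup -/r pnatE.
have oL : #|L| = (r * #|L / 'F(L)|)%N.
  by rewrite -(Lagrange (normal_sub nFL)) [#|L / 'F(L)|]card_quotient ?normal_norm.
have pid : pi.-nat #|L / 'F(L)|.
  exact: (quotient_Fitting_pi solL uL OL1 npi'L cycF).
split=> // q_ge5; set d := #|L / 'F(L)| in rd oL *.
have neq_qr : q != r by apply: contraTneq pi'r => <-; rewrite inE /= negbK chief_factor_prime_pi.
have odd_q : odd q by case: (even_prime pr_q) q_ge5 => // ->.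
have [k co_k kP] := prime_primitive_root pr_q; pose c := (k ^ 2)%N.
have Dq : (q = ((q.-1)./2).*2.+1)%N.
  by rewrite -[LHS](odd_double_half q) odd_q add1n /= -[in RHS](odd_double_half q) odd_q /= doubleK.
have expV v : v \in V^# -> #[v] = q.
  by case/setD1P=> ntv Vv; apply: abelem_order_p abV Vv ntv.
have cP v j : v \in V^# -> (v ^+ (c ^ j) == v) = ((q.-1)./2 %| j).
  move=> V1v; rewrite -[X in _ == X]expg1 eq_expg_mod_order expV // -expnM kP.
  by rewrite {1}Dq /= -mul2n dvdn_pmul2l.
have fus v : v \in V^# -> exists g, [/\ g \in G, forall j, v ^ (g ^+ j) = v ^+ (c ^ j)
    & forall j, (coset K g) ^+ j = 1 -> (q.-1)./2 %| j].
  move=> V1v; have [_ Vv] := setD1P V1v; have co_kv : coprime k #[v] by rewrite expV.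
  have /imsetP[g Gg vg] := square_power_class qG (subsetP sVG v Vv) co_kv.
  have vgj j : v ^ (g ^+ j) = v ^+ (c ^ j).
    elim: j => [|j IHj]; first by rewrite conjg1.
    by rewrite expgSr conjgM IHj conjXg -vg -expgM -expnS.
  exists g; split=> // j gj; rewrite -(cP v j V1v) -vgj.
  rewrite (@act_coset (g ^+ j) 1) ?group1 ?groupX ?conjg1 //.
  by rewrite morphX ?nKx // gj morph1.
have eltL u : u \in L -> u ^+ r = 1 \/ u ^+ d = 1 /\ pi.-elt u.
  move=> Lu; case/orP: (uL Lu) => [pi_u | p'u]; last first.
    left; apply/eqP; rewrite -order_dvdn; apply: order_dvdG.
    by apply: (@mem_Fitting _ pi L).
  right; split=> //; have Fud : u ^+ d \in 'F(L).
    apply: coset_idr; first by rewrite groupX // (subsetP (normal_norm nFL)).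
    rewrite morphX ?(subsetP (normal_norm nFL)) //; apply/eqP; rewrite -order_dvdn.
    by apply: order_dvdG; apply: mem_quotient.
  apply/eqP; rewrite -order_eq1; apply/eqP.
  by apply: (pnat_1 (_ : pi.-elt (u ^+ d)) (mem_p_elt p'F Fud)); apply: p_eltX.
have [v0 V1v0] : exists v, v \in V^#.
  by apply/set0Pn; rewrite -subset0 subDset setU0 subG1.
have d_lt_r : 0 < d < r by move: rd; rewrite !inE !xpair_eqE; clear; lia.
have o_gt1 : 1 < (q.-1)./2 by move: (q) q_ge5; clear; lia.
have nFLx u : u \in L -> u \in 'N(F) by apply: (subsetP (normal_norm nFL)).
have commF u y : u \in L -> y \in F -> y != 1 -> commute u y -> u \in F.
  exact: (Fitting_commute solL uL OL1 npi'L cycF).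
(* otherwise (q - 1) / 2 = r and F^# supplies all eigenvectors *)
have o_dvd_d : (q.-1)./2 %| d.
  apply: contraT => not_od.
  have eltS v : v \in V^# -> exists2 g, coset K g \in F^# & g \in G /\ v ^ g = v ^+ c.
    move=> V1v; have [g [Gg vg og]] := fus v V1v; exists g; last first.
      by split=> //; have := vg 1%N; rewrite expg1 expn1.
    have Lg : coset K g \in L by apply: mem_quotient.
    case: (eltL _ Lg) => [ur | [ud _]]; last by rewrite (og d ud) in not_od.
    rewrite inE; apply/andP; split.
      rewrite inE; apply: contraL o_gt1 => /eqP u1.
      by rewrite -leqNgt dvdn_leq // og // expg1.
    apply: (@mem_Fitting _ pi L) => //.
    by apply: (pnat_dvd (n := r)); rewrite ?order_dvdn ?ur // pnatE.
  have o_r : (q.-1)./2 = r.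
    have [g [Gg vg og]] := fus v0 V1v0; have Lg : coset K g \in L by apply: mem_quotient.
    case: (eltL _ Lg) => [ur | [ud _]]; last by rewrite (og d ud) in not_od.
    by apply/(prime_nt_dvdP pr_r); rewrite ?gtn_eqF ?og.
  have [||e [e1 qe e2 Ve]] := @eigenvalue_count F^# c _ _ eltS.
  - by move=> u /setD1P[_ Fu]; apply: (subsetP (normal_sub nFL)).
  - move=> u /setD1P[ntu Fu]; have [a [La pi_a nta]] := pi_elt_exists.
    exists a => //; split.
      by rewrite groupM // groupV memJ_norm // nFLx.
    apply/negP=> /eqP/conjg_fixP/commgP/commute_sym cau.
    have Lu := subsetP (normal_sub nFL) u Fu.
    have [a1|u1] := unmixed_commute uL La Lu cau pi_a (mem_p_elt p'F Fu).
      by rewrite a1 eqxx in nta.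
    by rewrite u1 eqxx in ntu.
  have F1 : #|F^#| = r.-1 by have := cardsD1 1 F; rewrite group1 -/r => ->.
  have := dvdn_leq (ltnW e1) qe; have := leq_trans e2 Ve; rewrite F1 Dq o_r -mulnn.
  by move: (r) (prime_gt0 pr_r) e1; clear => r r_gt0 e1; nia.
pose cases := [:: (3, 2, 5); (7, 6, 5); (7, 6, 13); (13, 6, 5); (13, 6, 7)].
have rdq : ((r, d, q) \in cases).
{ move: Dq o_dvd_d rd neq_qr pr_q o_gt1; rewrite /cases; move: ((q.-1)./2) => o Eq od.
  rewrite !inE !xpair_eqE Eq; clear -od.
  move: od; move: (r) (d) => r1 d1 od /orP[|/orP[|/orP[|/orP[|/orP[]]]]].
  all: case/andP=> /eqP -> /eqP Ed; move: od; rewrite Ed dvdn_divisors // !inE.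
  all: by do ?[case/orP]; move=> /eqP ->. }
have split_cases : (r, q) = (3, 5) \/
    d = 6 /\ exists s, [/\ prime s, s %| 6 &
      (r, s, q) \in [:: (7, 2, 5); (7, 2, 13); (13, 2, 5); (13, 3, 7)]].
  move: rdq; rewrite /cases !inE !xpair_eqE; clear.
  move: (r) (d) (q) => r1 d1 q1 /orP[|/orP[|/orP[|/orP[]]]] /andP[/andP[/eqP -> /eqP ->] /eqP ->];
    [by left | right; split=> // ..].
  - by exists 2.
  - by exists 2.
  - by exists 2.
  - by exists 3.
have [-> // | [d6 [s [pr_s s6 rsq]]]] := split_cases.
(* the elements whose image in L / F, cyclic of order 6, has order s *)
pose A := (L / F)%G; have cycA6 : cyclic A by [].
have oA : #|A| = 6 by [].
pose T := [set a in A | #[a] == s]; pose S := [set u in L | coset F u \in T].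
have cardT : #|T| <= s.-1.
  have [-> | [a0]] := set_0Vmem T; first by rewrite cards0.
  rewrite inE => /andP[Aa0 /eqP oa0].
  apply: (@leq_trans (totient #[a0])); last by rewrite oa0 totient_prime.
  rewrite totient_gen; apply: subset_leq_card; apply/subsetP=> a.
  rewrite !inE => /andP[Aa /eqP oa]; rewrite /generator.
  by rewrite (eq_subG_cyclic cycA6) ?cycle_subG // -!orderE oa oa0.
have cardS : #|S| <= r * s.-1.
  apply: (@leq_trans #|\bigcup_(a in T) (coset F @*^-1 [set a])|).
    apply: subset_leq_card; apply/subsetP=> u; rewrite inE => /andP[Lu Tu].
    apply/bigcupP; exists (coset F u) => //; apply/morphpreP.
    by split; [apply: nFLx | rewrite inE].
  apply: (@leq_trans (\sum_(a in T) r)); last first.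
    by rewrite sum_nat_const mulnC leq_mul2l cardT orbT.
  apply: (@leq_trans (\sum_(a in T) #|coset F @*^-1 [set a]|)).
    elim/big_rec2: _ => [|a n B _ leBn]; first by rewrite cards0.
    by rewrite (leq_trans (leq_card_setU _ _).1) // leq_add2l.
  by apply: leq_sum => a _; case: (cosetP a) => u Nu ->; rewrite cosetpre_set1 // card_rcoset.
have s_gt1 := prime_gt1 pr_s.
have s6d : (6 %/ s * s = 6)%N by rewrite divnK.
pose j := (6 %/ s)%N.
have o_nj : ~~ ((q.-1)./2 %| j).
  move: rsq; rewrite /j !inE !xpair_eqE; clear.
  by case/or4P=> /andP[/andP[_ /eqP->] /eqP->].
have o_nr : ~~ ((q.-1)./2 %| r).
  move: rsq; rewrite !inE !xpair_eqE; clear.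
  by case/or4P=> /andP[/andP[/eqP -> _] /eqP->].
have sSL u : u \in S -> u \in L by rewrite inE => /andP[].
have [x Fx ox] := Cauchy pr_r (dvdnn r).
have Lx := subsetP (normal_sub nFL) x Fx.
have ntx : x != 1 by rewrite -order_gt1 ox prime_gt1.
have [|v V1v|e [e1 qe e2 Ve]] := @eigenvalue_count S (c ^ j)%N sSL.
- move=> u Su; have Lu := sSL u Su; exists x => //; split.
    apply: coset_idr; first by rewrite nFLx // groupM ?groupV ?groupJ.
    rewrite morphM ?morphV ?morphJ ?nFLx ?groupV ?groupJ //=.
    by rewrite (coset_id Fx) conjg1 mulgV.
  apply/negP=> /eqP/conjg_fixP/commgP cux; have Fu := commF u x Lu Fx ntx cux.
  move: Su; rewrite !inE (coset_id Fu) order1 => /and3P[_ _ /eqP s1].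
  by rewrite -s1 in s_gt1.
- have [g [Gg vg og]] := fus v V1v; have Lg : coset K g \in L by apply: mem_quotient.
  case: (eltL _ Lg) => [ur | [ud pi_u]]; first by rewrite (og r ur) in o_nr.
  exists (g ^+ j); last by rewrite groupX.
  rewrite morphX ?nKx //= inE groupX //= inE.
  rewrite mem_quotient ?groupX //=; apply/eqP.
  have Nu : coset K g ^+ j \in 'N(F) by rewrite nFLx ?groupX.
  apply: nt_prime_order => //.
    by rewrite -morphX // -expgM /j s6d -d6 ud morph1.
  apply: contraNneq o_nj => Fuj; apply: og.
  have {}Fuj : coset K g ^+ j \in F by apply: coset_idr.
  apply/eqP; rewrite -order_eq1; apply/eqP.
  by apply: (pnat_1 _ (mem_p_elt p'F Fuj)); apply: p_eltX.
have {}Ve : #|V| <= 1 + r * s.-1 * e.-1.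
  by apply: leq_trans Ve _; rewrite leq_add2l leq_mul2r cardS orbT.
have Vr := card_V_mod; have [l Vl] := p_natP (abelem_pgroup abV).
have e_ge := dvdn_leq (ltnW e1) qe; have le_e := leq_trans e2 Ve.
have big : [\/ (r, s, q, l) = (7, 2, 5, 2), (r, s, q, l) = (13, 2, 5, 2),
    (r, s, q, l) = (13, 2, 5, 3) | (r, s, q, l) = (13, 3, 7, 2) \/ (r, s, q, l) = (13, 3, 7, 3)].
  have e_lt : e < r * s.-1.
    have N_gt1 : 1 < r * s.-1 by move: rsq; rewrite !inE !xpair_eqE; clear; lia.
    by move: le_e e1 N_gt1; rewrite -mulnn; move: (r * s.-1)%N; clear; nia.
  have Vb : q ^ l <= 1 + r * s.-1 * (r * s.-1 - 2).
    by rewrite -Vl; apply: leq_trans Ve _; rewrite leq_add2l leq_mul2l; move: e_lt; clear; lia.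
  have Vge : q * q <= q ^ l.
    by rewrite -Vl (leq_trans _ e2) // mulnn leq_exp2r.
  have l_le3 N : (q ^ l <= N)%N -> (N < q ^ 4)%N -> l < 4.
    move=> qN Nq; rewrite ltnNge; apply/negP=> l4.
    by have := leq_ltn_trans qN Nq; rewrite ltnNge leq_exp2l ?l4 // (leq_trans _ q_ge5).
  have l_ge2 : 1 < l.
    by rewrite -(leq_exp2l _ _ (leq_trans (isT : 1 < 5) q_ge5)) -mulnn.
  move: rsq Vb l_le3; rewrite !inE !xpair_eqE.
  case/or4P=> /andP[/andP[/eqP -> /eqP ->] /eqP ->] Vb /(_ _ Vb)/(_ isT) l_lt4;
    move: Vb; move: l_ge2 l_lt4; clear; case: l => [|[|[|[|l]]]] // _ _ Vb.
  - by constructor 1.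
  - by constructor 2.
  - by constructor 3.
  - by constructor 4; left.
  - by constructor 4; right.
have contra_mod rr ss qq ll : (r, s, q, l) = (rr, ss, qq, ll) ->
    (qq ^ ll != 1 %[mod rr]) -> (r, q) = (3, 5).
  case=> Er Es Eq El; move: Vr; rewrite Vl -/r Er Eq El => ->; by rewrite eqxx.
by case: big => [|||[|]] /contra_mod -> .
Qed.

End NonFrobenius.

End CentralizedChiefFactor.

(** * Chief factors *)

(** A Sylow s-subgroup U of K = O_pi(G), s <> q, can be chosen invariant under a
    subgroup R of prime order outside pi; as U R is a Frobenius group acting
    without R-fixed points on V, U centralizes V. So K acts on V as a q-group,
    which has fixed points; they form a normal subgroup of G. *)
Lemma minnormal_cent (gT : finGroupType) (pi : nat_pred) q (G V : {group gT}) :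
    solvable G -> unmixed pi G -> ~~ pi.-group G -> prime q -> q.-group V ->
    minnormal V G -> V \subset 'O_pi(G) ->
  'O_pi(G) \subset 'C(V).
Proof.
move=> solG uG npiG pr_q qV minV; set K := 'O_pi(G)%G => sVK.
have nKG : K <| G := pcore_normal _ _; have piK : pi.-group K := pcore_pgroup _ _.
have [/andP[ntV nVG] minV1] := mingroupP minV.
have sKG := normal_sub nKG; have solK := solvableS sKG solG.
have piV := pgroupS sVK piK; have nVK := subset_trans sKG nVG.
have abV : abelian V.
  by have [_ _ /is_abelemP[p _ /abelem_abelian]] := minnormal_solvable minV sVK solK.
have [r [pr_r pi'r r_G]] : exists r, [/\ prime r, r \in pi^' & r %| #|G|].
  move: npiG; rewrite /pgroup /pnat cardG_gt0 /= => /allPn[r].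
  by rewrite mem_primes => /and3P[pr_r _ r_G] pi'r; exists r.
have [y Gy oy] := Cauchy pr_r r_G; pose R := <[y]>%G.
have sRG : R \subset G by rewrite cycle_subG.
have nty : y != 1 by rewrite -order_gt1 oy prime_gt1.
have p'y : pi^'.-elt y by rewrite /p_elt oy pnatE.
have oR : #|R| = r by rewrite -oy.
have cent1 (U : {group gT}) : U \subset K -> 'C_U(R) = 1.
  move=> sUK; apply/trivgP/subsetP=> u /setIP[Uu]; rewrite /= cent_cycle => /cent1P cyu.
  have Ku := subsetP sUK u Uu; have Gu := subsetP sKG u Ku.
  have [-> | y1] := unmixed_commute uG Gu Gy cyu (mem_p_elt piK Ku) p'y.
    by rewrite inE.
  by rewrite y1 eqxx in nty.
have sylC s : prime s -> s != q -> exists2 U : {group gT}, s.-Sylow(K) U & U \subset 'C(V).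
  move=> pr_s neq_sq.
  have coKR : coprime #|K| #|R| by rewrite oR (pnat_coprime piK) // pnatE.
  have nKR : R \subset 'N(K) := subset_trans sRG (normal_norm nKG).
  have [U sylU nUR] := sol_coprime_Sylow_exists s (abelian_sol (cycle_abelian y)) nKR coKR.
  have [sUK sU _] := and3P sylU; exists U => //.
  apply: (@Frobenius_kernel_cent _ V U R) => //.
  - by apply: (pnat_coprime qV); apply: pi_pnat sU _; rewrite inE /= inE.
  - exact: subset_trans sUK nVK.
  - exact: subset_trans sRG nVG.
  - by rewrite oR.
  - exact: cent1.
  - exact: cent1.
have [S sylS] := Sylow_exists q K; have [sSK qS _] := and3P sylS.
have sVS : V \subset S.
  apply: subset_trans (pcore_sub_Hall sylS); apply: pcore_max qV _.
  by rewrite /normal sVK.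
have ntVZ : V :&: 'Z(S) != 1.
  apply: meet_center_nil ntV; first exact: pgroup_nil qS.
  by rewrite /normal sVS (subset_trans sSK nVK).
pose W := (V :&: 'C(K))%G.
have ntW : W :!=: 1.
  apply: contraNneq ntVZ => W1; rewrite -subG1 -W1 subsetI subsetIl /=.
  apply/subsetP=> x /setIP[Vx /setIP[Sx cSx]]; rewrite -sub_cent1.
  have sylCx p : prime p -> exists2 U : {group gT}, p.-Sylow(K) U & U \subset 'C_K[x].
    move=> pr_p; have [-> | neq_pq] := eqVneq p q.
      by exists S => //; rewrite subsetI sSK sub_cent1.
    have [U sylU cUV] := sylC p pr_p neq_pq; exists U => //.
    by rewrite subsetI (pHall_sub sylU) sub_cent1 (subsetP _ x Vx) // centsC.
  suffices : #|K : 'C_K[x]| == 1%N by rewrite indexg_eq1 subsetI => /andP[].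
  apply: contraT => i1; have i_gt1 : 1 < #|K : 'C_K[x]|.
    by case: #|_ : _| (indexg_gt0 K 'C_K[x]) i1 => [|[|]].
  have pr_p := pdiv_prime i_gt1; have [U sylU sUC] := sylCx _ pr_p.
  have := dvdn_trans (pdiv_dvd _) (indexgS K sUC).
  by have [_ _] := and3P sylU; rewrite p'natE // => /negP.
have nWG : G \subset 'N(W) by rewrite normsI // norms_cent // normal_norm.
have <- : W = V by apply: val_inj; apply: minV1; rewrite ?subsetIl // ntW.
by rewrite centsC subsetIr.
Qed.

(** Take N maximal among the normal subgroups of G below O_pi(G) that avoid b,
    and a minimal normal subgroup above it. *)
Lemma chief_factor_exists (gT : finGroupType) (pi : nat_pred) q (G : {group gT}) b :
    solvable G -> unmixed pi G -> ~~ pi.-group G -> prime q ->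
    b \in 'O_pi(G) -> #[b] = q ->
  exists (N : {group gT}) (V : {group coset_of N}),
    [/\ N <| G, N \subset 'O_pi(G), b \in 'N(N), coset N b \in V & coset N b != 1] /\
    [/\ q.-abelem V, V :!=: 1, V <| G / N, V \subset 'O_pi(G / N)
       & 'O_pi(G / N) \subset 'C(V)].
Proof.
move=> solG uG npiG pr_q Kb ob; set K := 'O_pi(G)%G in Kb *.
have nKG : K <| G := pcore_normal _ _; have piK : pi.-group K := pcore_pgroup _ _.
pose P (N : {group gT}) := [&& N <| G, N \subset K & b \notin N].
have P1 : P 1%G.
  by rewrite /P normal1 sub1G inE -order_eq1 ob gtn_eqF ?prime_gt1.
have [N /maxgroupP[/and3P[nNG sNK nNb] maxN] _] := maxgroup_exists (gP := P) P1.
have Gb := subsetP (normal_sub nKG) b Kb.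
have Nb : b \in 'N(N) := subsetP (normal_norm nNG) b Gb.
have ntb : coset N b != 1 by apply: contra nNb => /eqP/(coset_idr Nb).
have Kbb : coset N b \in K / N by apply: mem_quotient.
have ntKN : (K / N)%G :!=: 1 by apply/trivgPn; exists (coset N b).
have nKN : G / N \subset 'N(K / N) by rewrite quotient_norms ?normal_norm.
have [V minV sVK] := minnormal_exists ntKN nKN.
have [/andP[ntV nVG] _] := mingroupP minV.
have solGN : solvable (G / N) := quotient_sol _ solG.
have DK : 'O_pi(G / N) = K / N by apply: pquotient_pcore => //; apply: pgroupS sNK piK.
have sVG : V \subset G / N by apply: subset_trans sVK _; rewrite quotientS ?normal_sub.
have [_ _ /is_abelemP[p pr_p abV]] := minnormal_solvable minV sVG solGN.
have nVGn : V <| G / N by rewrite /normal sVG.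
have Vb : coset N b \in V.
  apply: contraT => nVb; have [M DM sNM nMG] := inv_quotientN nNG nVGn.
  have sMK : M \subset K.
    rewrite -(quotientSGK _ sNK) -?DM //.
    by apply: subset_trans (normal_sub nMG) (normal_norm nNG).
  have PM : P M by rewrite /P nMG sMK; apply: contra nVb => Mb; rewrite DM mem_quotient.
  have EM := maxN M PM sNM; case/negP: ntV; rewrite DM EM.
  by rewrite trivg_quotient.
have Dpq : p = q.
  have := abelem_order_p abV Vb ntb; have : #[coset N b] %| q by rewrite -ob morph_order.
  by move=> + op; rewrite op dvdn_prime2 // => /eqP.
rewrite Dpq in abV.
exists N, V; split; split=> //; first by rewrite DK.
apply: (minnormal_cent (q := q)) => //.
- exact: unmixed_quotient.
- apply: contra npiG => piGN; rewrite /pgroup -(Lagrange (normal_sub nNG)) pnatM.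
  apply/andP; split; first exact: pgroupS sNK piK.
  by rewrite -card_quotient ?normal_norm.
- exact: abelem_pgroup abV.
- by rewrite DK.
Qed.

(** In the chief factor where b is nontrivial, g acts trivially; the exponent c is
    therefore 1 modulo q. *)
Lemma pcore_normalizes_trivially (gT : finGroupType) (pi : nat_pred) q (G : {group gT}) b g c :
    solvable G -> unmixed pi G -> ~~ pi.-group G -> prime q ->
    b \in 'O_pi(G) -> #[b] = q -> g \in 'O_pi(G) -> b ^ g = b ^+ c -> b ^ g = b.
Proof.
move=> solG uG npiG pr_q Kb ob Kg bg.
have [N [V [[nNG sNK Nb Vb ntb] [abV ntV nVG sVK cVK]]]] :=
  chief_factor_exists solG uG npiG pr_q Kb ob.
have Ng : g \in 'N(N).
  by rewrite (subsetP (normal_norm nNG)) // (subsetP (pcore_sub pi G)).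
have Kgb : coset N g \in 'O_pi(G / N).
  rewrite pquotient_pcore //; first exact: mem_quotient.
  exact: pgroupS sNK (pcore_pgroup _ _).
have cgb : commute (coset N b) (coset N g).
  by apply: commute_sym; apply: (centP (subsetP cVK _ Kgb)).
have /commgP/conjg_fixP := cgb; rewrite -morphJ // bg morphX //= => /eqP.
rewrite -[X in _ == X]expg1 eq_expg_mod_order (abelem_order_p abV Vb ntb) => cq.
by apply/eqP; rewrite -[X in _ == X]expg1 eq_expg_mod_order ob cq.
Qed.

(** * Solvable groups with disconnected graph *)

Lemma GK_adjC (gT : finGroupType) (G : {group gT}) p q : GK_adj G p q = GK_adj G q p.
Proof. by rewrite /GK_adj eq_sym mulnC. Qed.

Lemma GK_edgesP (gT : finGroupType) (G : {group gT}) (e : {fset nat}) :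
  reflect (exists p q, [/\ p \in primes #|G|, q \in primes #|G|, GK_adj G p q
                         & e = [fset p; q]%fset])
          (e \in GK_edges G).
Proof.
apply: (iffP (imfsetP _ _ _ _)) => /=.
  case=> [[p q]] /=; rewrite inE /= => /andP[/allpairsP[[p' q'] /= [Gp Gq [-> ->]]] pq] ->.
  by exists p', q'.
case=> p [q [Gp Gq pq ->]]; exists (p, q) => //=; rewrite inE /= pq andbT.
by apply/allpairsP; exists (p, q).
Qed.

Lemma GK_pair_graph (gT : finGroupType) (G : {group gT}) a b (V : {fset nat}) :
    V =i [:: a; b] -> (forall p, (p \in primes #|G|) = (p \in [:: a; b])) ->
    ~~ GK_adj G a b ->
  (GK_vertices G, GK_edges G) = (V, fset0).
Proof.
move=> DV DG nab; congr (_, _); first by apply/fsetP=> p; rewrite DV -DG inE.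
apply/fsetP=> e; rewrite inE; apply/GK_edgesP=> -[p [q [Gp Gq pq _]]].
move: pq nab (pq); rewrite {1}/GK_adj; move: Gp Gq; rewrite !DG !inE.
by case/orP=> /eqP-> /orP[]/eqP->; rewrite ?eqxx // => _; [| rewrite GK_adjC] => /negP.
Qed.

Lemma GK_triple_graph (gT : finGroupType) (G : {group gT}) a b c (V : {fset nat}) :
    V =i [:: a; b; c] -> (forall p, (p \in primes #|G|) = (p \in [:: a; b; c])) ->
    GK_adj G a b -> ~~ GK_adj G a c -> ~~ GK_adj G b c ->
  (GK_vertices G, GK_edges G) = (V, [fset [fset a; b]])%fset.
Proof.
move=> DV DG ab nac nbc; congr (_, _); first by apply/fsetP=> p; rewrite DV -DG inE.
apply/fsetP=> e; rewrite inE; apply/GK_edgesP/eqP=> [[p [q [Gp Gq pq ->]]] | ->].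
  have npq : p != q by case/andP: pq.
  move: pq nac nbc npq; move: Gp Gq; rewrite !DG !inE.
  case/or3P=> /eqP-> /or3P[]/eqP->; rewrite ?eqxx //.
  - by move=> -> .
  - by move=> _ _ _ _; rewrite fsetUC.
  - by move=> -> .
  - by rewrite GK_adjC => -> .
  - by rewrite GK_adjC => -> .
by exists a, b; rewrite !DG !inE !eqxx ?orbT.
Qed.

Definition seven_graphs : seq ({fset nat} * {fset {fset nat}}) :=
  [:: ([fset 2; 3], fset0);
      ([fset 2; 5], fset0);
      ([fset 3; 7], fset0);
      ([fset 2; 3; 5], [fset [fset 2; 5]]);
      ([fset 2; 3; 5], [fset [fset 2; 3]]);
      ([fset 2; 3; 7], [fset [fset 2; 3]]);
      ([fset 2; 3; 13], [fset [fset 2; 3]])]%fset.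

Lemma GK_adj_quotient (gT : finGroupType) (G N : {group gT}) p q :
  0 < p -> 0 < q -> GK_adj (G / N) p q -> GK_adj G p q.
Proof.
move=> p_gt0 q_gt0 /andP[npq /existsP[_ /andP[/morphimP[x Nx Gx ->] /eqP ox]]].
have pq_x : p * q %| #[x] by rewrite -ox morph_order.
rewrite /GK_adj npq; apply/existsP; exists (x ^+ (#[x] %/ (p * q))).
by rewrite groupX //= orderXdiv ?dvdn_div // divnA // mulKn ?order_gt0 ?eqxx.
Qed.

Lemma dvdn_pcore_quotient (gT : finGroupType) (pi : nat_pred) (G : {group gT}) p :
  prime p -> (p %| #|G|) = (p %| #|'O_pi(G)|) || (p %| #|G / 'O_pi(G)|).
Proof.
move=> pr_p; rewrite card_quotient ?normal_norm ?pcore_normal //.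
by rewrite -Euclid_dvdM // Lagrange ?pcore_sub.
Qed.

Section ComponentCases.

Variables (gT : finGroupType) (pi : nat_pred) (G : {group gT}).
Let K := 'O_pi(G)%G.
Hypotheses (solG : solvable G) (qG : quadratic_characters G) (uG : unmixed pi G).
Hypotheses (npiG : ~~ pi.-group G) (ntK : K :!=: 1).
Hypothesis nbr : forall q q', q \in primes #|G| -> q' \in primes #|G| -> q \in pi -> q' \in pi ->
  q != q' -> exists2 a, a \in primes #|G| & (a \in pi) && GK_adj G q a.

Let nKG : K <| G. Proof. exact: pcore_normal. Qed.
Let piK : pi.-group K. Proof. exact: pcore_pgroup. Qed.

Let dvdG p : prime p -> (p %| #|G|) = (p %| #|K|) || (p %| #|G / K|).
Proof. exact: dvdn_pcore_quotient. Qed.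

Lemma unmixed_nonadjacent p q : prime p -> prime q -> p \in pi -> q \in pi^' -> ~~ GK_adj G p q.
Proof.
move=> pr_p pr_q pi_p pi'q; apply/negP=> /andP[_ /existsP[x /andP[Gx /eqP ox]]].
case/orP: (uG Gx); rewrite /p_elt ox pnatM !pnatE // => /andP[].
  by move=> _ pi_q; rewrite inE /= pi_q in pi'q.
by rewrite inE /= pi_p.
Qed.

Lemma adjacent_elements p q : prime p -> prime q -> GK_adj G p q ->
  exists a b, [/\ a \in G, b \in G, commute a b, #[a] = p & #[b] = q].
Proof.
move=> pr_p pr_q /andP[_ /existsP[x /andP[Gx /eqP ox]]].
exists (x ^+ q), (x ^+ p); split; rewrite ?groupX //.
- exact: commuteX2.
- by rewrite orderXdiv ox ?dvdn_mull // mulnK ?prime_gt0.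
- by rewrite orderXdiv ox ?dvdn_mulr // mulKn ?prime_gt0.
Qed.

Let quotient_data q : prime q -> q %| #|K| ->
  exists (N : {group gT}) (V : {group coset_of N}),
    [/\ N <| G, G / K \isog (G / N) / 'O_pi(G / N)
      & [/\ q.-abelem V, V :!=: 1, V <| G / N, V \subset 'O_pi(G / N)
       & 'O_pi(G / N) \subset 'C(V)]].
Proof.
move=> pr_q /(Cauchy pr_q)[b Kb ob].
have [N [V [[nNG sNK _ _ _] chV]]] := chief_factor_exists solG uG npiG pr_q Kb ob.
exists N, V; split=> //; rewrite pquotient_pcore //; last exact: pgroupS sNK piK.
by rewrite isog_sym; apply: third_isog.
Qed.

Let prK q : prime q -> q %| #|K| -> q \in pi.
Proof. by move=> pr_q; apply: (pgroupP piK). Qed.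

(** Here pi^' contributes the single prime r, and the primes of pi are those of d and
    some of 2, 3, and 5 if r = 3; when there are two of them, they are joined. *)
Let non_Frobenius_case : ~~ pi^'.-group (G / K) ->
  (GK_vertices G, GK_edges G) \in seven_graphs.
Proof.
move=> npi'L.
have cases q : prime q -> q %| #|K| -> exists r d,
  [/\ r \in pi^', pi.-nat d, #|G / K| = (r * d)%N,
      (r, d) \in [:: (3, 2); (5, 2); (5, 4); (7, 3); (7, 6); (13, 6)]
    & (5 <= q -> (r, q) = (3, 5))].
  move=> pr_q qK; have [N [V [nNG isoL [abV ntV nVG sVK cVK]]]] := quotient_data pr_q qK.
  rewrite (card_isog isoL); apply: (non_Frobenius_orders (V := V)) => //.
  - exact: quotient_sol.
  - exact: quadratic_characters_quotient.
  - exact: unmixed_quotient.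
  - by rewrite /pgroup -(card_isog isoL).
have K_gt1 : 1 < #|K| by rewrite cardG_gt1.
have [r [d [pi'r pid oL rd _]]] := cases _ (pdiv_prime K_gt1) (pdiv_dvd _).
have Kcases q : prime q -> q %| #|K| -> (q \in pi) && ((q == 2) || (q == 3) || ((r == 3) && (q == 5))).
  move=> pr_q qK; rewrite prK //=.
  have [r1 [d1 [_ _ oL1 rd1 q5]]] := cases q pr_q qK.
  have Er : r1 = r.
    move: oL1; rewrite oL; move: rd rd1; rewrite !inE !xpair_eqE; clear.
    by do 5?[case/orP]; move=> /andP[/eqP-> /eqP->]; do 5?[case/orP]; move=> /andP[/eqP-> /eqP->].
  case: (ltnP q 5) => [|/q5[<- ->]]; last by rewrite Er !eqxx orbT.
  by case: q pr_q {qK q5} => [|[|[|[|[|]]]]].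
have pr_r : prime r by move: rd; rewrite !inE !xpair_eqE; clear; do 5?[case/orP]; move=> /andP[/eqP-> _].
have dG p : prime p -> p %| #|G| -> [|| p == r, (p \in pi) && (p %| d) | p %| #|K|].
  move=> pr_p; rewrite dvdG // oL Euclid_dvdM // => /or3P[-> | pr | pd]; rewrite ?orbT //.
    by rewrite -(dvdn_prime2 pr_p pr_r) pr.
  have d_gt0 : 0 < d by case/andP: pid.
  by rewrite pd (pnatP _ d_gt0 pid) ?orbT.
have rG : r \in primes #|G|.
  by rewrite mem_primes pr_r cardG_gt0 dvdG // oL dvdn_mulr ?orbT.
have dvd_dG p : prime p -> p %| d -> p \in primes #|G|.
  by move=> pr_p pd; rewrite mem_primes pr_p cardG_gt0 dvdG // oL dvdn_mull ?orbT.
have Gcases p : p \in primes #|G| ->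
   (p == r) || (p \in pi) && ((p == 2) || (p == 3) || ((r == 3) && (p == 5))).
  rewrite mem_primes => /and3P[pr_p _ pG].
  case/or3P: (dG p pr_p pG) => [-> // | /andP[pi_p pd] | pK]; last first.
    by rewrite (Kcases p pr_p pK) orbT.
  rewrite pi_p /=; move: rd pd pr_p; rewrite !inE !xpair_eqE; clear.
  by do 5?[case/orP]; move=> /andP[/eqP-> /eqP->]; rewrite dvdn_divisors // !inE; do 3?[case/orP]; move=> /eqP->.
have piG p : p \in primes #|G| -> p != r -> p \in pi.
  by move/Gcases=> /orP[/eqP-> | /andP[-> _]]; rewrite ?eqxx.
have adjpi a b : a \in primes #|G| -> b \in primes #|G| -> a != b -> a != r -> b != r ->
    (forall p, p \in primes #|G| -> p \in [:: r; a; b]) -> GK_adj G a b.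
  move=> Ga Gb nab nar ner allG.
  have [c Gc /andP[pi_c adj]] := nbr Ga Gb (piG a Ga nar) (piG b Gb ner) nab.
  have := allG c Gc; rewrite !inE => /or3P[]/eqP E.
  - by rewrite inE /= -E pi_c in pi'r.
  - by case/andP: adj; rewrite E eqxx.
  - by rewrite -E.
have nadj a : a \in primes #|G| -> a != r -> ~~ GK_adj G a r.
  move=> Ga nar; apply: unmixed_nonadjacent => //; last exact: piG.
  by move: Ga; rewrite mem_primes => /andP[].
have pair a : a \in primes #|G| -> a != r -> (forall p, p \in primes #|G| -> p \in [:: r; a]) ->
    forall V, V =i [:: a; r] -> (GK_vertices G, GK_edges G) = (V, fset0).
  move=> Ga nar allG V DV; apply: GK_pair_graph DV _ (nadj a Ga nar) => p.
  by apply/idP/idP=> [/allG|]; rewrite !inE orbC // => /orP[]/eqP->.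
have triple a b : a \in primes #|G| -> b \in primes #|G| -> a != b -> a != r -> b != r ->
    (forall p, p \in primes #|G| -> p \in [:: r; a; b]) ->
    forall V, V =i [:: a; b; r] -> (GK_vertices G, GK_edges G) = (V, [fset [fset a; b]])%fset.
  move=> Ga Gb nab nar ner allG V DV.
  apply: GK_triple_graph DV _ (adjpi a b Ga Gb nab nar ner allG) (nadj a Ga nar) (nadj b Gb ner).
  move=> p; apply/idP/idP=> [/allG|]; rewrite !inE; first by do 2?[case/orP]; move=> ->; rewrite ?orbT.
  by do 2?[case/orP]; move=> /eqP->.
have two : 2 %| d -> 2 \in primes #|G| := dvd_dG 2 isT.
have three : 3 %| d -> 3 \in primes #|G| := dvd_dG 3 isT.
clear cases Kcases dG dvd_dG.
have seven VE b : VE = nth VE seven_graphs b -> b < 7 -> VE \in seven_graphs.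
  by move=> -> lt_b; apply: mem_nth.
rewrite !inE !xpair_eqE in rd.
have G23 : r = 5 \/ r = 7 \/ r = 13 -> 2 \in primes #|G| -> 3 \in primes #|G| ->
    (GK_vertices G, GK_edges G) = ([fset 2; 3; r], [fset [fset 2; 3]])%fset.
  move=> Er G2 G3; apply: triple => //; try by move: Er; clear; lia.
  - by move=> p /Gcases; rewrite !inE; move: Er; clear; lia.
  - by move=> p; rewrite !inE orbA.
have d2 : 2 %| d -> forall V, V =i [:: 2; r] ->
    (forall p, p \in primes #|G| -> (p == 2) || (p == r)) -> r != 2 ->
    (GK_vertices G, GK_edges G) = (V, fset0).
  move=> /two G2 V DV allG nr2; apply: (pair 2) => //; first by rewrite eq_sym.
  by move=> p /allG; rewrite !inE orbC.
have r5 : r = 5 -> 2 %| d -> (GK_vertices G, GK_edges G) \in seven_graphs.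
  move=> Er d2'; have G2 := two d2'; have [G3 | nG3] := boolP (3 \in primes #|G|).
    by apply: (seven _ 4) => //=; rewrite G23 ?Er //; left.
  apply: (seven _ 1%N) => //=; apply: (d2 _ _ _ _); rewrite ?Er //.
    by move=> p; rewrite !inE.
  move=> p Gp; have := Gcases p Gp; case: (eqVneq p 3) Gp => [-> | + _]; first by rewrite (negPf nG3).
  by rewrite Er; clear; lia.
move: rd; do 5?[case/orP]; move=> /andP[/eqP Er /eqP Ed].
- rewrite Ed in two; have G2 := two isT.
  have [G5 | nG5] := boolP (5 \in primes #|G|).
    apply: (seven _ 3) => //=; apply: triple; rewrite ?Er //.
      by move=> p /Gcases; rewrite Er !inE; clear; lia.
    by move=> p; rewrite !inE; clear; lia.
  apply: (seven _ 0) => //=; apply: (d2 _ _ _ _); rewrite ?Ed ?Er //.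
    by move=> p; rewrite !inE.
  move=> p Gp; have := Gcases p Gp; case: (eqVneq p 5) Gp => [-> | + _]; first by rewrite (negPf nG5).
  by rewrite Er; clear; lia.
- by apply: (r5 Er); rewrite Ed.
- by apply: (r5 Er); rewrite Ed.
- have G3 : 3 \in primes #|G| by apply: three; rewrite Ed.
  have [G2 | nG2] := boolP (2 \in primes #|G|).
    by apply: (seven _ 5) => //=; rewrite G23 ?Er //; right; left.
  apply: (seven _ 2) => //=; apply: (pair 3); rewrite ?Er //; last by move=> p; rewrite !inE.
  move=> p Gp; have := Gcases p Gp; case: (eqVneq p 2) Gp => [-> | + _]; first by rewrite (negPf nG2).
  by rewrite Er !inE; clear; lia.
- by apply: (seven _ 5) => //=; rewrite G23 ?Er ?two ?three ?Ed //; right; left.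
- by apply: (seven _ 6) => //=; rewrite G23 ?Er ?two ?three ?Ed //; right; right.
Qed.

(** A Hall pi'-subgroup H of G / N, isomorphic to G / K, acts on V without fixed points,
    and O_pi(G / N) acts trivially, so that the power maps on V are induced by H. The
    involution of H is central, which joins 2 to the other primes of H. *)
Let Frobenius_case_table q : pi^'.-group (G / K) -> prime q -> q %| #|K| ->
  [/\ (2 %| #|G / K|, 3 %| #|G / K|, 5 %| #|G / K|, q) \in
        [:: (true, false, false, 3); (true, false, false, 5); (false, true, false, 2);
            (false, true, false, 7); (true, true, false, 5); (true, true, false, 7);
            (true, true, false, 13); (true, false, true, 3)],
      forall p, prime p -> p %| #|G / K| -> p \in [:: 2; 3; 5]
    & forall p, prime p -> 2 %| #|G / K| -> p %| #|G / K| -> p != 2 -> GK_adj G 2 p].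
Proof.
move=> pi'L pr_q qK; have [N [V [nNG isoL [abV ntV nVG sVO cVO]]]] := quotient_data pr_q qK.
set O := 'O_pi(G / N)%G in isoL sVO cVO.
have nO : O <| G / N := pcore_normal _ _.
have pi'LN : pi^'.-group ((G / N) / O) by rewrite /pgroup -(card_isog isoL).
have hallO : pi.-Hall(G / N) O.
  rewrite /pHall normal_sub ?pcore_pgroup //=.
  by rewrite -card_quotient ?normal_norm.
have [H] := splitsP (SchurZassenhaus_split (pHall_Hall hallO) nO).
case/complP=> tiOH defGN.
have sHG : H \subset G / N by rewrite -defGN mulG_subr.
have nOH : H \subset 'N(O) := subset_trans sHG (normal_norm nO).
have isoH : G / K \isog H.
  have sdGN : O ><| H = G / N by rewrite sdprodE.
  by apply: isog_trans isoL _; rewrite isog_sym; apply: sdprod_isog sdGN.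
rewrite (card_isog isoH).
have solGN : solvable (G / N) by apply: quotient_sol.
have qGN : quadratic_characters (G / N) by apply: quadratic_characters_quotient.
have uGN : unmixed pi (G / N) by apply: unmixed_quotient.
have pi'H : pi^'.-group H by rewrite /pgroup -(card_isog isoH).
have regH : semiregular V H.
  by apply: (pi'_group_semiregular (pi := pi) (G := G / N)).
have nVH : H \subset 'N(V) := subset_trans sHG (normal_norm nVG).
have qH : quadratic_characters H.
  by apply: (quadratic_characters_isog isoH); apply: quadratic_characters_quotient.
have ntH : H :!=: 1.
  apply: contra npiG => /eqP H1; rewrite /pgroup -(Lagrange (normal_sub nKG)) pnatM.
  rewrite -card_quotient ?normal_norm // (card_isog isoH) H1 cards1 andbT.
  exact: piK.
split.
- apply: (fixed_point_free_orders abV ntV nVH regH qH) => //; first exact: solvableS solGN.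
  move=> k co_k v Vv; have [-> | ntv] := eqVneq v 1.
    by exists 1; rewrite ?group1 // conjg1 expg1n.
  have GNv : v \in G / N by apply: (subsetP (normal_sub nVG)).
  have := square_power_class qGN GNv (k := k); rewrite (abelem_order_p abV Vv ntv).
  case/(_ co_k)/imsetP=> g; rewrite -{1}defGN => /mulsgP[o h Oo Hh ->] ->; exists h => //.
  have cvo : commute v o by apply: commute_sym; apply: (centP (subsetP cVO o Oo)).
  by have /commgP/conjg_fixP vo := cvo; rewrite conjgM vo.
- exact: (prime_divisor_le5 abV ntV nVH regH qH).
move=> p pr_p evenH pH np2; apply: (@GK_adj_quotient _ _ N) => //; first exact: prime_gt0.
have [t Ht ot] := Cauchy (isT : prime 2) evenH; have [x Hx ox] := Cauchy pr_p pH.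
have ctx := involution_central abV ntV nVH regH Ht ot Hx.
rewrite /GK_adj eq_sym np2; apply/existsP; exists (t * x).
rewrite (subsetP sHG) ?groupM //= orderM // ot ox ?eqxx //.
by rewrite prime_coprime // dvdn_prime2 // eq_sym.
Qed.

(** Above a prime q >= 5 of pi, an element of order (q-1)/2 modulo the
    centralizer of an element of order q would commute with a neighbour of q,
    hence would lie in K, which cannot move the subgroup of order q. *)
Let large_prime_alone q q' : pi^'.-group (G / K) ->
  prime q -> q %| #|K| -> prime q' -> q' %| #|K| -> 5 <= q -> q' = q.
Proof.
move=> pi'L pr_q qK pr_q' q'K q_ge5; apply/eqP; apply: contraT => nqq'.
have hallK : pi.-Hall(G) K.
  by rewrite /pHall normal_sub ?pcore_pgroup //= -card_quotient ?normal_norm.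
have primeG p : prime p -> p %| #|K| -> p \in primes #|G|.
  by move=> pr_p pK; rewrite mem_primes pr_p cardG_gt0 dvdG ?pK.
rewrite eq_sym in nqq'.
have [s Gs /andP[pi_s adj]] := nbr (primeG q pr_q qK) (primeG q' pr_q' q'K)
  (prK pr_q qK) (prK pr_q' q'K) nqq'.
have pr_s : prime s by move: Gs; rewrite mem_primes => /andP[].
have [b [a [Gb Ga cba ob oa]]] := adjacent_elements pr_q pr_s adj.
have cab : commute a b by apply: commute_sym.
have co_ab : coprime #[a] q.
  by rewrite oa prime_coprime // dvdn_prime2 // eq_sym; case/andP: adj.
have odd_q : odd q by case: (even_prime pr_q) q_ge5 => // ->.
have [c [g /setIP[Gg /cent1P cag] [bg cP]]] :=
  prime_order_fusion qG Ga Gb cab co_ab pr_q odd_q ob.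
have pi_a : pi.-elt a by rewrite /p_elt oa pnatE.
have pi_g : pi.-elt g.
  case/orP: (uG Gg) => // pi'g.
  have [a1 | ->] := unmixed_commute uG Ga Gg (commute_sym cag) pi_a pi'g; last exact: p_elt1.
  by move: pr_s; rewrite -oa a1 order1.
have Kg : g \in K by rewrite (mem_normal_Hall hallK nKG).
have Kb : b \in K.
  by rewrite (mem_normal_Hall hallK nKG) // /p_elt ob pnatE ?prK.
have bg1 := bg 1%N; rewrite expg1 expn1 in bg1.
have bgb := pcore_normalizes_trivially solG uG npiG pr_q Kb ob Kg bg1.
have := cP 1%N; rewrite expn1 -bg1 bgb eqxx => /esym.
by rewrite dvdn1; move: q_ge5; clear; case: q => [|[|[|[|[|q]]]]].
Qed.

Theorem component_cases : (GK_vertices G, GK_edges G) \in seven_graphs.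
Proof.
have [pi'L | npi'L] := boolP (pi^'.-group (G / K)); last exact: non_Frobenius_case.
have K_gt1 : 1 < #|K| by rewrite cardG_gt1.
have [q pr_q qK] : exists2 q, prime q & q %| #|K|.
  by exists (pdiv #|K|); rewrite ?pdiv_prime ?pdiv_dvd.
have [tab L235 adj2] := Frobenius_case_table pi'L pr_q qK.
have Kq p : prime p -> p %| #|K| -> p = q.
  move=> pr_p pK; have [q_ge5 | q_lt5] := leqP 5 q; first exact: (large_prime_alone pi'L pr_q).
  have [p_ge5 | p_lt5] := leqP 5 p; first by rewrite (large_prime_alone pi'L pr_p pK pr_q qK).
  have [tab' _ _] := Frobenius_case_table pi'L pr_p pK.
  { have lt5 s : prime s -> s < 5 -> (s == 2) || (s == 3) by case: s => [|[|[|[|[|]]]]].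
  have := lt5 p pr_p p_lt5; have := lt5 q pr_q q_lt5; move: tab tab'; clear.
  move: (2 %| _) (3 %| _) (5 %| _) => b2 b3 b5 tab tab' /orP[]/eqP E /orP[]/eqP E'.
  all: by move: tab tab'; rewrite ?E ?E' // !inE !xpair_eqE /=; case: b2; case: b3; case: b5. }
have pi_q := prK pr_q qK.
have DG p : (p \in primes #|G|) = (p == q) || (p \in [:: 2; 3; 5]) && (p %| #|G / K|).
  rewrite mem_primes cardG_gt0 /=; apply/andP/orP=> [[pr_p] | [/eqP-> | /andP[p5 pL]]].
  - rewrite dvdG // => /orP[/(Kq p pr_p)-> | pL]; first by left.
    by right; rewrite L235.
  - by rewrite dvdG ?qK.
  - have pr_p : prime p by move: p5; rewrite !inE => /or3P[]/eqP->.
    by rewrite dvdG ?pL ?orbT.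
have nadj p : p %| #|G / K| -> prime p -> ~~ GK_adj G p q.
  move=> pL pr_p; rewrite GK_adjC; apply: unmixed_nonadjacent => //.
  exact: (pgroupP pi'L).
have seven VE b : VE = nth VE seven_graphs b -> b < 7 -> VE \in seven_graphs.
  by move=> -> lt_b; apply: mem_nth.
have pair a : prime a -> a %| #|G / K| -> (forall p, p \in primes #|G| -> p \in [:: a; q]) ->
    forall V, V =i [:: a; q] -> (GK_vertices G, GK_edges G) = (V, fset0).
  move=> pr_a aL allG V DV; apply: GK_pair_graph DV _ (nadj a aL pr_a) => p.
  apply/idP/idP=> [/allG // |]; rewrite DG !inE => /orP[/eqP-> | -> //].
  by rewrite aL; have := L235 a pr_a aL; rewrite !inE => ->; rewrite orbT.
have triple b : prime b -> 2 %| #|G / K| -> b %| #|G / K| -> b != 2 ->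
   (forall p, p \in primes #|G| -> p \in [:: 2; b; q]) ->
    forall V, V =i [:: 2; b; q] -> (GK_vertices G, GK_edges G) = (V, [fset [fset 2; b]])%fset.
  move=> pr_b evenL bL nb2 allG V DV.
  apply: GK_triple_graph DV _ (adj2 b pr_b evenL bL nb2) (nadj 2 evenL isT) (nadj b bL pr_b).
  move=> p; apply/idP/idP=> [/allG // |]; rewrite DG !inE => /or3P[/eqP-> | /eqP-> | -> //].
    by rewrite evenL orbT.
  by rewrite bL; have := L235 b pr_b bL; rewrite !inE => ->; rewrite orbT.
clear Kq adj2 L235 nadj; rewrite !inE !xpair_eqE in tab.
have allG (B : seq nat) : (2 %| #|G / K| -> 2 \in B) -> (3 %| #|G / K| -> 3 \in B) ->
    (5 %| #|G / K| -> 5 \in B) -> q \in B -> forall p, p \in primes #|G| -> p \in B.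
  move=> B2 B3 B5 Bq p; rewrite DG !inE => /orP[/eqP-> // | /andP[/or3P[]/eqP->]].
  - exact: B2.
  - exact: B3.
  - exact: B5.
move: tab; do 7?[case/orP]; move=> /andP[/andP[/andP[/eqP E2 /eqP E3] /eqP E5] /eqP Eq];
  move: allG; rewrite E2 E3 E5 => allG.
- apply: (seven _ 0) => //=; apply: (pair 2); rewrite ?E2 ?Eq //; last by move=> p; rewrite !inE orbC.
  by apply: allG; rewrite // Eq.
- apply: (seven _ 1%N) => //=; apply: (pair 2); rewrite ?E2 ?Eq //; last by move=> p; rewrite !inE.
  by apply: allG; rewrite // Eq.
- apply: (seven _ 0) => //=; apply: (pair 3); rewrite ?E3 ?Eq //; last by move=> p; rewrite !inE orbC.
  by apply: allG; rewrite // Eq.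
- apply: (seven _ 2) => //=; apply: (pair 3); rewrite ?E3 ?Eq //; last by move=> p; rewrite !inE.
  by apply: allG; rewrite // Eq.
- apply: (seven _ 4) => //=; apply: (triple 3); rewrite ?E2 ?E3 ?Eq //; last first.
    by move=> p; rewrite !inE orbA.
  by apply: allG; rewrite // Eq.
- apply: (seven _ 5) => //=; apply: (triple 3); rewrite ?E2 ?E3 ?Eq //; last first.
    by move=> p; rewrite !inE orbA.
  by apply: allG; rewrite // Eq.
- apply: (seven _ 6) => //=; apply: (triple 3); rewrite ?E2 ?E3 ?Eq //; last first.
    by move=> p; rewrite !inE orbA.
  by apply: allG; rewrite // Eq.
- apply: (seven _ 3) => //=; apply: (triple 5); rewrite ?E2 ?E5 ?Eq //; last first.
    by move=> p; rewrite !inE; clear; lia.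
  by apply: allG; rewrite // Eq.
Qed.

End ComponentCases.

Lemma mixed_order_adjacent (gT : finGroupType) (G : {group gT}) x s t :
  x \in G -> prime s -> prime t -> s != t -> s %| #[x] -> t %| #[x] -> GK_adj G s t.
Proof.
move=> Gx pr_s pr_t nst sx tx; rewrite /GK_adj nst; apply/existsP.
have st_x : s * t %| #[x] by rewrite Gauss_dvd ?sx // prime_coprime // dvdn_prime2.
exists (x ^+ (#[x] %/ (s * t))).
by rewrite groupX //= orderXdiv ?dvdn_div // divnA // mulKn ?order_gt0 ?eqxx.
Qed.

(** Taking for pi a connected component that contains a prime dividing the order
    of the Fitting subgroup makes O_pi(G) nontrivial. *)
Theorem disconnected_GK_graph (gT : finGroupType) (G : {group gT}) :
    solvable G -> quadratic_characters G -> disconnected (GK_graph G) ->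
  (GK_vertices G, GK_edges G) \in seven_graphs.
Proof.
move=> solG qG [u [v [Gu Gv no_path]]].
have {}Gu : u \in primes #|G| by move: Gu; rewrite inE.
have {}Gv : v \in primes #|G| by move: Gv; rewrite inE.
have ntG : G :!=: 1 by apply: contraTneq Gu => ->; rewrite cards1.
have ntF : 'F(G) != 1 by rewrite trivg_Fitting.
have F_gt1 : 1 < #|'F(G)| by rewrite cardG_gt1.
pose p := pdiv #|'F(G)|; have pr_p : prime p := pdiv_prime F_gt1.
have pF : p %| #|'F(G)| := pdiv_dvd _.
have pG : p \in primes #|G|.
  by rewrite mem_primes pr_p cardG_gt0 (dvdn_trans pF) ?cardSg ?Fitting_sub.
pose n := #|G|; have ltn s : s \in primes #|G| -> s < n.+1.
  by rewrite mem_primes ltnS => /and3P[_ ? /dvdn_leq->].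
pose e : rel 'I_n.+1 :=
  fun i j => [&& nat_of_ord i \in primes #|G|, nat_of_ord j \in primes #|G| & GK_adj G i j].
have e_sym : connect_sym e.
  by apply: sym_connect_sym => i j; rewrite /e GK_adjC andbCA.
pose pi : nat_pred := [pred s | (s < n.+1) && connect e (inord p) (inord s)].
have pi_p : p \in pi by rewrite inE /= ltn // connect0.
have stepP s t : s \in primes #|G| -> t \in primes #|G| -> s \in pi -> GK_adj G s t -> t \in pi.
  move=> Gs Gt /andP[_ ps] st; rewrite inE /= ltn //; apply: connect_trans ps (connect1 _).
  by rewrite /e !inordK ?ltn // Gs Gt.
have conn s t : s \in pi -> t \in pi -> connect e (inord s) (inord t).
  by case/andP=> _ ps /andP[_]; apply: connect_trans; rewrite e_sym.
have adjE i j : e i j -> adjacent (GK_graph G) i j.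
  by case/and3P=> Gi Gj ij; apply/GK_edgesP; exists (val i), (val j).
apply: (component_cases (pi := pi)) => //.
- move=> x Gx; apply: contraT; rewrite negb_or => /andP[].
  rewrite /p_elt /pnat order_gt0 => /= /allPn[t]; rewrite mem_primes => /and3P[pr_t _ tx] pi't.
  case/allPn=> s; rewrite mem_primes => /and3P[pr_s _ sx]; rewrite inE /= negbK => pi_s.
  have nst : s != t by apply: contraNneq pi't => <-.
  have Gmem r : prime r -> r %| #[x] -> r \in primes #|G|.
    by move=> pr_r rx; rewrite mem_primes pr_r cardG_gt0 (dvdn_trans rx) ?order_dvdG.
  case/negP: pi't; apply: (stepP s t) => //; try exact: Gmem.
  exact: (mixed_order_adjacent Gx).
- apply/negP=> piG; case: no_path.
  have piP s : s \in primes #|G| -> s \in pi.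
    by rewrite mem_primes => /and3P[pr_s _]; apply: (pgroupP piG).
  have /connectP[c ec lc] := conn u v (piP u Gu) (piP v Gv).
  exists (map val c); split.
    have <- : val (inord u : 'I_n.+1) = u by rewrite /= inordK ?ltn.
    by rewrite path_map; apply: sub_path ec => i j /adjE.
  have Du : u = val (inord u : 'I_n.+1) by rewrite /= inordK ?ltn.
  by rewrite {1}Du last_map -lc /= inordK ?ltn.
- apply: contraTneq pF => K1.
  have hallF := nilpotent_pcore_Hall pi (Fitting_nil G).
  have O1 : 'O_pi('F(G)) = 1 by apply/trivgP; rewrite -K1 pcore_Fitting.
  have p'F : pi^'.-group 'F(G).
    by case/and3P: hallF => _ _; rewrite O1 indexg1.
  by apply/negP=> pF; have := pgroupP p'F p pr_p pF; rewrite inE /= pi_p.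
move=> q q' Gq Gq' pi_q pi_q' nqq'.
have /connectP[[|y c] /= ec lc] := conn q q' pi_q pi_q'.
  by case/eqP: nqq'; have := congr1 val lc; rewrite /= !inordK ?ltn.
case/andP: ec => /and3P[_ Gy qy] _; rewrite inordK ?ltn // in qy.
by exists (val y) => //; rewrite qy andbT; apply: (stepP q).
Qed.

(** * A criterion for semi-rationality *)

(** Either every element of the Galois group fixes a, which is then rational, or
    an automorphism that moves a extends to the algebraic numbers. *)
Lemma rational_or_moved (Qn : splittingFieldType rat) (QnC : {rmorphism Qn -> algC}) a :
    galois 1 {:Qn} ->
    (forall nuQn : argumentType [in 'Gal({:Qn} / 1)],
       {nu : {rmorphism algC -> algC} | {morph QnC: a / nuQn a >-> nu a}}) ->
  (exists r : rat, QnC a = ratr r) \/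
  (exists nu : {rmorphism algC -> algC}, nu (QnC a) != QnC a).
Proof.
move=> galQn gQnC; have [Fa | nFa] := boolP (a \in fixedField 'Gal({:Qn} / 1)).
  left; move/galois_fixedField: galQn Fa => -> /vlineP[r ->]; exists r.
  by rewrite rmorphZ_num rmorph1 mulr1.
right; have [x Gx xa] : exists2 x : gal_of {:Qn}, x \in 'Gal({:Qn} / 1) & x a != a.
  apply/exists_inP; apply: contraR nFa; rewrite negb_exists_in => /forall_inP fixa.
  apply/fixedFieldP; first exact: memvf.
  by move=> x /fixa; rewrite negbK => /eqP.
have [nu nuE] := gQnC x; exists nu; rewrite -nuE.
by rewrite (inj_eq (fmorph_inj QnC)).
Qed.

(** The converse of [quadratic_values_degree]: if u moves a value z, then
    z' + u z' and (z' - u z') / (z - u z) are rational for every value z', because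
    every automorphism agrees on the values with the identity or with u. *)
Lemma degree_quadratic_values (Qn : splittingFieldType rat) (QnC : {rmorphism Qn -> algC}) s :
    galois 1 {:Qn} ->
    (forall nuQn : argumentType [in 'Gal({:Qn} / 1)],
       {nu : {rmorphism algC -> algC} | {morph QnC: a / nuQn a >-> nu a}}) ->
    {in s, forall z, exists a, QnC a = z} ->
    (forall (u : {rmorphism algC -> algC}) z, z \in s -> exists a, QnC a = u z) ->
    quadratic_values s ->
  degree_over_Q s <= 2.
Proof.
move=> galQn gQnC sQn usQn qs; rewrite /degree_over_Q /num_field.
case: (num_field_exists s) => /= Qs [QsC [s1 Ds gens1]].
have ratP z : (exists a, QnC a = z) -> (forall nu : {rmorphism algC -> algC}, nu z = z) ->
    exists r : rat, z = ratr r.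
  move=> [a <-] fix_a; have [//|[nu]] := rational_or_moved a galQn gQnC.
  by rewrite fix_a eqxx.
have ratE (r : rat) : QsC (r%:A)%R = ratr r by rewrite rmorphZ_num rmorph1 mulr1.
have [rat1 | /allPn[z s1z nz]] := boolP (all (mem 1%VS) s1).
  rewrite -gens1; apply: leq_trans (_ : \dim (1%VS : {vspace Qs}) <= 2); last by rewrite dimv1.
  by apply: dimvS; apply/Fadjoin_seqP; split=> // y /(allP rat1).
have sE y : y \in s1 -> QsC y \in s by move=> s1y; rewrite -Ds map_f.
have [u uz] : exists u : {rmorphism algC -> algC}, u (QsC z) != QsC z.
  have [a Da] := sQn _ (sE z s1z).
  have [[r rz]|] := rational_or_moved a galQn gQnC; last by rewrite Da.
  case/negP: nz; apply/vlineP; exists r; apply: (fmorph_inj QsC).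
  by rewrite ratE -Da.
have fix_or (v : {rmorphism algC -> algC}) : {in s, v =1 id} \/ {in s, v =1 u}.
  case: (qs u v) => E; [by rewrite E ?eqxx ?sE in uz | by left |].
  by right=> y sy; rewrite E.
have fix2 (v : {rmorphism algC -> algC}) :
    {in s, v =1 id} /\ {in s, v \o u =1 u} \/ {in s, v =1 u} /\ {in s, v \o u =1 id}.
  have vu : v (u (QsC z)) != v (QsC z) by rewrite (inj_eq (fmorph_inj v)).
  have sz := sE z s1z; case: (fix_or v) => E; [left | right]; split=> //.
    case: (fix_or (v \o u : {rmorphism algC -> algC})) => // E'.
    by have := E' _ sz; rewrite /= -{2}[QsC z]E // => Ez; rewrite Ez eqxx in vu.
  case: (fix_or (v \o u : {rmorphism algC -> algC})) => // E'.
  by have := E' _ sz; rewrite /= -[RHS]E // => Ez; rewrite Ez eqxx in vu.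
have trace y : y \in s1 -> exists r : rat, (QsC y + u (QsC y) = ratr r)%R.
  move=> s1y; have sy := sE y s1y; apply: ratP.
    have [a Da] := sQn _ sy; have [b Db] := usQn u _ sy.
    by exists (a + b)%R; rewrite rmorphD Da Db.
  move=> v; rewrite rmorphD; case: (fix2 v) => [[E E'] | [E E']]; have /= -> := E' _ sy.
    by rewrite E.
  by rewrite E // addrC.
have nzd : (QsC z - u (QsC z) != 0)%R by rewrite subr_eq0 eq_sym.
have ratio y : y \in s1 ->
    exists r : rat, ((QsC y - u (QsC y)) / (QsC z - u (QsC z)) = ratr r)%R.
  move=> s1y; have sy := sE y s1y; have sz := sE z s1z; apply: ratP.
    have [a Da] := sQn _ sy; have [b Db] := usQn u _ sy.
    have [c Dc] := sQn _ sz; have [d Dd] := usQn u _ sz.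
    by exists ((a - b) / (c - d))%R; rewrite fmorph_div !rmorphB Da Db Dc Dd.
  move=> v; rewrite fmorph_div !rmorphB.
  case: (fix2 v) => [[E E'] | [E E']]; have /= -> := E' _ sy; have /= -> := E' _ sz; rewrite !E //.
  by rewrite -opprB -[(u (QsC z) - _)%R]opprB invrN mulrNN.
have span_z y : y \in s1 -> exists a b : rat, y = (a%:A + b *: z)%R.
  move=> s1y; have [w Dw] := trace y s1y; have [w0 Dw0] := trace z s1z.
  have [t Dt] := ratio y s1y; exists ((w - t * w0) / 2%:R)%R, t; apply: (fmorph_inj QsC).
  have Er : (ratr ((w - t * w0) / 2%:R) = (ratr w - ratr t * ratr w0) / 2%:R :> algC)%R.
    by rewrite fmorph_div rmorph_nat rmorphB rmorphM.
  rewrite rmorphD ratE rmorphZ_num Er -Dw -Dw0 -Dt.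
  move: nzd; move: (QsC y) (u (QsC y)) (QsC z) (u (QsC z)) => a b c d nzd; field; exact: nzd.
have zz : exists a b : rat, (z * z = a%:A + b *: z)%R.
  have sz := sE z s1z; have [w Dw] := trace z s1z.
  have [n Dn] : exists r : rat, (QsC z * u (QsC z) = ratr r)%R.
    apply: ratP; first by have [a Da] := sQn _ sz; have [b Db] := usQn u _ sz; exists (a * b)%R; rewrite rmorphM Da Db.
    move=> v; rewrite rmorphM; case: (fix2 v) => [[E E'] | [E E']]; have /= -> := E' _ sz; rewrite E //.
    exact: mulrC.
  exists (- n)%R, w; apply: (fmorph_inj QsC).
  rewrite rmorphM rmorphD ratE rmorphZ_num (rmorphN (ratr : rat -> algC)) /= -Dw -Dn; ring.
have [a [b Dzz]] := zz.
pose P : {poly Qs} := ('X^2 - (b%:A *: 'X + a%:A%:P))%R.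
have rat1 (r : rat) : r%:A%R \in (1%VS : {vspace Qs}) by apply/vlineP; exists r.
have P1 : P \is a polyOver 1%AS.
  by rewrite rpredB ?rpredX ?rpredD ?polyOverX ?polyOverZ ?polyOverX ?polyOverC ?rat1.
have rootP : root P z.
  by rewrite /root !hornerE expr2 Dzz -scalerAl mul1r subr_eq0 addrC.
have size2 : (size (b%:A *: 'X + a%:A%:P : {poly Qs})%R <= 2)%N.
  rewrite (leq_trans (size_polyD _ _)) // geq_max (leq_trans (size_scale_leq _ _)) ?size_polyX //.
  by rewrite (leq_trans (size_polyC_leq1 _)).
have sizeP : size P = 3 by rewrite size_polyDl ?size_polyXn // size_polyN ltnS.
rewrite -gens1; apply: leq_trans (_ : \dim <<1; z>>%VS <= 2).
  apply: dimvS; apply/Fadjoin_seqP; split=> [|y /span_z[c [d ->]]]; first exact: subv_adjoin.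
  by rewrite memvD ?memvZ ?memv_adjoin ?mem1v.
rewrite dim_Fadjoin dimv1 muln1.
have := dvdp_leq _ (minPoly_dvdp P1 rootP).
by rewrite size_minPoly sizeP ltnS; apply; rewrite -size_poly_eq0 sizeP.
Qed.

(** The generators of <[x]> lie in at most two classes, in the form that mirrors
    [quadratic_values]. *)
Definition two_classes (gT : finGroupType) (G : {set gT}) (x : gT) : Prop :=
  forall k1 k2, coprime k1 #[x] -> coprime k2 #[x] ->
  [\/ x ^+ k1 \in x ^: G, x ^+ k2 \in x ^: G | x ^+ k1 \in (x ^+ k2) ^: G].

Lemma aut_power (u : {rmorphism algC -> algC}) n : 0 < n ->
  exists2 k, coprime k n & forall z, (z ^+ n = 1 -> u z = z ^+ k)%R.
Proof.
move=> n_gt0; have [w prim_w] := C_prim_root_exists n_gt0.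
have uw1 : (u w ^+ n = 1)%R by rewrite -rmorphXn (prim_expr_order prim_w) rmorph1.
have [[k ltkn] /= uw] := prim_rootP prim_w uw1.
exists k; last first.
  by move=> z /(prim_rootP prim_w)[i ->]; rewrite rmorphXn uw /= exprAC.
by rewrite -(prim_root_exp_coprime k prim_w) -uw fmorph_primitive_root.
Qed.

Theorem semi_rational_two_classes (gT : finGroupType) (G : {group gT}) :
  (forall x, x \in G -> two_classes G x) -> semi_rational G.
Proof.
move=> G2 x Gx; have [Qn galQn [QnC gQnC [_ _ QnG]]] := group_num_field_exists G.
have inQn i y : y \in G -> exists a, QnC a = ('chi[G]_i y)%R.
  by move=> Gy; have [a Da] := QnG _ G _ (irr_char i) y (order_dvdG Gy); exists a.
have power (u : {rmorphism algC -> algC}) :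
    exists2 k, coprime k #[x] & forall i, (u ('chi[G]_i x) = 'chi_i (x ^+ k)%g)%R.
  have [k co_k uE] := aut_power u (order_gt0 x); exists k => // i.
  exact: char_power_aut (irr_char i) Gx uE.
apply: (degree_quadratic_values galQn gQnC).
- by move=> _ /imageP[i _ ->]; apply: inQn.
- by move=> u _ /imageP[i _ ->]; have [k _ ->] := power u; apply: inQn; apply: groupX.
move=> u v; have [k1 co1 uE] := power u; have [k2 co2 vE] := power v.
case: (G2 x Gx k1 k2 co1 co2) => /imsetP[g Gg Dg];
  [apply: Or31 | apply: Or32 | apply: Or33]; move=> _ /imageP[i _ ->].
- by rewrite uE Dg cfunJ.
- by rewrite vE Dg cfunJ.
- by rewrite uE vE Dg cfunJ.
Qed.

(** * Affine groups *)

Section TwoClasses.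

Variable gT : finGroupType.
Implicit Types (G H : {group gT}) (x : gT).

Lemma two_classesJ G x g : g \in G -> two_classes G (x ^ g) -> two_classes G x.
Proof.
have memJ a b : g \in G -> (a ^ g \in (b ^ g) ^: G) = (a \in b ^: G).
  by move=> Gg; rewrite classGidl // class_sym classGidl // class_sym.
move=> Gg xg2 k1 k2 co1 co2; have := xg2 k1 k2; rewrite orderJ -!conjXg !memJ //.
exact.
Qed.

Lemma two_classesS G H x : H \subset G -> two_classes H x -> two_classes G x.
Proof.
move=> sHG H2 k1 k2 co1 co2; have sub y : y ^: H \subset y ^: G by apply: imsetS.
by case: (H2 k1 k2 co1 co2) => /(subsetP (sub _)); [apply: Or31 | apply: Or32 | apply: Or33].
Qed.

(** The unit u generates a subgroup of index at most two of the units modulo n, with b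
    in the other coset if there is one. *)
Definition index_two n u b : bool :=
  all (fun k => coprime k n ==>
    has (fun i => (k == u ^ i %[mod n]) || (k == b * u ^ i %[mod n])) (iota 0 n)) (iota 0 n).

Lemma two_classes_index_two G x u b :
  x ^+ u \in x ^: G -> index_two #[x] u b -> two_classes G x.
Proof.
move=> xu n2; have xui i : exists2 g, g \in G & x ^+ (u ^ i) = x ^ g.
  elim: i => [|i [g Gg xg]]; first by exists 1; rewrite ?group1 ?conjg1 ?expg1.
  have /imsetP[h Gh xh] := xu; exists (h * g); first exact: groupM.
  by rewrite expnSr expgM xg -conjXg xh conjgM.
have cases k : coprime k #[x] -> x ^+ k \in x ^: G \/ x ^+ k \in (x ^+ b) ^: G.
  move=> co_k; have := allP n2 (k %% #[x]); rewrite mem_iota ltn_mod order_gt0 => /(_ isT).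
  rewrite coprime_modl co_k => /hasP[i _]; rewrite modn_mod => /orP[] E; [left | right].
    have /eqP -> : x ^+ k == x ^+ (u ^ i) by rewrite eq_expg_mod_order.
    by have [g Gg ->] := xui i; apply: imset_f.
  have /eqP -> : x ^+ k == x ^+ (b * u ^ i) by rewrite eq_expg_mod_order.
  rewrite mulnC expgM; have [g Gg ->] := xui i.
  by rewrite -conjXg; apply: imset_f.
move=> k1 k2 /cases[? _ | k1b]; first by apply: Or31.
case/cases=> [? | k2b]; first by apply: Or32.
by apply: Or33; rewrite -(class_eqP k2b) in k1b.
Qed.

Lemma two_classes_small G x : #[x] \in [:: 1%N; 2; 3; 4; 6] -> two_classes G x.
Proof.
move=> small; apply: (@two_classes_index_two G x 1 (#[x].-1)).
  by rewrite expg1 class_refl.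
by move: small; rewrite !inE => /or4P[/eqP->|/eqP->|/eqP->|/orP[]/eqP->].
Qed.

End TwoClasses.

(** The Frobenius group of the maps x -> h x + v, for h in a group of
    automorphisms of V that act without nonzero fixed points. *)
Section AffineGroup.

Variables (V : finZmodType) (H : {group {perm V}}).
Hypothesis addH : forall h, h \in H -> {morph h : x y / (x + y)%R}.
Hypothesis regH : forall h x, h \in H -> h x = x -> x != 0%R -> h = 1.

Definition translation (v : V) : {perm V} := perm (@addIr V v).

Lemma translationE v x : translation v x = (x + v)%R.
Proof. by rewrite permE. Qed.

Lemma translationD v w : translation (v + w)%R = translation v * translation w.
Proof. by apply/permP=> x; rewrite permM !translationE addrA. Qed.

Lemma translation0 : translation 0%R = 1.
Proof. by apply/permP=> x; rewrite perm1 translationE addr0. Qed.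

Lemma translationX v k : translation v ^+ k = translation (v *+ k)%R.
Proof.
elim: k => [|k IHk]; first by rewrite mulr0n translation0.
by rewrite expgSr IHk mulrSr translationD.
Qed.

Lemma translationJ v h : h \in H -> translation v ^ h = translation (h v).
Proof.
move=> Hh; apply/permP=> x; rewrite /conjg !permM !translationE addH //.
by rewrite -permM mulVg perm1.
Qed.

Definition translations : {set {perm V}} := [set translation v | v in [set: V]].

Lemma translations_group_set : group_set translations.
Proof.
apply/group_setP; split; first by apply/imsetP; exists 0%R; rewrite ?translation0.
move=> _ _ /imsetP[v _ ->] /imsetP[w _ ->].
by apply/imsetP; exists (v + w)%R; rewrite ?translationD.
Qed.
Canonical translations_group := Group translations_group_set.

Lemma mem_translation v : translation v \in translations.
Proof. by apply: imset_f. Qed.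

Lemma translations_norm : H \subset 'N(translations).
Proof.
apply/subsetP=> h Hh; rewrite inE; apply/subsetP=> _ /imsetP[_ /imsetP[v _ ->] ->].
by rewrite translationJ ?mem_translation.
Qed.

Lemma translations_abelian : abelian translations.
Proof.
apply/centsP=> _ /imsetP[v _ ->] _ /imsetP[w _ ->].
by rewrite /commute -!translationD addrC.
Qed.

Let h0 h : h \in H -> h 0%R = 0%R.
Proof. by move=> Hh; apply: (addIr (h 0%R)); rewrite -addH // !add0r. Qed.

Lemma card_translations : #|translations| = #|V|.
Proof.
rewrite card_imset ?cardsT // => v w /(congr1 (fun s : {perm V} => s 0%R)).
by rewrite !translationE !add0r.
Qed.

Definition affine_group : {group {perm V}} := (translations_group <*> H)%G.

Lemma affine_groupE : affine_group = translations * H :> {set {perm V}}.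
Proof. by rewrite /= norm_joinEr ?translations_norm. Qed.

Lemma translationsI : translations :&: H = 1.
Proof.
apply/trivgP/subsetP=> _ /setIP[/imsetP[v _ ->] Hv].
have := h0 Hv; rewrite translationE add0r => ->.
by rewrite translation0 inE.
Qed.

Lemma card_affine_group : #|affine_group| = (#|V| * #|H|)%N.
Proof. by rewrite affine_groupE TI_cardMg ?translationsI // card_translations. Qed.

Lemma affine_group_solvable : solvable H -> solvable affine_group.
Proof.
move=> solH; have nT : affine_group \subset 'N(translations).
  by rewrite join_subG normG translations_norm.
have nsT : translations <| affine_group by rewrite /normal joing_subl.
rewrite (series_sol nsT) (abelian_sol translations_abelian) /=.
rewrite norm_joinEr ?translations_norm // quotientMidl.
exact: quotient_sol.
Qed.

Lemma sub_affine_group : H \subset affine_group.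
Proof. exact: joing_subr. Qed.

Lemma translation_affine v : translation v \in affine_group.
Proof. by rewrite (subsetP (joing_subl _ _)) ?mem_translation. Qed.

(** An affine map x -> h x + v with h <> 1 has a fixed point c, because x -> x - h x is
    injective, hence onto; conjugate c to 0. *)
Lemma affine_cases g : g \in affine_group ->
  (exists v, g = translation v) \/ (exists2 w, w \in affine_group & g ^ w \in H).
Proof.
have stab0 f : f \in affine_group -> f 0%R = 0%R -> f \in H.
  move=> Gf; have: f \in translations * H by rewrite -affine_groupE.
  case/mulsgP=> _ h /imsetP[v _ ->] Hh ->; rewrite permM translationE add0r -(h0 Hh).
  by move/perm_inj->; rewrite translation0 mul1g.
move=> Gg; have: g \in translations * H by rewrite -affine_groupE.
case/mulsgP=> _ h /imsetP[v _ ->] Hh Dg.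
have [h1 | nth] := eqVneq h 1; first by left; exists v; rewrite Dg h1 mulg1.
have injd : injective (fun x => x - h x)%R.
  move=> x y /= E; apply/eqP; rewrite -subr_eq0; apply: contraR nth => nz.
  apply/eqP; apply: (regH Hh _ nz).
  have hN z : h (- z)%R = (- h z)%R.
    by apply: (addIr (h z)); rewrite -addH // !addNr h0.
  rewrite addH // hN; apply/eqP; rewrite -subr_eq0 -oppr_eq0 opprB.
  have -> : (x - y - (h x - h y) = x - h x - (y - h y))%R.
    by rewrite !opprB addrACA [RHS]addrACA [(- y + _)%R]addrC.
  by rewrite E subrr.
have [d _ dK] := injF_bij injd; pose c := d (h v).
have dc : (c - h c = h v)%R := dK (h v).
have hc : h (c + v)%R = c by rewrite addH // -dc addrC subrK.
right; exists (translation (- c)%R); first exact: translation_affine.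
apply: stab0; first by rewrite groupJ ?translation_affine.
have tc : translation (- c)%R c = 0%R by rewrite translationE subrr.
by rewrite -{1}tc permJ Dg permM (translationE v) hc.
Qed.

Lemma order_translation v p : (v *+ p = 0)%R -> #[translation v] %| p.
Proof. by move=> pv; rewrite order_dvdn translationX pv translation0. Qed.

(** A translation of order p is conjugate under h to its power of exponent u. *)
Lemma affine_semi_rational p u b :
    prime p -> (forall v : V, v *+ p = 0)%R -> index_two p u b ->
    (exists2 h, h \in H & forall v, h v = (v *+ u)%R) ->
    (forall h, h \in H -> two_classes H h) ->
  semi_rational affine_group.
Proof.
move=> pr_p expV pub [h Hh hu] H2; apply: semi_rational_two_classes => x Gx.
case: (affine_cases Gx) => [[v Dx] | [w Gw Hxw]]; last first.
  by apply: (two_classesJ Gw); apply: two_classesS sub_affine_group (H2 _ Hxw).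
have [_ dvd_p] := primeP pr_p.
have /orP[/eqP ox | /eqP ox] := dvd_p _ (order_translation (expV v)); rewrite -Dx in ox.
  by apply: two_classes_small; rewrite ox.
apply: (two_classes_index_two (u := u) (b := b)); last by rewrite ox.
apply/imsetP; exists h; first exact: (subsetP sub_affine_group).
by rewrite Dx translationX translationJ // hu.
Qed.

Lemma affine_order p : (forall v : V, v *+ p = 0)%R ->
  forall x, x \in affine_group -> #[x] %| p \/ #[x] %| #|H|.
Proof.
move=> expV x Gx; case: (affine_cases Gx) => [[v ->] | [w Gw Hxw]].
  by left; apply: order_translation.
by right; rewrite -(orderJ _ w) order_dvdG.
Qed.

End AffineGroup.

Lemma field_with_root p k d : prime p -> 0 < k -> d %| (p ^ k).-1 ->
  exists F : finFieldType, exists2 c : F, (d.-primitive_root c)%R &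
    (p \in [pchar F])%R /\ #|F| = (p ^ k)%N.
Proof.
move=> pr_p k_gt0 dvd_d; have [F charF cardF] := pPrimePowerField pr_p k_gt0.
have F_gt1 : 1 < #|F| := finNzRing_gt1 F.
have [n Dn] : exists n, #|F| = n.+1 by exists #|F|.-1; rewrite prednK // ltnW.
have n_gt0 : 0 < n by rewrite -ltnS -Dn.
pose rs := rem 0%R (enum F).
have rsE x : (x \in rs) = (x != 0)%R.
  by rewrite mem_rem_uniq ?enum_uniq // inE mem_enum inE andbT.
have /hasP[z _ prim_z] : has (n.-primitive_root)%R rs.
  apply: has_prim_root => //; last by rewrite size_rem ?mem_enum // -cardE Dn.
  - apply/allP=> x; rewrite rsE unity_rootE => nzx; apply/eqP.
    by apply: (mulfI nzx); rewrite -exprS -Dn expf_card mulr1.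
  - by rewrite rem_uniq ?enum_uniq.
exists F, (z ^+ (n %/ d))%R; last by [].
by apply: dvdn_prim_root => //; rewrite -[n]/(n.+1.-1) -Dn cardF.
Qed.

Lemma primitive_root_neq0 (F : fieldType) d (c : F) : (d.-primitive_root c)%R -> (c != 0)%R.
Proof.
move=> prim_c; apply/eqP=> c0; have := prim_expr_order prim_c; rewrite c0 expr0n.
by rewrite eqn0Ngt (prim_order_gt0 prim_c) => /eqP; rewrite eq_sym oner_eq0.
Qed.

Section Homothety.

Variables (F : finFieldType) (d : nat) (c : F).
Hypothesis prim_c : (d.-primitive_root c)%R.

Definition homothety : {perm F} := perm (mulfI (primitive_root_neq0 prim_c)).

Lemma homothetyX i x : (homothety ^+ i) x = (c ^+ i * x)%R.
Proof.
elim: i => [|i IHi]; first by rewrite perm1 mul1r.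
by rewrite expgSr permM IHi permE /= mulrA -exprS.
Qed.

Lemma homothety_eq1 i x : (homothety ^+ i) x = x -> (x != 0)%R -> homothety ^+ i = 1.
Proof.
rewrite homothetyX => cx nzx; have ci1 : (c ^+ i = 1)%R by apply: (mulIf nzx); rewrite mul1r.
by apply/permP=> y; rewrite homothetyX ci1 mul1r perm1.
Qed.

Lemma order_homothety : #[homothety] = d.
Proof.
have eq1 i : (homothety ^+ i == 1) = (c ^+ i == 1)%R.
  apply/eqP/eqP=> [h1 | c1].
    by have := homothetyX i 1%R; rewrite h1 perm1 mulr1.
  by apply/permP=> x; rewrite homothetyX c1 mul1r perm1.
apply/eqP; rewrite eqn_dvd order_dvdn eq1 (prim_expr_order prim_c) eqxx /=.
by rewrite (prim_order_dvd prim_c) -eq1 expg_order.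
Qed.

Lemma homothetyD h : h \in <[homothety]> -> {morph h : x y / (x + y)%R}.
Proof. by case/cycleP=> i -> x y; rewrite !homothetyX mulrDr. Qed.

End Homothety.

(** Take the maps x -> c^i x + v, where c has multiplicative order d in the field with
    p ^ k elements. As u ^ d = 1 modulo p, the scalar u is a power of c. *)
Lemma cyclic_affine_group p k d u b :
    prime p -> 0 < k -> d %| (p ^ k).-1 -> d \in [:: 2; 3; 6] ->
    index_two p u b -> u ^ d = 1 %[mod p] ->
  exists gT : finGroupType, exists G : {group gT},
    [/\ solvable G, semi_rational G, #|G| = (p ^ k * d)%N,
        forall x, x \in G -> #[x] %| p \/ #[x] %| d
      & exists2 h, h \in G & #[h] = d].
Proof.
move=> pr_p k_gt0 dvd_d d236 pub ud1.
have [F [c prim_c [charF cardF]]] := field_with_root pr_p k_gt0 dvd_d.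
pose h := homothety prim_c; pose H := <[h]>%G.
have oh : #[h] = d := order_homothety prim_c.
have addH : forall f, f \in H -> {morph f : x y / (x + y)%R} by apply: homothetyD.
have regH f x : f \in H -> f x = x -> x != 0%R -> f = 1.
  by case/cycleP=> i -> /homothety_eq1; apply.
have expF (v : F) : (v *+ p = 0)%R by rewrite -mulr_natl (pcharf0 charF) mul0r.
exists {perm F}, (affine_group H); split.
- by apply: (affine_group_solvable addH); apply/abelian_sol/cycle_abelian.
- apply: (affine_semi_rational addH regH pr_p expF pub).
    have ur : ((u%:R : F) ^+ d = 1)%R.
      by rewrite -natrX -(GRing.natr_mod_pchar charF) ud1 (GRing.natr_mod_pchar charF).
    have [i Di] := prim_rootP prim_c ur.
    exists (h ^+ i) => [|v]; first exact: mem_cycle.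
    by rewrite homothetyX -Di mulr_natl.
  move=> f Hf; apply: two_classes_small.
  have := order_dvdG Hf; rewrite -orderE oh; move: d236; rewrite !inE; clear.
  by case/or3P=> /eqP->; rewrite dvdn_divisors // !inE; do ?[case/orP]; move=> /eqP->.
- by rewrite (card_affine_group addH) cardF -orderE oh.
- by move=> x /(affine_order addH regH expF); rewrite -orderE oh.
by exists h; rewrite // (subsetP (sub_affine_group _)) // cycle_id.
Qed.

(** In the field with 81 elements, x -> g^8 x and x -> g^4 x^9 generate a group
    of order 20, in which the second map has square -1 and inverts the first. *)
Lemma dicyclic_affine_group :
  exists gT : finGroupType, exists G : {group gT},
    [/\ solvable G, semi_rational G, primes #|G| = [:: 2; 3; 5],
        forall x, x \in G -> #[x] %| 3 \/ #[x] %| 40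
      & exists2 h, h \in G & #[h] = 10].
Proof.
have [F [g prim_g [charF cardF]]] := @field_with_root 3 4 80 isT isT isT.
have prim_c : (10.-primitive_root (g ^+ 8))%R by apply: (dvdn_prim_root prim_g (isT : 10 %| 80)).
have g40 : (g ^+ 40 = -1)%R.
  have : ((g ^+ 40) ^+ 2 == 1)%R by rewrite -exprM (prim_expr_order prim_g).
  by rewrite sqrf_eq1 -(prim_order_dvd prim_g) => /orP[|/eqP].
have frobD (x y : F) : ((x + y) ^+ 9 = x ^+ 9 + y ^+ 9)%R.
  by rewrite exprDn_pchar // (eq_pnat 9 (GRing.pcharf_eq charF)).
pose bf (x : F) : F := (g ^+ 4 * x ^+ 9)%R.
have bf2 x : bf (bf x) = (- x)%R.
  have x81 : (x ^+ 81 = x)%R by rewrite -[81]cardF expf_card.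
  rewrite /bf exprMn -!exprM mulrA -exprD -[(4 + 4 * 9)%N]/40 -[(9 * 9)%N]/81.
  by rewrite g40 x81 mulN1r.
have bf_inj : injective bf by move=> x y /(congr1 bf); rewrite !bf2 => /oppr_inj.
pose a := homothety prim_c; pose b : {perm F} := perm bf_inj.
have oa : #[a] = 10 := order_homothety prim_c.
have bE x : b x = (g ^+ 4 * x ^+ 9)%R by rewrite permE.
have bb : b ^+ 2 = a ^+ 5.
  by apply/permP=> x; rewrite expgS expg1 permM homothetyX -exprM g40 !permE -/bf bf2 mulN1r.
have ab : a ^ b = a ^+ 9.
  apply/permP=> y; rewrite -[y](permKV b) permJ homothetyX; set z := _ y.
  by rewrite !bE -[a]expg1 homothetyX expr1; ring.
have a9 x : x \in <[a]> -> x ^ b = x ^+ 9.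
  by case/cycleP=> i ->; rewrite conjXg ab -!expgM mulnC.
pose H := (<[a]> <*> <[b]>)%G.
have nab : <[b]> \subset 'N(<[a]>).
  by rewrite cycle_subG inE -cycleJ cycle_subG ab mem_cycle.
have DH : H = <[a]> * <[b]> :> {set {perm F}} by rewrite /= norm_joinEr.
have Ha : a \in H by rewrite mem_gen // inE cycle_id.
have Hb : b \in H by rewrite mem_gen // inE cycle_id orbT.
have Hcases h : h \in H -> exists2 x, x \in <[a]> & h = x \/ h = x * b.
  move=> Hh; have: h \in <[a]> * <[b]> by rewrite -DH.
  case/mulsgP=> x _ Ax /cycleP[j ->] ->; exists (x * (a ^+ 5) ^+ j./2).
    by rewrite groupM ?groupX ?cycle_id.
  rewrite -bb -expgM -[X in b ^+ X](odd_double_half j) mul2n -mulgA.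
  by case: (odd j); [right; rewrite add1n expgSr mulgA | left].
have square x : x \in <[a]> -> (x * b) ^+ 2 = a ^+ 5.
  move=> Ax; have x10 : x ^+ 10 = 1 by apply/eqP; rewrite -order_dvdn -oa order_dvdG.
  have cxa : commute x (a ^+ 5).
    by apply: (centsP (cycle_abelian a)); rewrite ?mem_cycle.
  rewrite expgS expg1 {2}(conjgC x b) (a9 x Ax) mulgA -[x * b * b]mulgA.
  have <- : b ^+ 2 = b * b by rewrite expgS expg1.
  by rewrite bb cxa -mulgA -expgS x10 mulg1.
have addA : forall h, h \in <[a]> -> {morph h : x y / (x + y)%R} by apply: homothetyD.
have addb : {morph b : x y / (x + y)%R} by move=> x y; rewrite !bE frobD mulrDr.
have addH : forall h, h \in H -> {morph h : x y / (x + y)%R}.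
  by move=> h /Hcases[f Af [-> | ->]] x y; rewrite ?permM addA // addb.
have a5 x : (a ^+ 5) x = x -> x = 0%R.
  rewrite homothetyX -exprM g40 mulN1r => /eqP; rewrite eq_sym -subr_eq0 opprK.
  rewrite -mulr2n -mulr_natl mulf_eq0 => /orP[|/eqP //].
  by rewrite -(dvdn_pcharf charF).
have regH f x : f \in H -> f x = x -> x != 0%R -> f = 1.
  case/Hcases=> h Ah [-> | ->] hx nzx.
    by move: Ah hx => /cycleP[i ->] /homothety_eq1; apply.
  case/eqP: nzx; apply: a5; rewrite -(square h Ah) expgS expg1.
  by rewrite permM hx.
have expF (v : F) : (v *+ 3 = 0)%R by rewrite -mulr_natl (pcharf0 charF) mul0r.
have H40 : #|H| %| 40.
  have oab := mul_cardG <[a]> <[b]>; rewrite -DH -!orderE oa in oab.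
  have ob : #[b] %| 4.
    by rewrite order_dvdn (expgM b 2 2) bb -expgM -order_dvdn oa.
  by apply: (@dvdn_trans (10 * #[b])); [rewrite oab dvdn_mulr | rewrite (@dvdn_pmul2l 10 _ 4)].
have H10 : 10 %| #|H| by rewrite -oa order_dvdG.
exists {perm F}, (affine_group H); split.
- apply: (affine_group_solvable addH); have nsA : <[a]> <| H by rewrite /normal joing_subl join_subG normG.
  rewrite (series_sol nsA) (abelian_sol (cycle_abelian a)) /= norm_joinEr // quotientMidl.
  by rewrite abelian_sol // quotient_abelian ?cycle_abelian.
- apply: (affine_semi_rational (p := 3) (u := 1) (b := 2) addH regH) => //.
    by exists 1 => [|v]; rewrite ?group1 // perm1.
  move=> h Hh; case/Hcases: (Hh) => x Ax [Dh | Dh].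
    rewrite Dh; have : #[x] \in [:: 1; 2; 5; 10]%N.
      by have := order_dvdG Ax; rewrite -orderE oa dvdn_divisors // !inE.
    rewrite !inE => /or4P[] /eqP ox; try by apply: two_classes_small; rewrite ox.
      apply: (two_classes_index_two (u := 9) (b := 2)); last by rewrite ox.
      by rewrite -(a9 x Ax); apply: imset_f.
    apply: (two_classes_index_two (u := 9) (b := 3)); last by rewrite ox.
    by rewrite -(a9 x Ax); apply: imset_f.
  apply: two_classes_small; have : #[h] %| 4.
    by rewrite order_dvdn (expgM h 2 2) Dh square // -expgM -order_dvdn oa.
  by rewrite dvdn_divisors // !inE => /or3P[]/eqP->.
- rewrite (card_affine_group addH) cardF; move: H40 H10; rewrite dvdn_divisors // !inE.
  by move: #|H| => m; do ?[case/orP]; move=> /eqP->.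
- move=> x /(affine_order addH regH expF)[? | xH]; first by left.
  by right; apply: dvdn_trans xH H40.
by exists a; rewrite // (subsetP (sub_affine_group _)).
Qed.

(** * Classification *)

Lemma GK_nonadjacent (gT : finGroupType) (G : {group gT}) m1 m2 r s :
    (forall x, x \in G -> #[x] %| m1 \/ #[x] %| m2) ->
    ~~ (r * s %| m1) -> ~~ (r * s %| m2) ->
  ~~ GK_adj G r s.
Proof.
move=> oG n1 n2; apply/negP=> /andP[_ /existsP[x /andP[Gx /eqP ox]]].
by have := oG x Gx; rewrite ox (negPf n1) (negPf n2) => -[].
Qed.

Theorem seven_graphs_realized VE : VE \in seven_graphs ->
  exists gT : finGroupType, exists G : {group gT},
    [/\ solvable G, semi_rational G & VE = (GK_vertices G, GK_edges G)].
Proof.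
have pair a p u b (V : {fset nat}) : prime a -> prime p -> a %| p.-1 -> a \in [:: 2; 3] ->
    index_two p u b -> u ^ a = 1 %[mod p] -> V =i [:: a; p] ->
    (forall r, (r \in primes (p * a)) = (r \in [:: a; p])) -> ~~ (a * p %| p) -> ~~ (a * p %| a) ->
  exists gT : finGroupType, exists G : {group gT},
    [/\ solvable G, semi_rational G & (V, fset0) = (GK_vertices G, GK_edges G)].
- move=> pr_a pr_p ap a23 pub ua DV Dpr n1 n2.
  have a236 : a \in [:: 2; 3; 6] by move: a23; rewrite !inE => /orP[]->; rewrite ?orbT.
  have [|gT [G [solG rG oG ordG _]]] :=
    @cyclic_affine_group p 1 a u b pr_p isT _ a236 pub ua; first by rewrite expn1.
  exists gT, G; split=> //; rewrite (GK_pair_graph (a := a) (b := p) DV) //.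
    by move=> r; rewrite oG expn1 Dpr.
  exact: GK_nonadjacent ordG _ _.
have six p k u b (V : {fset nat}) : prime p -> 0 < k -> 6 %| (p ^ k).-1 ->
    index_two p u b -> u ^ 6 = 1 %[mod p] -> V =i [:: 2; 3; p] ->
    (forall r, (r \in primes (p ^ k * 6)) = (r \in [:: 2; 3; p])) ->
    ~~ (2 * p %| p) -> ~~ (2 * p %| 6) -> ~~ (3 * p %| p) -> ~~ (3 * p %| 6) ->
  exists gT : finGroupType, exists G : {group gT},
    [/\ solvable G, semi_rational G
      & (V, [fset [fset 2; 3]])%fset = (GK_vertices G, GK_edges G)].
- move=> pr_p k_gt0 d6 pub u6 DV Dpr n1 n2 n3 n4.
  have [gT [G [solG rG oG ordG [x Gx ox]]]] :=
    @cyclic_affine_group p k 6 u b pr_p k_gt0 d6 isT pub u6.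
  exists gT, G; split=> //; rewrite (GK_triple_graph (a := 2) (b := 3) (c := p) DV) //.
  - by move=> r; rewrite oG Dpr.
  - by apply: (mixed_order_adjacent Gx); rewrite ?ox.
  - exact: GK_nonadjacent ordG _ _.
  - exact: GK_nonadjacent ordG _ _.
rewrite !inE; do 6?[case/orP]; move=> /eqP->.
- by apply: (pair 2 3 1%N 2) => // r; rewrite !inE.
- by apply: (pair 2 5 4 2) => // r; rewrite !inE.
- by apply: (pair 3 7 2 3) => // r; rewrite !inE.
- have [gT [G [solG rG Dpr ordG [x Gx ox]]]] := dicyclic_affine_group.
  exists gT, G; split=> //.
  rewrite (GK_triple_graph (a := 2) (b := 5) (c := 3) (V := [fset 2; 3; 5]%fset)) //.
  - by move=> r; rewrite !inE -orbA; congr (_ || _); rewrite orbC.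
  - by move=> r; rewrite Dpr !inE; congr (_ || _); rewrite orbC.
  - by apply: (mixed_order_adjacent Gx); rewrite ?ox.
  - exact: GK_nonadjacent ordG _ _.
  - exact: GK_nonadjacent ordG _ _.
- by apply: (six 5 2 4 2) => // r; rewrite !inE ?orbA.
- by apply: (six 7 1%N 2 3) => // r; rewrite !inE ?orbA.
- by apply: (six 13 1%N 4 2) => // r; rewrite !inE ?orbA.
Qed.

Lemma prime_graph_eq (Gamma Delta : prime_graph) :
  (vertices Gamma, edges Gamma) = (vertices Delta, edges Delta) -> Gamma = Delta.
Proof.
case: Gamma Delta => [[V E] P] [[V' E'] P'] /=; rewrite /vertices /edges /= => DVE.
by case: DVE P P' => -> -> P P'; congr PrimeGraph; apply: bool_irrelevance.
Qed.

Theorem corollary3p2 (Gamma : prime_graph) (hGamma : disconnected Gamma) :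
  (exists (gT : finGroupType) (G : {group gT}),
     [/\ solvable G,
         character_quadratic G \/ semi_rational G &
         Gamma = GK_graph G])
  <->
  (vertices Gamma, edges Gamma) \in
    [:: ([fset 2; 3], fset0);
        ([fset 2; 5], fset0);
        ([fset 3; 7], fset0);
        ([fset 2; 3; 5], [fset [fset 2; 5]]);
        ([fset 2; 3; 5], [fset [fset 2; 3]]);
        ([fset 2; 3; 7], [fset [fset 2; 3]]);
        ([fset 2; 3; 13], [fset [fset 2; 3]])]%fset.
Proof.
split=> [[gT [G [solG qG DG]]] | /seven_graphs_realized[gT [G [solG rG DG]]]].
  rewrite DG in hGamma *; apply: disconnected_GK_graph => //.
  exact: quadratic_charactersP.
by exists gT, G; split; [| right | apply: prime_graph_eq].
Qed.
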